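(* Let $\chi\in\mathfrak g_{\bar 0}^*$ be a $p$-character with $\chi(\mathfrak n^+_{\bar 0})=\chi(\mathfrak n^-_{\bar 0})=0$ (so $\chi$ is semisimple), where $\mathfrak g=\mathfrak q(n)$ over $K$, and let $\lambda=(\lambda_1,\dots,\lambda_n)\in\Lambda_\chi$. Then the baby Verma module $Z_\chi(\lambda)$ is simple if and only if $\Phi(\lambda)\neq 0$, where $$\Phi(\lambda)=\prod_{1\le i<j\le n}\phi(\lambda_i,\lambda_j),\qquad \phi(x,y)=(x+y)(x-y-1)(x-y-2)\cdots(x-y-(p-1)).$$
   Context: $K$ is an algebraically closed field of characteristic $p>2$. $\mathfrak g=\mathfrak q(n)=\mathfrak g_{\bar 0}\oplus\mathfrak g_{\bar 1}$ is the Lie superalgebra of $2n\times 2n$ matrices $\begin{pmatrix} A & B \\ B & A \end{pmatrix}$, $A,B\in M_n(K)$, a subalgebra of $\mathfrak{gl}(n|n)$; even elements have $B=0$, odd elements have $A=0$. It is restricted, the $p$-th power map on $\mathfrak g_{\bar 0}\cong\mathfrak{gl}(n)$ being the matrix $p$-th power $x\mapsto x^{[p]}$. For $\chi\in\mathfrak g_{\bar 0}^*$ and a subalgebra $\mathfrak a$ whose even part is closed under $[p]$, $U_\chi(\mathfrak a)$ is the quotient of $U(\mathfrak a)$ by the ideal generated by $x^p-x^{[p]}-\chi(x)^p$, $x\in\mathfrak a_{\bar 0}$. $\mathfrak h=\mathfrak h_{\bar 0}\oplus\mathfrak h_{\bar 1}$ is the standard Cartan subalgebra ($A,B$ diagonal),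 with basis $h_i$ (even) and $H_i$ (odd), $1\le i\le n$, given by the $i$-th diagonal matrix unit in $A$, respectively $B$. Let $\{\varepsilon_i\}$ be the basis of $\mathfrak h_{\bar 0}^*$ dual to $\{h_i\}$; the roots are $\varepsilon_i-\varepsilon_j$, $i\ne j$, each root space having dimension $1|1$. A system of positive roots is fixed, with corresponding triangular decomposition $\mathfrak g=\mathfrak n^-\oplus\mathfrak h\oplus\mathfrak n^+$ and $\mathfrak b=\mathfrak h\oplus\mathfrak n^+$. $\Lambda_\chi=\{\lambda\in\mathfrak h_{\bar 0}^*: \lambda(h)^p-\lambda(h^{[p]})=\chi(h)^p\ \forall h\in\mathfrak h_{\bar 0}\}$; writing $\lambda_i=\lambda(h_i)$, this says $\lambda_i^p-\lambda_i=\chi(h_i)^p$ for all $i$. For $\lambda\in\Lambda_\chi$, let $\mathfrak h'_{\bar 1}\subset\mathfrak h_{\bar 1}$ be a maximal isotropic subspace for the symmetric form $(a|b)_\lambda=\lambda([a,b])$ on $\mathfrak h_{\bar 1}$; let $K_\lambda$ be the one-dimensional $U_\chi(\mathfrak h_{\bar 0}\oplus\mathfrak h'_{\bar 1})$-module on which $\mathfrak h_{\bar 0}$ acts via $\lambda$ and $\mathfrak h'_{\bar 1}$ acts by $0$; put $V_\chi(\lambda)=U_\chi(\mathfrak h)\otimes_{U_\chi(\mathfrak h_{\bar 0}\oplus\mathfrak h'_{\bar 1})}K_\lambda$ (an irreducible $U_\chi(\mathfrak h)$-module), extended to $\mathfrak b$ by letting $\mathfrak n^+$ act by $0$. The baby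 Verma module is $Z_\chi(\lambda)=U_\chi(\mathfrak g)\otimes_{U_\chi(\mathfrak b)}V_\chi(\lambda)$. Modules, submodules and simplicity are in the super ($\mathbb Z_2$-graded) sense. *)

(* Defs.v *)
From HB Require Import structures.
From mathcomp Require Import all_boot all_order all_algebra ring_quotient.
From mathcomp Require Import finmap boolp.
From mathcomp.multinomials Require Import monalg.

Set Implicit Arguments.
Unset Strict Implicit.
Unset Printing Implicit Defensive.

Import GRing.Theory.
Local Open Scope ring_scope.
Local Open Scope quotient_scope.


Section RingQuotient.
Variables (R : pzRingType) (P : R -> Prop).

Inductive ideal_gen : R -> Prop :=
| Ideal0 : ideal_gen 0
| IdealD x y : ideal_gen x -> ideal_gen y -> ideal_gen (x + y)
| IdealG a x b : P x -> ideal_gen (a * x * b).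

Definition ideal : {pred R} := fun x => `[< ideal_gen x >].

Lemma idealP x : reflect (ideal_gen x) (x \in ideal).
Proof. exact: asboolP. Qed.

Lemma ideal_genN x : ideal_gen x -> ideal_gen (- x).
Proof.
elim=> [|y z _ Hy _ Hz|a y b Py]; first by rewrite oppr0; exact: Ideal0.
  by rewrite opprD; exact: IdealD.
by rewrite -!mulNr; exact: IdealG.
Qed.

Lemma ideal_zmod : zmod_closed ideal.
Proof.
split=> [|x y /idealP Ix /idealP Iy]; apply/idealP; first exact: Ideal0.
exact/IdealD/ideal_genN.
Qed.

HB.instance Definition _ := GRing.isZmodClosed.Build R ideal ideal_zmod.

Lemma ideal_mull a x : x \in ideal -> a * x \in ideal.
Proof.
move=> /idealP Ix; apply/idealP; elim: Ix => [|y z _ Hy _ Hz|b y c Py].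
- by rewrite mulr0; exact: Ideal0.
- by rewrite mulrDr; exact: IdealD.
by rewrite 2!mulrA; exact: IdealG.
Qed.

Lemma ideal_mulr a x : x \in ideal -> x * a \in ideal.
Proof.
move=> /idealP Ix; apply/idealP; elim: Ix => [|y z _ Hy _ Hz|b y c Py].
- by rewrite mul0r; exact: Ideal0.
- by rewrite mulrDl; exact: IdealD.
by rewrite -mulrA; exact: IdealG.
Qed.

Definition rquot := Quotient.quot ideal.
HB.instance Definition _ := GRing.Zmodule.on rquot.
HB.instance Definition _ := EqQuotient.on rquot.

Definition rpi (x : R) : rquot := \pi_rquot x.

Lemma rpiP x y : reflect (rpi x = rpi y) (x - y \in ideal).
Proof. by rewrite (Quotient.idealrBE ideal); exact: eqP. Qed.

Lemma rpi_repr (u : rquot) : rpi (repr u) = u.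
Proof. exact: reprK. Qed.

Lemma rpi_surj (u : rquot) : exists x, u = rpi x.
Proof. by exists (repr u); rewrite rpi_repr. Qed.

Lemma rpiD x y : rpi (x + y) = rpi x + rpi y.
Proof. exact: (@Quotient.pi_add R ideal). Qed.

Definition rquot_mul (u v : rquot) : rquot := rpi (repr u * repr v).

Lemma rpiM x y : rpi (x * y) = rquot_mul (rpi x) (rpi y).
Proof.
apply/rpiP; rewrite -[x * y](subrK (x * repr (rpi y))) -mulrBr -addrA -mulrBl.
apply: rpredD.
  by apply: ideal_mull; apply/rpiP; rewrite rpi_repr.
by apply: ideal_mulr; apply/rpiP; rewrite rpi_repr.
Qed.

Fact rquot_mulA : associative rquot_mul.
Proof.
move=> u v w; have [x ->] := rpi_surj u; have [y ->] := rpi_surj v.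
by have [z ->] := rpi_surj w; rewrite -!rpiM mulrA.
Qed.

Fact rquot_mul1 : left_id (rpi 1) rquot_mul.
Proof. by move=> u; have [x ->] := rpi_surj u; rewrite -rpiM mul1r. Qed.

Fact rquot_mulr1 : right_id (rpi 1) rquot_mul.
Proof. by move=> u; have [x ->] := rpi_surj u; rewrite -rpiM mulr1. Qed.

Fact rquot_mulDl : left_distributive rquot_mul +%R.
Proof.
move=> u v w; have [x ->] := rpi_surj u; have [y ->] := rpi_surj v.
by have [z ->] := rpi_surj w; rewrite -rpiD -!rpiM -rpiD mulrDl.
Qed.

Fact rquot_mulDr : right_distributive rquot_mul +%R.
Proof.
move=> u v w; have [x ->] := rpi_surj u; have [y ->] := rpi_surj v.
by have [z ->] := rpi_surj w; rewrite -rpiD -!rpiM -rpiD mulrDr.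
Qed.

HB.instance Definition _ := GRing.Zmodule_isPzRing.Build rquot
  rquot_mulA rquot_mul1 rquot_mulr1 rquot_mulDl rquot_mulDr.

Fact rpi_additive : zmod_morphism rpi.
Proof.
move=> x y; apply: (addIr (rpi y)); rewrite -rpiD !subrK //.
Qed.
HB.instance Definition _ := GRing.isZmodMorphism.Build R rquot rpi rpi_additive.

Fact rpi_mult : monoid_morphism rpi.
Proof. by split=> // x y; rewrite rpiM. Qed.
HB.instance Definition _ := GRing.isMonoidMorphism.Build R rquot rpi rpi_mult.

Lemma rpi_rel x : P x -> rpi x = 0.
Proof.
move=> Px; rewrite -(rmorph0 rpi); apply/rpiP/idealP.
by rewrite subr0 -[x]mulr1 -[x]mul1r; exact: IdealG.
Qed.

Section Lift.
Variables (S : pzRingType) (f : {rmorphism R -> S}).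
Hypothesis fP : forall x, P x -> f x = 0.

Definition rquot_lift of (forall x, P x -> f x = 0) :=
  fun u : rquot => f (repr u).
Local Notation g := (rquot_lift fP).

Lemma rquot_liftE x : g (rpi x) = f x.
Proof.
apply/eqP; rewrite -subr_eq0 -rmorphB; apply/eqP.
have /rpiP/idealP : rpi (repr (rpi x)) = rpi x by rewrite rpi_repr.
elim=> [|y z _ fy _ fz|a y b Py]; first by rewrite rmorph0.
  by rewrite rmorphD fy fz addr0.
by rewrite !rmorphM (fP Py) mulr0 mul0r.
Qed.

Fact rquot_lift_additive : zmod_morphism g.
Proof.
move=> u v; have [x ->] := rpi_surj u; have [y ->] := rpi_surj v.
by rewrite -rmorphB !rquot_liftE rmorphB.
Qed.

Fact rquot_lift_mult : monoid_morphism g.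
Proof.
split=> [|u v]; first by rewrite -(rmorph1 rpi) rquot_liftE rmorph1.
have [x ->] := rpi_surj u; have [y ->] := rpi_surj v.
by rewrite -rmorphM !rquot_liftE rmorphM.
Qed.

HB.instance Definition _ :=
  GRing.isZmodMorphism.Build rquot S g rquot_lift_additive.
HB.instance Definition _ :=
  GRing.isMonoidMorphism.Build rquot S g rquot_lift_mult.
End Lift.
End RingQuotient.


Definition restr (S R : pzRingType) (phi : {rmorphism S -> R})
  (M : lmodType R) : Type := M.

Section Restriction.
Variables (S R : pzRingType) (phi : {rmorphism S -> R}) (M : lmodType R).
Local Notation N := (restr phi M).

HB.instance Definition _ := GRing.Zmodule.on N.

Definition restr_scale (s : S) (m : N) : N := phi s *: (m : M).

Fact restr_scaleA a b m :
  restr_scale a (restr_scale b m) = restr_scale (a * b) m.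
Proof. by rewrite /restr_scale scalerA rmorphM. Qed.
Fact restr_scale1 : left_id 1 restr_scale.
Proof. by move=> m; rewrite /restr_scale rmorph1 scale1r. Qed.
Fact restr_scaleDr : right_distributive restr_scale +%R.
Proof. by move=> s m m'; rewrite /restr_scale scalerDr. Qed.
Fact restr_scaleDl m : {morph restr_scale^~ m : a b / a + b}.
Proof. by move=> a b; rewrite /restr_scale rmorphD scalerDl. Qed.

HB.instance Definition _ := GRing.Zmodule_isLmodule.Build S N
  restr_scaleA restr_scale1 restr_scaleDr restr_scaleDl.
End Restriction.

Section FreeAbelian.
Variables (X : choiceType) (V : zmodType) (f : X -> V).

Definition fab_lift (g : {malg int[X]}) : V := \sum_(x <- msupp g) f x *~ g@_x.

Lemma fab_liftEw (d : {fset X}) g : (msupp g `<=` d)%fset ->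
  fab_lift g = \sum_(x <- d) f x *~ g@_x.
Proof.
move=> le; rewrite [LHS](big_fset_incl _ le) => //= x xd /mcoeff_outdom ->.
by rewrite mulr0z.
Qed.

Fact fab_lift_additive : zmod_morphism fab_lift.
Proof.
move=> g1 g2.
have le1 : (msupp g1 `<=` msupp (g1 - g2) `|` (msupp g1 `|` msupp g2))%fset.
  by apply/fsubsetP=> x; rewrite !in_fsetU => ->; rewrite orbT.
have le2 : (msupp g2 `<=` msupp (g1 - g2) `|` (msupp g1 `|` msupp g2))%fset.
  by apply/fsubsetP=> x; rewrite !in_fsetU => ->; rewrite !orbT.
have le0 : (msupp (g1 - g2) `<=`
            msupp (g1 - g2) `|` (msupp g1 `|` msupp g2))%fset.
  exact: fsubsetUl.
rewrite (fab_liftEw le0) (fab_liftEw le1) (fab_liftEw le2).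
by rewrite -sumrB; apply: eq_bigr => x _; rewrite mcoeffB mulrzBr.
Qed.
HB.instance Definition _ :=
  GRing.isZmodMorphism.Build {malg int[X]} V fab_lift fab_lift_additive.

Lemma fab_liftU x : fab_lift << x >> = f x.
Proof. by rewrite (fab_liftEw msuppU_le) big_seq_fset1 mcoeffUU mulr1z. Qed.
End FreeAbelian.

Section Extension.
Variables (S R : pzRingType) (phi : {rmorphism S -> R}) (M : lmodType S).

Local Notation F := {malg int[(R * M)%type]}.

(* The defining relations of the tensor product R (x)_S M, where S acts on R on
   the right through phi. *)
Inductive tensor_rel : F -> Prop :=
| TensorDl r r' m : tensor_rel (<< (r + r', m) >> - << (r, m) >> - << (r', m) >>)
| TensorDr r m m' : tensor_rel (<< (r, m + m') >> - << (r, m) >> - << (r, m') >>)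
| TensorS r s m : tensor_rel (<< (r * phi s, m) >> - << (r, s *: m) >>).

Inductive tensor_gen : F -> Prop :=
| TensorGen0 : tensor_gen 0
| TensorGenB x y : tensor_gen x -> tensor_gen y -> tensor_gen (x - y)
| TensorGenR x : tensor_rel x -> tensor_gen x.

Definition tensor_null : {pred F} := fun x => `[< tensor_gen x >].

Lemma tensor_nullP x : reflect (tensor_gen x) (x \in tensor_null).
Proof. exact: asboolP. Qed.

Lemma tensor_null_zmod : zmod_closed tensor_null.
Proof.
split=> [|x y /tensor_nullP Ix /tensor_nullP Iy]; apply/tensor_nullP.
  exact: TensorGen0.
exact: TensorGenB.
Qed.
HB.instance Definition _ :=
  GRing.isZmodClosed.Build F tensor_null tensor_null_zmod.

Definition ext_scalars := Quotient.quot tensor_null.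
Local Notation T := ext_scalars.
HB.instance Definition _ := GRing.Zmodule.on T.
HB.instance Definition _ := EqQuotient.on T.

Definition tpi (x : F) : T := \pi_T x.

Definition tensor (r : R) (m : M) : T := tpi << (r, m) >>.

Lemma tpiP x y : reflect (tpi x = tpi y) (x - y \in tensor_null).
Proof. by rewrite (Quotient.idealrBE tensor_null); exact: eqP. Qed.

Lemma tpi_repr (u : T) : tpi (repr u) = u.
Proof. exact: reprK. Qed.

Lemma tpi_surj (u : T) : exists x, u = tpi x.
Proof. by exists (repr u); rewrite tpi_repr. Qed.

Fact tpi_additive : zmod_morphism tpi.
Proof.
have tpiD x y : tpi (x + y) = tpi x + tpi y.
  exact: (@Quotient.pi_add _ tensor_null).
by move=> x y; apply: (addIr (tpi y)); rewrite -tpiD !subrK.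
Qed.
HB.instance Definition _ := GRing.isZmodMorphism.Build F T tpi tpi_additive.

Definition tensor_lmul (r : R) : F -> F :=
  fab_lift (fun z : R * M => << (r * z.1, z.2) >>).

HB.instance Definition _ r := GRing.Additive.on (tensor_lmul r).

Lemma tensor_lmulU r r' m : tensor_lmul r << (r', m) >> = << (r * r', m) >>.
Proof. exact: fab_liftU. Qed.

Lemma tensor_lmul_null r x : x \in tensor_null -> tensor_lmul r x \in tensor_null.
Proof.
move=> /tensor_nullP Ix; apply/tensor_nullP.
elim: Ix => [|y z _ Hy _ Hz|y [r1 r2 m|r1 m m'|r1 s m]].
- by rewrite raddf0; exact: TensorGen0.
- by rewrite raddfB; exact: TensorGenB.
- rewrite !raddfB /= !tensor_lmulU mulrDr; exact/TensorGenR/TensorDl.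
- rewrite !raddfB /= !tensor_lmulU; exact/TensorGenR/TensorDr.
- rewrite !raddfB /= !tensor_lmulU mulrA; exact/TensorGenR/TensorS.
Qed.

Definition ext_scale (r : R) (u : T) : T := tpi (tensor_lmul r (repr u)).

Lemma ext_scaleE r x : ext_scale r (tpi x) = tpi (tensor_lmul r x).
Proof.
apply/tpiP; rewrite -raddfB; apply: tensor_lmul_null.
by apply/tpiP; rewrite tpi_repr.
Qed.

Lemma malg_ind (A : F -> Prop) : A 0 -> (forall x y, A x -> A y -> A (x - y)) ->
  (forall r m, A << (r, m) >>) -> forall x, A x.
Proof.
move=> A0 AB AU x.
have AN y : A y -> A (- y) by move=> Ay; rewrite -sub0r; exact: AB.
have AD y z : A y -> A z -> A (y + z).
  by move=> Ay Az; rewrite -[z]opprK; apply: AB => //; exact: AN.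
have AMn y n : A y -> A (y *+ n).
  by move=> Ay; elim: n => [|n IH]; rewrite ?mulr0n // mulrS; exact: AD.
rewrite (monalgE x); apply: big_ind => // -[r m] _.
have -> : << x@_(r, m) *g (r, m) >> = << (r, m) >> *~ x@_(r, m) :> F.
  by rewrite -raddfMz; congr << _ *g _ >>; rewrite intz.
by case: (x@_(r, m)) => n; [|apply: (AN)]; apply: (AMn).
Qed.

Lemma ext_scalars_ind (A : T -> Prop) : A 0 ->
  (forall x y, A x -> A y -> A (x - y)) ->
  (forall r m, A (tensor r m)) -> forall x, A x.
Proof.
move=> A0 AB AU u; have [x ->] := tpi_surj u.
elim/malg_ind: x => [|x y Ax Ay|r m]; last exact: AU.
  by rewrite raddf0.
by rewrite raddfB; exact: AB.
Qed.

Fact ext_scaleDr : right_distributive ext_scale +%R.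
Proof.
move=> r u v; have [x ->] := tpi_surj u; have [y ->] := tpi_surj v.
by rewrite -raddfD !ext_scaleE !raddfD.
Qed.

Lemma ext_scale0 r : ext_scale r 0 = 0.
Proof. by rewrite -(raddf0 tpi) ext_scaleE !raddf0. Qed.

Lemma ext_scaleB r u v : ext_scale r (u - v) = ext_scale r u - ext_scale r v.
Proof. by apply: (addIr (ext_scale r v)); rewrite -ext_scaleDr !subrK. Qed.

Lemma ext_scaleU r r' m : ext_scale r (tensor r' m) = tensor (r * r') m.
Proof. by rewrite ext_scaleE tensor_lmulU. Qed.

Lemma tensorDl r r' m : tensor (r + r') m = tensor r m + tensor r' m.
Proof.
rewrite -raddfD; apply/tpiP/tensor_nullP/TensorGenR.
by rewrite opprD addrA; exact: TensorDl.
Qed.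

Lemma tensorDr r m m' : tensor r (m + m') = tensor r m + tensor r m'.
Proof.
rewrite -raddfD; apply/tpiP/tensor_nullP/TensorGenR.
by rewrite opprD addrA; exact: TensorDr.
Qed.

Lemma tensorS r s m : tensor (r * phi s) m = tensor r (s *: m).
Proof. by apply/tpiP/tensor_nullP/TensorGenR; exact: TensorS. Qed.

Fact ext_scaleA a b u : ext_scale a (ext_scale b u) = ext_scale (a * b) u.
Proof.
elim/ext_scalars_ind: u => [|u v IHu IHv|r m]; first by rewrite !ext_scale0.
  by rewrite !ext_scaleB IHu IHv.
by rewrite !ext_scaleU mulrA.
Qed.

Fact ext_scale1 : left_id 1 ext_scale.
Proof.
elim/ext_scalars_ind=> [|u v IHu IHv|r m]; first by rewrite !ext_scale0.
  by rewrite !ext_scaleB IHu IHv.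
by rewrite !ext_scaleU mul1r.
Qed.

Fact ext_scaleDl u : {morph ext_scale^~ u : a b / a + b}.
Proof.
move=> a b; elim/ext_scalars_ind: u => [|u v IHu IHv|r m].
- by rewrite !ext_scale0 addr0.
- by rewrite !ext_scaleB IHu IHv opprD addrACA.
by rewrite !ext_scaleU mulrDl tensorDl.
Qed.

HB.instance Definition _ := GRing.Zmodule_isLmodule.Build R T
  ext_scaleA ext_scale1 ext_scaleDr ext_scaleDl.
End Extension.

Arguments tensor {S R} phi {M} r m.


(* A grading of M is given by its two sets of homogeneous elements, the even
   ones (index false) and the odd ones (index true). *)

Section ExtHomog.
Variables (S R : pzRingType) (phi : {rmorphism S -> R}) (M : lmodType S).
Variables (grR : bool -> R -> Prop) (grM : bool -> M -> Prop) (d : bool).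

Inductive ext_homog : ext_scalars phi M -> Prop :=
| ExtHomog0 : ext_homog 0
| ExtHomogD x y : ext_homog x -> ext_homog y -> ext_homog (x + y)
| ExtHomogT e f r m : grR e r -> grM f m -> e (+) f = d ->
    ext_homog (tensor phi r m).
End ExtHomog.

Definition submodule (R : pzRingType) (M : lmodType R) (N : M -> Prop) :=
  N 0 /\ forall a x y, N x -> N y -> N (a *: x + y).

Definition graded_sub (V : zmodType) (gr : bool -> V -> Prop) (N : V -> Prop) :=
  forall x, N x -> exists x0 x1,
    [/\ gr false x0, gr true x1, N x0, N x1 & x = x0 + x1].

Definition supersimple (R : pzRingType) (M : lmodType R)
    (gr : bool -> M -> Prop) :=
  (exists x : M, x != 0) /\
  forall N : M -> Prop, submodule N -> graded_sub gr N ->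
    (forall x, N x -> x = 0) \/ (forall x, N x).


Definition falg (K : fieldType) (I : choiceType) : Type := {malg K[{fmonom I}]}.

(* The ring operations of {malg K[{fmonom I}]}, locked so that unification does
   not unfold them. *)
HB.lock Definition falg_one (K : fieldType) (I : choiceType) : falg K I :=
  (1 : {malg K[{fmonom I}]}).
HB.lock Definition falg_mul (K : fieldType) (I : choiceType) (x y : falg K I) :
  falg K I := (x : {malg K[{fmonom I}]}) * y.

Fact malg_scaleAr (K : fieldType) (I : choiceType) (c : K)
  (x y : {malg K[{fmonom I}]}) : c *: (x * y) = x * (c *: y).
Proof.
rewrite (scalerAl c x y) -(mul_malgC c x) -(mul_malgC c y) mulrA; congr (_ * y).
rewrite [LHS]fgmulUg [RHS]fgmulgU; apply: eq_bigr => k _.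
by rewrite mulrC mul1m mulm1.
Qed.

Section FreeAlgebra.
Variables (K : fieldType) (I : choiceType).
Local Notation M := {malg K[{fmonom I}]}.
Local Notation F := (falg K I).

HB.instance Definition _ := GRing.Lmodule.on F.

Local Notation mul := (@falg_mul K I).
Local Notation one := (falg_one K I).

Fact falg_mulA : associative mul.
Proof. by move=> x y z; rewrite falg_mul.unlock; exact: (@mulrA M). Qed.
Fact falg_mul1 : left_id one mul.
Proof. by move=> x; rewrite falg_mul.unlock falg_one.unlock; exact: (@mul1r M). Qed.
Fact falg_mulr1 : right_id one mul.
Proof. by move=> x; rewrite falg_mul.unlock falg_one.unlock; exact: (@mulr1 M). Qed.
Fact falg_mulDl : left_distributive mul +%R.
Proof. by move=> x y z; rewrite falg_mul.unlock; exact: (@mulrDl M). Qed.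
Fact falg_mulDr : right_distributive mul +%R.
Proof. by move=> x y z; rewrite falg_mul.unlock; exact: (@mulrDr M). Qed.
Fact falg_one_neq0 : one != 0.
Proof. by rewrite falg_one.unlock; exact: (@oner_neq0 M). Qed.
HB.instance Definition _ := GRing.Zmodule_isNzRing.Build F
  falg_mulA falg_mul1 falg_mulr1 falg_mulDl falg_mulDr falg_one_neq0.

Fact falg_scaleAl (c : K) (x y : F) : c *: mul x y = mul (c *: x) y.
Proof. by rewrite falg_mul.unlock; exact: (@scalerAl K M). Qed.
HB.instance Definition _ := GRing.Lmodule_isLalgebra.Build K F falg_scaleAl.

Fact falg_scaleAr (c : K) (x y : F) : c *: (x * y) = x * (c *: y).
Proof. by rewrite /GRing.mul /= falg_mul.unlock; exact: malg_scaleAr. Qed.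
HB.instance Definition _ := GRing.Lalgebra_isAlgebra.Build K F falg_scaleAr.

Definition fgen (i : I) : F := (<< fmu i >> : M).

Section Lift.
Variables (S : algType K) (f : I -> S).

Definition fmon_lift (m : {fmonom I}) : S := \prod_(i <- (m : seq I)) f i.

Fact fmon_lift_mult : mmorphism fmon_lift.
Proof.
split=> [x y|]; rewrite /fmon_lift.
  by rewrite /mmul /= fmmulE big_cat.
by rewrite fm1 big_nil.
Qed.
HB.instance Definition _ :=
  isMultiplicative.Build {fmonom I} S fmon_lift fmon_lift_mult.

Definition falg_lift : F -> S := fun x => mmap (in_alg S) fmon_lift (x : M).

Fact falg_lift_additive : zmod_morphism falg_lift.
Proof. exact: (@raddfB M S (mmap (in_alg S) fmon_lift)). Qed.
HB.instance Definition _ :=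
  GRing.isZmodMorphism.Build F S falg_lift falg_lift_additive.

Fact falg_lift_mult : monoid_morphism falg_lift.
Proof.
have [|fM f1] := @commr_mmap_is_multiplicative {fmonom I} K S (in_alg S) fmon_lift.
  by move=> g m m'; rewrite /GRing.comm mulr_algl mulr_algr.
split=> [|x y].
  by rewrite /GRing.one /= falg_one.unlock; exact: f1.
by rewrite /falg_lift {1}/GRing.mul /= falg_mul.unlock; exact: fM.
Qed.
HB.instance Definition _ :=
  GRing.isMonoidMorphism.Build F S falg_lift falg_lift_mult.

Fact falg_lift_scale : scalable falg_lift.
Proof. by move=> c x; rewrite /falg_lift (@mmapZ _ K S) mulr_algl. Qed.
HB.instance Definition _ :=
  GRing.isScalable.Build K F S *:%R falg_lift falg_lift_scale.

Lemma falg_lift_gen i : falg_lift (fgen i) = f i.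
Proof.
by rewrite /falg_lift mmapU /= scale1r mul1r /fmon_lift fmuE big_seq1.
Qed.
End Lift.

End FreeAlgebra.


Section Queer.
Variables (K : fieldType) (n : nat).
Local Notation gl := 'M[K]_(n + n).

(* Homogeneous elements of gl(n|n): even for d = false, odd for d = true. *)
Definition homog (d : bool) (x : gl) : Prop :=
  if d then ulsubmx x = 0 /\ drsubmx x = 0 else ursubmx x = 0 /\ dlsubmx x = 0.

(* The superbracket [x, y] of homogeneous x, y of parities d, e. *)
Definition sbracket (d e : bool) (x y : gl) : gl :=
  x *m y - (-1) ^+ (d && e) *: (y *m x).

Definition qelt (A B : 'M[K]_n) : gl := block_mx A B B A.
Definition qeven (i j : 'I_n) : gl := qelt (delta_mx i j) 0.
Definition qodd (i j : 'I_n) : gl := qelt 0 (delta_mx i j).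

Definition qspan (P : rel 'I_n) : {vspace gl} :=
  (\sum_i \sum_(j | P i j) (<[qeven i j]> + <[qodd i j]>))%VS.

Definition queer : {vspace gl} := qspan (fun _ _ => true).

Definition cartan : {vspace gl} := qspan (fun i j => i == j).
Definition cartan0 : {vspace gl} := (\sum_i <[qeven i i]>)%VS.
Definition cartan1 : {vspace gl} := (\sum_i <[qodd i i]>)%VS.

(* pos i j means that the root epsilon_i - epsilon_j is positive.  Exactly one
   of each pair of opposite roots is positive, and sums of positive roots that
   are roots are positive. *)
Definition positive_system (pos : rel 'I_n) : Prop :=
  [/\ irreflexive pos, transitive pos &
      forall i j, i != j -> pos i j (+) pos j i].

Definition npos (pos : rel 'I_n) : {vspace gl} := qspan pos.
Definition nneg (pos : rel 'I_n) : {vspace gl} := qspan (fun i j => pos j i).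
Definition borel (pos : rel 'I_n) : {vspace gl} := (cartan + npos pos)%VS.

Definition qsupp (P : rel 'I_n) (x : gl) : Prop :=
  [/\ drsubmx x = ulsubmx x, dlsubmx x = ursubmx x &
      forall i j, ~~ P i j -> ulsubmx x i j = 0 /\ ursubmx x i j = 0].

Lemma qelt_ul A B : ulsubmx (qelt A B) = A. Proof. exact: block_mxKul. Qed.
Lemma qelt_ur A B : ursubmx (qelt A B) = B. Proof. exact: block_mxKur. Qed.
Lemma qelt_dl A B : dlsubmx (qelt A B) = B. Proof. exact: block_mxKdl. Qed.
Lemma qelt_dr A B : drsubmx (qelt A B) = A. Proof. exact: block_mxKdr. Qed.
Definition qeltE := (qelt_ul, qelt_ur, qelt_dl, qelt_dr).

Fact ulsubmx_lin : linear (ulsubmx : gl -> 'M[K]_n).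
Proof. by move=> c x y; rewrite /ulsubmx !linearP. Qed.
Fact ursubmx_lin : linear (ursubmx : gl -> 'M[K]_n).
Proof. by move=> c x y; rewrite /ursubmx !linearP. Qed.
Fact dlsubmx_lin : linear (dlsubmx : gl -> 'M[K]_n).
Proof. by move=> c x y; rewrite /dlsubmx !linearP. Qed.
Fact drsubmx_lin : linear (drsubmx : gl -> 'M[K]_n).
Proof. by move=> c x y; rewrite /drsubmx !linearP. Qed.
HB.instance Definition _ := GRing.isLinear.Build K gl 'M[K]_n *:%R
  (ulsubmx : gl -> 'M[K]_n) ulsubmx_lin.
HB.instance Definition _ := GRing.isLinear.Build K gl 'M[K]_n *:%R
  (ursubmx : gl -> 'M[K]_n) ursubmx_lin.
HB.instance Definition _ := GRing.isLinear.Build K gl 'M[K]_n *:%R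
  (dlsubmx : gl -> 'M[K]_n) dlsubmx_lin.
HB.instance Definition _ := GRing.isLinear.Build K gl 'M[K]_n *:%R
  (drsubmx : gl -> 'M[K]_n) drsubmx_lin.

Lemma qsuppE P x : qsupp P x -> x = qelt (ulsubmx x) (ursubmx x).
Proof. by case=> e1 e2 _; rewrite -{1}[x]submxK e1 e2. Qed.

Lemma qelt_qsupp (P : rel 'I_n) (A B : 'M[K]_n) :
  (forall i j, ~~ P i j -> A i j = 0 /\ B i j = 0) -> qsupp P (qelt A B).
Proof. by move=> PAB; split; rewrite !qeltE. Qed.

Lemma qelt0 : qelt 0 0 = 0.
Proof. exact: block_mx0. Qed.

Lemma qsupp0 P : qsupp P 0.
Proof.
by rewrite -qelt0; apply: qelt_qsupp => i j _; rewrite mxE.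
Qed.

Lemma qsuppD P x y : qsupp P x -> qsupp P y -> qsupp P (x + y).
Proof.
move=> [e1 e2 e3] [f1 f2 f3]; split; rewrite ?linearD /= ?e1 ?e2 ?f1 ?f2 //=.
move=> i j ij; have [u1 u2] := e3 i j ij; have [v1 v2] := f3 i j ij.
by split; rewrite [LHS]mxE ?u1 ?u2 ?v1 ?v2 addr0.
Qed.

Lemma qsuppZ P c x : qsupp P x -> qsupp P (c *: x).
Proof.
move=> [e1 e2 e3]; split; rewrite ?linearZ /= ?e1 ?e2 //=.
move=> i j ij; have [u1 u2] := e3 i j ij.
by split; rewrite [LHS]mxE ?u1 ?u2 mulr0.
Qed.

Lemma qsupp_even (P : rel 'I_n) i j : P i j -> qsupp P (qeven i j).
Proof.
move=> Pij; apply: qelt_qsupp => k l Pkl; rewrite !mxE; split=> //.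
by case: andP Pkl => // -[/eqP -> /eqP ->]; rewrite Pij.
Qed.

Lemma qsupp_odd (P : rel 'I_n) i j : P i j -> qsupp P (qodd i j).
Proof.
move=> Pij; apply: qelt_qsupp => k l Pkl; rewrite !mxE; split=> //.
by case: andP Pkl => // -[/eqP -> /eqP ->]; rewrite Pij.
Qed.

Lemma mem_qspan P x : x \in qspan P -> qsupp P x.
Proof.
move=> /memv_sumP[v vP ->]; apply: big_ind; [exact: qsupp0|exact: qsuppD|].
move=> i _; have /memv_sumP[w wP ->] := vP i isT.
apply: big_ind; [exact: qsupp0|exact: qsuppD|] => j Pij.
have /memv_addP[_ /vlineP[c ->] [_ /vlineP[c' ->] ->]] := wP j Pij.
by apply: qsuppD; apply: qsuppZ; [exact: qsupp_even|exact: qsupp_odd].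
Qed.

Lemma qsupp_mem P x : qsupp P x -> x \in qspan P.
Proof.
move=> Px; rewrite (qsuppE Px).
have -> : qelt (ulsubmx x) (ursubmx x) = \sum_i \sum_(j | P i j)
    (ulsubmx x i j *: qeven i j + ursubmx x i j *: qodd i j).
  have qeltD A B A' B' : qelt (A + A') (B + B') = qelt A B + qelt A' B'.
    by rewrite /qelt add_block_mx.
  have qelt_sum I (r : seq I) (Q : pred I) (F G : I -> 'M[K]_n) :
      \sum_(k <- r | Q k) qelt (F k) (G k) =
      qelt (\sum_(k <- r | Q k) F k) (\sum_(k <- r | Q k) G k).
    elim: r => [|k r IH]; first by rewrite !big_nil qelt0.
    by rewrite !big_cons; case: (Q k); rewrite IH // -qeltD.
  under eq_bigr => i _.
    under eq_bigr => j _ do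
      rewrite /qeven /qodd /qelt !scale_block_mx add_block_mx !scaler0 !addr0
        !add0r -/(qelt _ _).
    rewrite qelt_sum; over.
  rewrite qelt_sum; congr qelt; rewrite [LHS]matrix_sum_delta;
    apply: eq_bigr => i _; rewrite [RHS]big_mkcond; apply: eq_bigr => j _;
    case: ifPn => // /(let: And3 _ _ H := Px in H i j) [e1 e2];
    by rewrite ?e1 ?e2 scale0r.
apply: memv_suml => i _; apply: (subvP (sumv_sup i isT (subvv _))).
apply: memv_suml => j Pij; apply: (subvP (sumv_sup j Pij (subvv _))).
by apply: memv_add; apply: memvZ; exact: memv_line.
Qed.

Lemma qspanP P x : x \in qspan P <-> qsupp P x.
Proof. by split; [exact: mem_qspan|exact: qsupp_mem]. Qed.

Lemma qspanS (P Q : rel 'I_n) : subrel P Q -> (qspan P <= qspan Q)%VS.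
Proof.
move=> PQ; apply/subvP => x /qspanP[e1 e2 e3]; apply/qspanP; split=> // i j nQ.
by apply: e3; apply: contra nQ; exact: PQ.
Qed.

Lemma borel_sub pos : (borel pos <= queer)%VS.
Proof. by apply/subvP/subvP; rewrite subv_add !qspanS. Qed.

Lemma borelP pos x : x \in borel pos -> qsupp [rel i j | (i == j) || pos i j] x.
Proof.
move=> /memv_addP[y /qspanP[e1 e2 e3] [z /qspanP[f1 f2 f3] ->]].
apply: qsuppD; split=> // i j /norP[ij pij]; [exact: e3|exact: f3].
Qed.

Lemma cartan0_sub : (cartan0 <= cartan)%VS.
Proof.
apply/subv_sumP => i _; rewrite -memvE; apply/qspanP.
by apply: qsupp_even; exact: eqxx.
Qed.

Lemma cartan1_sub : (cartan1 <= cartan)%VS.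
Proof.
apply/subv_sumP => i _; rewrite -memvE; apply/qspanP.
by apply: qsupp_odd; exact: eqxx.
Qed.

Lemma cartan0_ur x : x \in cartan0 -> ursubmx x = 0.
Proof.
move=> /memv_sumP[v vP ->]; rewrite linear_sum big1 // => i _.
by have /vlineP[c ->] := vP i isT; rewrite linearZ /= qelt_ur scaler0.
Qed.

Lemma cartan1_ul x : x \in cartan1 -> ulsubmx x = 0.
Proof.
move=> /memv_sumP[v vP ->]; rewrite linear_sum big1 // => i _.
by have /vlineP[c ->] := vP i isT; rewrite linearZ /= qelt_ul scaler0.
Qed.

(* The weight lam = (lam_1, ..., lam_n), evaluated on (the A-block of) an
   element of h_0. *)
Definition wt (lam : 'rV[K]_n) (A : 'M[K]_n) : K := \sum_i lam 0 i * A i i.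

Definition weight_set (p : nat) (chi : {scalar 'M[K]_n}) (lam : 'rV[K]_n) :=
  forall D : 'rV[K]_n,
    wt lam (diag_mx D) ^+ p - wt lam (diag_mx D ^+ p) = chi (diag_mx D) ^+ p.

(* chi(a_0) = 0. *)
Definition vanishes_on (chi : {scalar 'M[K]_n}) (a : {vspace gl}) : Prop :=
  forall x, x \in a -> homog false x -> chi (ulsubmx x) = 0.

Definition cartan_form (lam : 'rV[K]_n) (a b : gl) : K :=
  wt lam (ulsubmx (sbracket true true a b)).

Definition isotropic (lam : 'rV[K]_n) (W : {vspace gl}) : Prop :=
  forall a b, a \in W -> b \in W -> cartan_form lam a b = 0.

Definition max_isotropic (lam : 'rV[K]_n) (W : {vspace gl}) : Prop :=
  [/\ (W <= cartan1)%VS, isotropic lam W &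
      forall W' : {vspace gl}, (W' <= cartan1)%VS -> isotropic lam W' ->
        (W <= W')%VS -> W' = W].

Lemma cartan0W_sub W : (W <= cartan1)%VS -> (cartan0 + W <= cartan)%VS.
Proof.
by move=> W1; rewrite subv_add cartan0_sub (subv_trans W1 cartan1_sub).
Qed.

Lemma cartan0W_even W x : (W <= cartan1)%VS -> x \in (cartan0 + W)%VS ->
  ursubmx x = 0 -> x \in cartan0.
Proof.
move=> W1 /memv_addP[y hy [z /(subvP W1) hz ->]].
rewrite linearD /= (cartan0_ur hy) add0r => zur.
suff -> : z = 0 by rewrite addr0.
have /mem_qspan/qsuppE -> := subvP cartan1_sub _ hz.
by rewrite (cartan1_ul hz) zur qelt0.
Qed.

Lemma cartan0W_odd W x : (W <= cartan1)%VS -> x \in (cartan0 + W)%VS ->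
  ulsubmx x = 0 -> x \in W.
Proof.
move=> W1 /memv_addP[y hy [z hz ->]].
rewrite linearD /= (cartan1_ul (subvP W1 _ hz)) addr0 => yul.
suff -> : y = 0 by rewrite add0r.
have /mem_qspan/qsuppE -> := subvP cartan0_sub _ hy.
by rewrite (cartan0_ur hy) yul qelt0.
Qed.

(* The projection of b onto h along n^+. *)
Definition hdiag (A : 'M[K]_n) : 'M[K]_n := \matrix_(i, j) (A i j *+ (i == j)).
Definition hproj (x : gl) : gl := qelt (hdiag (ulsubmx x)) (hdiag (ursubmx x)).

Lemma hproj_cartan x : hproj x \in cartan.
Proof.
by apply/qspanP/qelt_qsupp => i j /negbTE ij; rewrite !mxE ij.
Qed.
End Queer.


Section Enveloping.
Variables (K : fieldType) (n p : nat) (chi : {scalar 'M[K]_n}).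
Local Notation gl := 'M[K]_(n + n).

Section Algebra.
Variable a : {vspace gl}.
Local Notation T := (falg K (subvs_of a)).

(* The free algebra on the set a modulo SuperRelD and SuperRelZ is the tensor
   algebra of a.  When a is closed under the superbracket, every instance of
   SuperRelB has exactly one z. *)
Inductive super_rel : T -> Prop :=
| SuperRelD x y : super_rel (fgen K (x + y) - fgen K x - fgen K y)
| SuperRelZ c x : super_rel (fgen K (c *: x) - c *: fgen K x)
| SuperRelB d e x y z : homog d (vsval x) -> homog e (vsval y) ->
    vsval z = sbracket d e (vsval x) (vsval y) ->
    super_rel (fgen K x * fgen K y - (-1) ^+ (d && e) *: (fgen K y * fgen K x)
               - fgen K z).

Definition Uenv := rquot super_rel.

(* The p-character chi is a linear form on gl(n), identified with the even part
   of q(n) through the A-block. *)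
Inductive restricted_rel : Uenv -> Prop :=
| RestrictedRel x z : homog false (vsval x) -> vsval z = vsval x ^+ p ->
    restricted_rel (rpi super_rel (fgen K x) ^+ p - rpi super_rel (fgen K z)
                    - rpi super_rel (chi (ulsubmx (vsval x)) ^+ p)%:A).

Definition Uchi := rquot restricted_rel.

Definition Uproj : {rmorphism T -> Uchi} := rpi restricted_rel \o rpi super_rel.
Definition Ugen (x : subvs_of a) : Uchi := Uproj (fgen K x).
Definition Uscal (c : K) : Uchi := Uproj c%:A.

(* The Z/2-grading of U_chi(a): sums of scalar multiples of products of
   homogeneous elements of a. *)
Inductive Uhomog : bool -> Uchi -> Prop :=
| UhomogC c : Uhomog false (Uscal c)
| UhomogD d u v : Uhomog d u -> Uhomog d v -> Uhomog d (u + v)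
| UhomogM d e x u : homog d (vsval x) -> Uhomog e u ->
    Uhomog (d (+) e) (Ugen x * u).

Section Lift.
Variables (S : pzRingType) (f : {rmorphism T -> S}).
Hypothesis fS : forall t, super_rel t -> f t = 0.
Hypothesis fR : forall x z, homog false (vsval x) -> vsval z = vsval x ^+ p ->
  f (fgen K x) ^+ p - f (fgen K z) - f (chi (ulsubmx (vsval x)) ^+ p)%:A = 0.

Fact Uchi_lift_subproof u : restricted_rel u -> rquot_lift fS u = 0.
Proof.
case=> x z x0 zx; rewrite !rmorphB rmorphXn /= !rquot_liftE; exact: fR.
Qed.

Definition Uchi_lift : {rmorphism Uchi -> S} := rquot_lift Uchi_lift_subproof.

Lemma Uchi_liftE t : Uchi_lift (Uproj t) = f t.
Proof. by apply: etrans; [exact: rquot_liftE|exact: rquot_liftE]. Qed.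
End Lift.
End Algebra.

Arguments Ugen {a} x.
Arguments Uscal {a} c.

Section Map.
Variables (a c : {vspace gl}) (f : subvs_of a -> subvs_of c).

(* Homomorphisms of Lie superalgebras compatible with [p] and chi. *)
Definition restricted_hom : Prop :=
  [/\ linear f,
      forall d x, homog d (vsval x) -> homog d (vsval (f x)),
      forall d e x y z, homog d (vsval x) -> homog e (vsval y) ->
        vsval z = sbracket d e (vsval x) (vsval y) ->
        vsval (f z) = sbracket d e (vsval (f x)) (vsval (f y)),
      forall x z, homog false (vsval x) -> vsval z = vsval x ^+ p ->
        vsval (f z) = vsval (f x) ^+ p &
      forall x, homog false (vsval x) ->
        chi (ulsubmx (vsval (f x))) = chi (ulsubmx (vsval x))].

Hypothesis f_hom : restricted_hom.

Let h : {rmorphism falg K (subvs_of a) -> falg K (subvs_of c)} :=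
  falg_lift (fun x => fgen K (f x)).

Let hgen x : h (fgen K x) = fgen K (f x). Proof. exact: falg_lift_gen. Qed.

Let hZ k t : h (k *: t) = k *: h t. Proof. exact: linearZ. Qed.

Fact map_super_rel t : super_rel t -> super_rel (h t).
Proof.
have [flin fhom fbr _ _] := f_hom.
have fD x y : f (x + y) = f x + f y by rewrite -[x]scale1r flin !scale1r.
have f0 : f 0 = 0 by apply: (addIr (f 0)); rewrite -fD !add0r.
have fZ k x : f (k *: x) = k *: f x by rewrite -[k *: x]addr0 flin f0 addr0.
case=> [x y|k x|d e x y z hx hy hz].
- rewrite (rmorphB h) (rmorphB h) !hgen fD; exact: SuperRelD.
- rewrite (rmorphB h) hZ !hgen fZ; exact: SuperRelZ.
rewrite (rmorphB h) (rmorphB h) hZ (rmorphM h) (rmorphM h) !hgen.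
by apply: SuperRelB; [exact: fhom|exact: fhom|exact: fbr].
Qed.

Let g : {rmorphism falg K (subvs_of a) -> Uchi c} := @Uproj c \o h.

Fact Uchi_map_super t : super_rel t -> g t = 0.
Proof.
move=> /map_super_rel tS.
have e : rpi (@super_rel c) (h t) = 0 by exact: rpi_rel.
by apply: (etrans (congr1 (rpi (@restricted_rel c)) e)); exact: rmorph0.
Qed.

Fact Uchi_map_restricted x z : homog false (vsval x) ->
  vsval z = vsval x ^+ p ->
  g (fgen K x) ^+ p - g (fgen K z) - g (chi (ulsubmx (vsval x)) ^+ p)%:A = 0.
Proof.
have [_ fhom _ fp fchi] := f_hom => hx hz.
have gE t : g t = rpi (@restricted_rel c) (rpi (@super_rel c) (h t)) by [].
rewrite !gE !hgen hZ (rmorph1 h) -fchi //.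
rewrite -(rmorphXn (rpi (@restricted_rel c))) -2!(rmorphB (rpi (@restricted_rel c))).
by apply: rpi_rel; apply: RestrictedRel; [exact: fhom|exact: fp].
Qed.

Definition Uchi_map : {rmorphism Uchi a -> Uchi c} :=
  Uchi_lift Uchi_map_super Uchi_map_restricted.

Lemma Uchi_mapE x : Uchi_map (Ugen x) = Ugen (f x).
Proof. by rewrite /Ugen Uchi_liftE /g /= falg_lift_gen. Qed.
End Map.

(* For a <= c, vsproj c restricts to the inclusion of a into c. *)
Fact incl_restricted_hom (a c : {vspace gl}) : (a <= c)%VS ->
  restricted_hom (fun x : subvs_of a => vsproj c (vsval x)).
Proof.
move=> ac; have E (x : subvs_of a) : vsval (vsproj c (vsval x)) = vsval x.
  by rewrite vsprojK // (subvP ac) // subvsP.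
split=> [k x y|d x|d e x y z|x z|x _]; rewrite ?E //.
by rewrite !linearP.
Qed.

Definition Uincl (a c : {vspace gl}) (ac : (a <= c)%VS) :
  {rmorphism Uchi a -> Uchi c} := Uchi_map (incl_restricted_hom ac).

End Enveloping.


Section HomLemmas.
Variables (K : fieldType) (n : nat).
Local Notation gl := 'M[K]_(n + n).

Lemma qelt_mul (A B A' B' : 'M[K]_n) :
  qelt A B *m qelt A' B' = qelt (A *m A' + B *m B') (A *m B' + B *m A').
Proof.
by rewrite /qelt mulmx_block [B *m A' + _]addrC [B *m B' + _]addrC.
Qed.

Lemma qelt1 : qelt 1 0 = 1 :> gl.
Proof. by rewrite /qelt -scalar_mx_block. Qed.

Lemma qelt_exp (A : 'M[K]_n) k : qelt A 0 ^+ k = qelt (A ^+ k) 0.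
Proof.
elim: k => [|k IH]; first by rewrite !expr0 qelt1.
rewrite !exprS IH; apply: etrans (qelt_mul _ _ _ _) _.
by rewrite !mulmx0 mul0mx !addr0.
Qed.

Lemma hdiag_lin : linear (@hdiag K n).
Proof. by move=> c A B; apply/matrixP=> i j; rewrite !mxE mulrnDl mulrnAr. Qed.

Lemma hproj_lin : linear (@hproj K n).
Proof.
move=> c x y; rewrite /hproj !linearP /= !hdiag_lin.
by rewrite /qelt scale_block_mx add_block_mx.
Qed.

Lemma hprojD x y : hproj (x + y) = hproj x + hproj y :> gl.
Proof. by rewrite -[x in LHS]scale1r hproj_lin scale1r. Qed.

Lemma hproj0 : hproj 0 = 0 :> gl.
Proof. by apply: (addIr (hproj 0)); rewrite -hprojD !add0r. Qed.

Lemma hprojZ c x : hproj (c *: x) = c *: hproj x :> gl.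
Proof. by rewrite -[c *: x]addr0 hproj_lin hproj0 addr0. Qed.

Lemma hprojB x y : hproj (x - y) = hproj x - hproj y :> gl.
Proof. by rewrite hprojD -scaleN1r hprojZ scaleN1r. Qed.

Lemma qsupp_uniq (P : rel 'I_n) (x : gl) (i j : 'I_n) :
  qsupp P x -> ~~ P i j -> ulsubmx x i j = 0 /\ ursubmx x i j = 0.
Proof. by case=> _ _; apply. Qed.

Variable pos : rel 'I_n.
Hypothesis posP : positive_system pos.
Let bpos : rel 'I_n := [rel i j | (i == j) || pos i j].

Lemma hdiag_mul (A B : 'M[K]_n) : (forall i j, ~~ bpos i j -> A i j = 0) ->
  (forall i j, ~~ bpos i j -> B i j = 0) ->
  hdiag (A *m B) = hdiag A *m hdiag B.
Proof.
have [pirr ptr _] := posP => A0 B0; apply/matrixP=> i j.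
have -> : (hdiag A *m hdiag B) i j = A i i * B i i *+ (i == j).
  rewrite mxE (bigD1 i) //= !mxE eqxx big1 ?addr0 => [|k /negbTE ki].
    by case: eqP => [<-|_]; rewrite ?mulr0n ?mulr0.
  by rewrite !mxE eq_sym ki mul0r.
rewrite !mxE; case: eqP => [<-|_]; last by rewrite !mulr0n.
congr (_ *+ _).
rewrite (bigD1 i) //= big1 ?addr0 // => k ki.
have [bik|/A0->] := boolP (bpos i k); last by rewrite mul0r.
have [bki|/B0->] := boolP (bpos k i); last by rewrite mulr0.
move: bik bki; rewrite /bpos /= eq_sym (negbTE ki) /= => ik ki'.
by have := pirr i; rewrite (ptr _ _ _ ik ki').
Qed.

Lemma mul_supp (A B : 'M[K]_n) : (forall i j, ~~ bpos i j -> A i j = 0) ->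
  (forall i j, ~~ bpos i j -> B i j = 0) ->
  forall i j, ~~ bpos i j -> (A *m B) i j = 0.
Proof.
have [_ ptr _] := posP => A0 B0 i j nij; rewrite mxE big1 // => k _.
have [bik|/A0->] := boolP (bpos i k); last by rewrite mul0r.
have [bkj|/B0->] := boolP (bpos k j); last by rewrite mulr0.
case/negP: nij; move: bik bkj; rewrite /bpos /=.
case/orP=> [/eqP-> //|ik]; case/orP=> [/eqP<-|kj]; first by rewrite ik orbT.
by rewrite (ptr _ _ _ ik kj) orbT.
Qed.

Lemma qsuppM (x y : gl) : qsupp bpos x -> qsupp bpos y ->
  qsupp bpos (x *m y) /\ hproj (x *m y) = hproj x *m hproj y.
Proof.
move=> Sx Sy; rewrite (qsuppE Sx) (qsuppE Sy) qelt_mul.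
have A0 i j : ~~ bpos i j -> ulsubmx x i j = 0 by case/(qsupp_uniq Sx).
have B0 i j : ~~ bpos i j -> ursubmx x i j = 0 by case/(qsupp_uniq Sx).
have C0 i j : ~~ bpos i j -> ulsubmx y i j = 0 by case/(qsupp_uniq Sy).
have D0 i j : ~~ bpos i j -> ursubmx y i j = 0 by case/(qsupp_uniq Sy).
split.
  by apply: qelt_qsupp => i j ij; split; rewrite [LHS]mxE !mul_supp ?addr0.
rewrite /hproj !qeltE qelt_mul.
have hD A B : hdiag (A + B) = hdiag A + hdiag B :> 'M[K]_n.
  by rewrite -[A in LHS]scale1r hdiag_lin scale1r.
by rewrite !hD !hdiag_mul.
Qed.

Lemma qsupp1 : qsupp bpos (1 : gl).
Proof.
rewrite -qelt1; apply: qelt_qsupp => i j /norP[/negbTE ij _].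
by rewrite !mxE ij.
Qed.

Lemma hproj1 : hproj 1 = 1 :> gl.
Proof.
rewrite -qelt1 /hproj !qeltE; congr qelt; apply/matrixP=> i j; rewrite !mxE.
  by case: eqP.
by rewrite mul0rn.
Qed.

Lemma qsuppX (x : gl) k : qsupp bpos x ->
  qsupp bpos (x ^+ k) /\ hproj (x ^+ k) = hproj x ^+ k.
Proof.
move=> Sx; elim: k => [|k [IH1 IH2]].
  by rewrite !expr0; split; [exact: qsupp1|exact: hproj1].
by have [S1 S2] := qsuppM Sx IH1; rewrite !exprS; split=> //; rewrite -IH2.
Qed.

Lemma hproj_restricted_hom p (chi : {scalar 'M[K]_n}) :
  vanishes_on chi (npos K pos) ->
  restricted_hom p chi
    (fun x : subvs_of (borel K pos) => vsproj (cartan K n) (hproj (vsval x))).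
Proof.
move=> chi0.
have E (x : gl) : vsval (vsproj (cartan K n) (hproj x)) = hproj x.
  by rewrite vsprojK // hproj_cartan.
have S (x : subvs_of (borel K pos)) : qsupp bpos (vsval x).
  by apply: borelP; exact: subvsP.
split=> [c x y|d x|d e x y z _ _|x z _|x [x1 x2]]; rewrite ?E.
- by rewrite linearP hproj_lin linearP.
- have hd0 : hdiag 0 = 0 :> 'M[K]_n by apply/matrixP=> i j; rewrite !mxE mul0rn.
  by rewrite /hproj; case: d => -[e1 e2]; split; rewrite !qeltE ?e1 ?e2.
- move=> ->; rewrite /sbracket hprojB hprojZ.
  by rewrite (qsuppM (S x) (S y)).2 (qsuppM (S y) (S x)).2.
- by move=> ->; rewrite (qsuppX p (S x)).2.
apply/eqP; rewrite -subr_eq0 -opprB oppr_eq0 -raddfB /=.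
rewrite /hproj qelt_ul; set D := _ - _.
have -> : D = ulsubmx (qelt D 0) by rewrite qelt_ul.
apply/eqP; apply: chi0; last by rewrite /homog !qeltE.
apply/qspanP/qelt_qsupp => i j ij; rewrite [LHS]mxE; split=> //; last by rewrite mxE.
rewrite [X in _ + X]mxE [X in _ - X]mxE; have [<-|nij] := eqVneq i j.
  by rewrite subrr.
have nb : ~~ bpos i j by rewrite /bpos /= negb_or nij.
by have [-> _] := qsupp_uniq (S x) nb; rewrite mul0rn subr0.
Qed.

Lemma wt_lin (lam : 'rV[K]_n) : scalar (wt lam).
Proof.
move=> c A B; rewrite /wt mulr_sumr -big_split; apply: eq_bigr => i _ /=.
by rewrite !mxE mulrDr mulrCA.
Qed.

Lemma wtD (lam : 'rV[K]_n) A B : wt lam (A + B) = wt lam A + wt lam B.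
Proof. by rewrite -[A in LHS]scale1r wt_lin mul1r. Qed.

Lemma wt0 (lam : 'rV[K]_n) : wt lam 0 = 0.
Proof. by rewrite /wt big1 // => i _; rewrite mxE mulr0. Qed.

Lemma wtZ (lam : 'rV[K]_n) c A : wt lam (c *: A) = c * wt lam A.
Proof. by rewrite -[c *: A]addr0 wt_lin wt0 addr0. Qed.
End HomLemmas.

Section BabyVerma.
Variables (K : fieldType) (n p : nat) (chi : {scalar 'M[K]_n}).
Variables (lam : 'rV[K]_n) (W : {vspace 'M[K]_(n + n)}).
Hypothesis lam_chi : weight_set p chi lam.
Hypothesis W_lam : max_isotropic lam W.

Local Notation gl := 'M[K]_(n + n).
Local Notation h0W := (cartan0 K n + W)%VS.

Let W_sub : (W <= cartan1 K n)%VS. Proof. by case: W_lam. Qed.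

(* h_0 acts by lam, and W by 0 because its elements have zero A-block. *)
Definition Klam_act (x : subvs_of h0W) : K^o := wt lam (ulsubmx (vsval x)).

Definition Klam_ev (t : falg K (subvs_of h0W)) : K := falg_lift Klam_act t.

Fact Klam_ev_additive : zmod_morphism Klam_ev.
Proof. exact: (raddfB (falg_lift Klam_act)). Qed.
HB.instance Definition _ := GRing.isZmodMorphism.Build
  (falg K (subvs_of h0W)) K Klam_ev Klam_ev_additive.

Fact Klam_ev_mult : monoid_morphism Klam_ev.
Proof.
split; first exact: (rmorph1 (falg_lift Klam_act)).
exact: (rmorphM (falg_lift Klam_act)).
Qed.
HB.instance Definition _ := GRing.isMonoidMorphism.Build
  (falg K (subvs_of h0W)) K Klam_ev Klam_ev_mult.

Let ev : {rmorphism falg K (subvs_of h0W) -> K} := Klam_ev.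

Let evE x : ev (fgen K x) = Klam_act x. Proof. exact: (falg_lift_gen Klam_act x). Qed.

Let evZ c t : ev (c *: t) = c * ev t.
Proof. exact: (falg_lift_scale Klam_act c t). Qed.

Fact Klam_super t : super_rel t -> ev t = 0.
Proof.
have actD x y : Klam_act (x + y) = Klam_act x + Klam_act y.
  by rewrite /Klam_act !linearD wtD.
have actZ c x : Klam_act (c *: x) = c * Klam_act x.
  by rewrite /Klam_act !linearZ /= wtZ.
have S (x : subvs_of h0W) : qsupp (fun i j => i == j) (vsval x).
  exact/mem_qspan/(subvP (cartan0W_sub W_sub))/subvsP.
have odd0 (x : subvs_of h0W) : homog true (vsval x) -> Klam_act x = 0.
  by case=> e _; rewrite /Klam_act e wt0.
case=> [x y|c x|d e x y z hx hy hz].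
- by rewrite (rmorphB ev) (rmorphB ev) !evE actD -addrA -opprD subrr.
- by rewrite (rmorphB ev) evZ !evE actZ subrr.
rewrite (rmorphB ev) (rmorphB ev) evZ (rmorphM ev) (rmorphM ev) !evE.
have Ez : Klam_act z = wt lam (ulsubmx (sbracket d e (vsval x) (vsval y))).
  by rewrite -hz.
case: d e hx hy hz Ez => -[] hx hy hz Ez.
- have [_ iso _] := W_lam.
  rewrite (odd0 _ hx) (odd0 _ hy) !(mul0r, mulr0) subrr sub0r Ez.
  apply/eqP; rewrite oppr_eq0; apply/eqP; apply: iso.
    by apply: cartan0W_odd W_sub (subvsP x) _; case: hx.
  by apply: cartan0W_odd W_sub (subvsP y) _; case: hy.
- rewrite (odd0 _ hx) !(mul0r, mulr0) subrr sub0r Ez.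
  rewrite (qsuppE (S x)) (qsuppE (S y)) (_ : ulsubmx (vsval x) = 0); last by case: hx.
  rewrite (_ : ursubmx (vsval y) = 0); last by case: hy.
  rewrite /sbracket !qelt_mul !(mul0mx, mulmx0) !addr0 linearB linearZ /=.
  by rewrite !qeltE scaler0 subrr wt0 oppr0.
- rewrite (odd0 _ hy) !(mul0r, mulr0) subrr sub0r Ez.
  rewrite (qsuppE (S x)) (qsuppE (S y)) (_ : ulsubmx (vsval y) = 0); last by case: hy.
  rewrite (_ : ursubmx (vsval x) = 0); last by case: hx.
  rewrite /sbracket !qelt_mul !(mul0mx, mulmx0) !add0r linearB linearZ /=.
  by rewrite !qeltE scaler0 subrr wt0 oppr0.
rewrite [Klam_act y * _]mulrC mul1r subrr sub0r Ez.
rewrite (qsuppE (S x)) (qsuppE (S y)) (_ : ursubmx (vsval y) = 0); last by case: hy.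
rewrite (_ : ursubmx (vsval x) = 0); last by case: hx.
rewrite /sbracket !qelt_mul !(mul0mx, mulmx0) !addr0 scale1r linearB /= !qeltE.
have diagc (A B : 'M[K]_n) : (forall i j, i != j -> A i j = 0) ->
    (forall i j, i != j -> B i j = 0) -> A *m B = B *m A.
  move=> A0 B0; apply/matrixP=> i j; rewrite !mxE.
  apply: eq_bigr => k _; have [->|ik] := eqVneq i k.
    have [->|kj] := eqVneq k j; first by rewrite mulrC.
    by rewrite (B0 _ _ kj) (A0 _ _ kj) !mulr0.
  by rewrite (A0 _ _ ik) (B0 _ _ ik) !mul0r.
rewrite (diagc (ulsubmx (vsval x)) (ulsubmx (vsval y))) ?subrr ?wt0 ?oppr0 //.
  by move=> i j; case/(qsupp_uniq (S x)).
by move=> i j; case/(qsupp_uniq (S y)).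
Qed.

Fact Klam_restricted x z : homog false (vsval x) -> vsval z = vsval x ^+ p ->
  ev (fgen K x) ^+ p - ev (fgen K z) - ev (chi (ulsubmx (vsval x)) ^+ p)%:A = 0.
Proof.
move=> hx hz; rewrite evZ (rmorph1 ev) mulr1 !evE /Klam_act hz.
have Sx : qsupp (fun i j => i == j) (vsval x).
  exact/mem_qspan/(subvP (cartan0W_sub W_sub))/subvsP.
rewrite (qsuppE Sx) (_ : ursubmx (vsval x) = 0); last by case: hx.
rewrite qelt_exp !qeltE.
have -> : ulsubmx (vsval x) = diag_mx (\row_i ulsubmx (vsval x) i i).
  apply/matrixP=> i j; rewrite [RHS]mxE; have [<-|ij] := eqVneq i j.
    by rewrite [RHS]mxE.
  by have [-> _] := qsupp_uniq Sx ij; rewrite mulr0n.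
by rewrite lam_chi subrr.
Qed.

Definition Klam : lmodType (Uchi p chi h0W) :=
  restr (Uchi_lift Klam_super Klam_restricted) K^o.

(* K_lambda is purely even. *)
Definition Klam_homog (d : bool) (v : Klam) : Prop := d -> v = 0.

Definition Vchi : lmodType (Uchi p chi (cartan K n)) :=
  ext_scalars (Uincl p chi (cartan0W_sub W_sub)) Klam.

Definition Vchi_homog : bool -> Vchi -> Prop :=
  ext_homog (@Uhomog K n p chi (cartan K n)) Klam_homog.

Variable pos : rel 'I_n.
Hypothesis pos_sys : positive_system pos.
Hypothesis chi_npos : vanishes_on chi (npos K pos).

(* Vchi extended to b, n^+ acting by 0. *)
Definition Vchi_borel : lmodType (Uchi p chi (borel K pos)) :=
  restr (Uchi_map (hproj_restricted_hom pos_sys p chi_npos)) Vchi.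

Definition baby_Verma : lmodType (Uchi p chi (queer K n)) :=
  ext_scalars (Uincl p chi (borel_sub K pos)) Vchi_borel.

Definition baby_Verma_homog : bool -> baby_Verma -> Prop :=
  ext_homog (M := Vchi_borel) (@Uhomog K n p chi (queer K n)) Vchi_homog.

End BabyVerma.

Definition phi (K : fieldType) (p : nat) (x y : K) : K :=
  (x + y) * \prod_(1 <= k < p) (x - y - k%:R).

Definition Phi (K : fieldType) (p n : nat) (lam : 'rV[K]_n) : K :=
  \prod_(i < n) \prod_(j < n | (i < j)%N) phi p (lam 0 i) (lam 0 j).

(* Main.v *)
From HB Require Import structures.
Require Import Defs.
From mathcomp Require Import all_boot all_order all_algebra.
From mathcomp Require Import finmap zify ring boolp.
From mathcomp.multinomials Require Import monalg.

Set Implicit Arguments.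
Unset Strict Implicit.
Unset Printing Implicit Defensive.

Import Order.TTheory GRing.Theory Num.Theory.
Local Open Scope ring_scope.

(* Order the indices so that eps_i - eps_j is positive for i before j.  Let T be
   the product, over the negative roots, of e_ji^(p-1) E_ji, and T+ its analogue
   for the positive roots.  A rank one computation gives
   e^(p-1) E f^(p-1) F v = - phi(lam_i, lam_j) v for a singular vector v, and going
   from the given order to the opposite one by adjacent transpositions gives
   T+ T v = +-Phi(lam) v for every v in V(lam).
   If Phi(lam) <> 0, a nonzero homogeneous x in a submodule is multiplied by a
   complementary word of negative root vectors to +-T y with 0 <> y in V(lam), so
   the submodule contains Phi(lam) y, hence V(lam) by irreducibility of Clifford
   modules, hence everything.
   If Phi(lam) = 0, then T u T v0 = 0 for all u in U_chi(g), so U_chi(g) T v0 does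
   not contain v0.  It remains to see that T v0 <> 0; instead of a
   Poincare-Birkhoff-Witt theorem, this uses a module in which it is visible: the
   oscillator representation of q(n) on n^2 bosonic and n^2 fermionic modes, with
   the occupation numbers of the bosons read modulo p. *)

(** Ordered monomials in the negative root vectors are only shown to span; their linear independence
    is never established. What replaces it is a degree on words, bounded on monomials with
    admissible exponents, so that from the top degree on reordering is exact up to sign. A root word
    e^(p-1) E has weight p times a root, which is zero in K. The weight lam therefore survives every
    transposition, and each rank one factor is phi at two of the original lam_i. T u T v0 = 0 in the
    degenerate case because T v0 is singular for the opposite order: u T v0 is a combination of
    raising words on the Cartan span of T v0. A raising word other than the full one stays strictly
    below V(lam), and T kills that part for degree reasons; the full one produces the factor
    Phi(lam) = 0. As Z is built as a quotient, nothing rules out Z = 0 a priori. In the oscillator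
    module the bosons are cyclic at diagonal sites, so that every lam occurs as a weight, and
    truncated elsewhere, so that creation kills a full site and annihilation an empty one. *)

(* [(false, (i, j))] stands for e_ij and [(true, (i, j))] for E_ij. *)
Definition letter (n : nat) : Type := (bool * ('I_n * 'I_n))%type.
HB.instance Definition _ n := Finite.on (letter n).

(** Only the supercommutators and the nilpotency of the even root vectors are kept from a
    U_chi(g)-module, so that one set of lemmas serves both the baby Verma module and the oscillator
    module. *)
Record queer_action (K : fieldType) (p n : nat) (V : lmodType K)
  (X : letter n -> {linear V -> V}) : Prop := QueerAction {
  queer_bracket : forall d e i j k l v,
    X (d, (i, j)) (X (e, (k, l)) v) =
      (-1) ^+ (d && e) *: X (e, (k, l)) (X (d, (i, j)) v)
      + ((j == k)%:R *: X (d (+) e, (i, l)) v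
         - ((-1) ^+ (d && e) * (l == i)%:R) *: X (d (+) e, (k, j)) v);
  queer_nilpotent : forall i j v, i != j -> iter p (X (false, (i, j))) v = 0 }.

Fixpoint act (K : fieldType) (n : nat) (V : lmodType K)
  (X : letter n -> {linear V -> V}) (w : seq (letter n)) (v : V) : V :=
  if w is l :: w' then X l (act X w' v) else v.

Section Act.
Variables (K : fieldType) (n : nat) (V : lmodType K).
Variable X : letter n -> {linear V -> V}.
Local Notation act := (act X).

Fact act_linear w : linear (act w).
Proof. by elim: w => //= l w IH c x y; rewrite IH linearP. Qed.
HB.instance Definition _ w := GRing.isLinear.Build K V V *:%R (act w) (act_linear w).

Lemma act_cat w1 w2 v : act (w1 ++ w2) v = act w1 (act w2 v).
Proof. by elim: w1 => //= l w1 ->. Qed.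

Lemma act_nseq k l v : act (nseq k l) v = iter k (X l) v.
Proof. by elim: k => //= k ->. Qed.
End Act.

(** * Rank one *)

Section RankOne.
Variables (K : fieldType) (p n : nat) (V : lmodType K).
Variable X : letter n -> {linear V -> V}.
Hypotheses (p_char : p \in [pchar K]) (p_gt2 : (2 < p)%N).
Hypothesis qX : queer_action p X.
Local Notation ev i j := (X (false, (i, j))).
Local Notation od i j := (X (true, (i, j))).

Lemma two_neq0 : (2%:R : K) != 0.
Proof. by rewrite -(dvdn_pcharf p_char) gtnNdvd. Qed.

Lemma double_eq0 (x : V) : x + x = 0 -> x = 0.
Proof.
move=> x2; apply: (scalerI two_neq0); rewrite scaler0.
by rewrite scaler_nat mulr2n.
Qed.

Lemma odd_sq0 i j v : i != j -> od i j (od i j v) = 0.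
Proof.
move=> ij; apply: double_eq0; have := queer_bracket qX true true i j i j v.
rewrite eq_sym (negbTE ij) /= expr1 scale0r mulr0 scale0r subrr addr0 scaleN1r.
by move=> {1}->; rewrite addNr.
Qed.

Lemma odd_sq i v : od i i (od i i v) = ev i i v.
Proof.
have := queer_bracket qX true true i i i i v.
rewrite eqxx /= expr1 mulr1 !scaleN1r scale1r opprK => E.
apply/eqP; rewrite -subr_eq0; apply/eqP; apply: double_eq0.
have {}E : od i i (od i i v) + od i i (od i i v) = ev i i v + ev i i v.
  by rewrite {1}E addrAC addNr add0r.
by rewrite addrACA -opprD E subrr.
Qed.

Section Pair.
Variables i j : 'I_n.
Hypothesis ij : i != j.
Let ji : j != i. Proof. by rewrite eq_sym. Qed.
Let br := queer_bracket qX.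
Local Notation simp := (eqxx, negbTE ij, negbTE ji, expr0, expr1, scale1r, scale0r,
   mul1r, mulr1, mulr0, subr0, addr0, sub0r, add0r, scaleN1r, opprK, scaleNr).

Lemma weight_shift d k l a m v : ev a a v = m *: v ->
  ev a a (X (d, (k, l)) v) = (m + (a == k)%:R - (l == a)%:R) *: X (d, (k, l)) v.
Proof.
move=> av; rewrite br /= expr0 scale1r av linearZ /= mul1r.
have -> : (a == k)%:R *: X (d, (a, l)) v = (a == k)%:R *: X (d, (k, l)) v.
  by case: eqP => [->|] //; rewrite !scale0r.
have -> : (l == a)%:R *: X (d, (k, a)) v = (l == a)%:R *: X (d, (k, l)) v.
  by case: eqP => [->|] //; rewrite !scale0r.
by rewrite -scalerBl -scalerDl addrA.
Qed.

(** Write e, E and f, F for the even and odd root vectors of (i, j) and (j, i), and H = E_ii - E_jj.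
    The relation is [H, f] = - 2 F; it is needed because H is what commuting e with F, or E with f,
    leaves behind. *)
Lemma Hdiff_f u : od i i (ev j i u) - od j j (ev j i u) =
  ev j i (od i i u - od j j u) - 2%:R *: od j i u.
Proof.
rewrite (br true false i i j i) (br true false j j j i) /= !simp raddfB /=.
by rewrite opprD addrACA -opprD scaler_nat mulr2n.
Qed.

Lemma fF u : ev j i (od j i u) = od j i (ev j i u).
Proof. by rewrite br /= !simp. Qed.

Lemma fkF k u : iter k (ev j i) (od j i u) = od j i (iter k (ev j i) u).
Proof. by elim: k => //= k ->; rewrite fF. Qed.

Lemma Hdiff_fk k u :
  od i i (iter k.+1 (ev j i) u) - od j j (iter k.+1 (ev j i) u) =
  iter k.+1 (ev j i) (od i i u - od j j u)
    - (2 * k.+1)%:R *: od j i (iter k (ev j i) u).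
Proof.
elim: k => [|k IH]; first by rewrite /= Hdiff_f.
rewrite [iter k.+2 _ u]iterS Hdiff_f IH.
rewrite raddfB /= linearZ /= fF -!addrA; congr (_ + _).
by rewrite -opprD -scalerDl -natrD -mulnSr.
Qed.

Section Singular.
Variables (x y : K) (v : V).
Hypotheses (sing : forall d, X (d, (i, j)) v = 0).
Hypotheses (wi : ev i i v = x *: v) (wj : ev j j v = y *: v).

Lemma iterZ k l c u : iter k (X l) (c *: u) = c *: iter k (X l) u.
Proof. by elim: k => //= k ->; rewrite linearZ. Qed.

Lemma iterD k l u w : iter k (X l) (u + w) = iter k (X l) u + iter k (X l) w.
Proof. by elim: k => //= k ->; rewrite linearD. Qed.

Lemma wt_fk k : ev i i (iter k (ev j i) v) = (x - k%:R) *: iter k (ev j i) v /\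
  ev j j (iter k (ev j i) v) = (y + k%:R) *: iter k (ev j i) v.
Proof.
elim: k => [|k [IH1 IH2]]; first by rewrite /= subr0 addr0.
rewrite !iterS (weight_shift _ _ _ IH1) (weight_shift _ _ _ IH2) !simp.
by rewrite -[k.+1%:R]natr1 opprD !addrA.
Qed.

Lemma ef u : ev i j (ev j i u) = ev j i (ev i j u) + (ev i i u - ev j j u).
Proof. by rewrite br /= !simp. Qed.

Lemma eF u : ev i j (od j i u) = od j i (ev i j u) + (od i i u - od j j u).
Proof. by rewrite br /= !simp. Qed.

Lemma Ef u : od i j (ev j i u) = ev j i (od i j u) + (od i i u - od j j u).
Proof. by rewrite br /= !simp. Qed.

Lemma EF u : od i j (od j i u) = - od j i (od i j u) + (ev i i u + ev j j u).
Proof. by rewrite br /= !simp. Qed.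

Lemma e_fk k : ev i j (iter k.+1 (ev j i) v) =
  (k.+1%:R * (x - y - k%:R)) *: iter k (ev j i) v.
Proof.
elim: k => [|k IH]; first by rewrite /= ef sing raddf0 wi wj add0r -scalerBl !simp.
rewrite [iter k.+2 _ v]iterS ef IH linearZ /= -iterS.
have [-> ->] := wt_fk k.+1; rewrite -scalerBl -scalerDl; congr (_ *: _).
by rewrite !mulrSr; ring.
Qed.

Lemma efk k : iter k (ev i j) (iter k (ev j i) v) =
  (\prod_(0 <= t < k) (t.+1%:R * (x - y - t%:R))) *: v.
Proof.
elim: k => [|k IH]; first by rewrite big_nil scale1r.
by rewrite iterSr e_fk iterZ IH scalerA big_nat_recr // mulrC.
Qed.

Let v1 := od i i v - od j j v.

(** Pushing E through the powers of f creates H, and pushing H further creates F. The exponent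
    starts at 2 so that both resulting terms have natural exponents. *)
Lemma E_fk k : od i j (iter k.+2 (ev j i) v) =
  k.+2%:R *: iter k.+1 (ev j i) v1
  - (k.+1 * k.+2)%:R *: od j i (iter k (ev j i) v).
Proof.
elim: k => [|k IH].
  rewrite /= Ef Ef sing raddf0 add0r -/v1 Hdiff_f -/v1 addrA.
  by rewrite !scaler_nat mulr2n.
rewrite [iter k.+3 _ v]iterS Ef IH Hdiff_fk -/v1 raddfB /= !linearZ /=.
rewrite fF addrACA -scalerDl -natrD -[X in _ + X + _ = _]scale1r -scalerDl natr1.
by congr (_ + _%:R *: _); lia.
Qed.

(** H v is singular again, with the same weight as v, so the sl_2 computation of [e_fk] also applies
    to it. *)
Lemma v1_sing d : X (d, (i, j)) v1 = 0.
Proof.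
by rewrite raddfB /= (br d true i j i i) (br d true i j j j) /= !simp !sing !raddf0 ?scaler0 ?simp.
Qed.

Lemma v1_wt : ev i i v1 = x *: v1 /\ ev j j v1 = y *: v1.
Proof.
have H a m k : ev a a v = m *: v -> ev a a (od k k v) = m *: od k k v.
  move=> av; rewrite (weight_shift _ _ _ av) eq_sym [k == a]eq_sym addrK //.
split; rewrite raddfB /=.
  by rewrite (H _ _ _ wi) (H _ _ _ wi) scalerBr.
by rewrite (H _ _ _ wj) (H _ _ _ wj) scalerBr.
Qed.

(** E_ii and E_jj anticommute and square to e_ii and e_jj, so H^2 acts on v by x + y. This is the
    origin of the factor x + y in phi. *)
Lemma Hdiff_v1 : od i i v1 - od j j v1 = (x + y) *: v.
Proof.
rewrite !raddfB /= !odd_sq wi wj.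
have -> : od i i (od j j v) = - od j j (od i i v).
  by rewrite br /= !simp.
by rewrite !opprK addrA addrK -scalerDl.
Qed.
End Singular.

Section Composite.
Variables (x y : K) (v : V).
Hypotheses (sing : forall d, X (d, (i, j)) v = 0).
Hypotheses (wi : ev i i v = x *: v) (wj : ev j j v = y *: v).
Let v1 := od i i v - od j j v.

Lemma e_Ffk k : ev i j (od j i (iter k.+1 (ev j i) v1)) =
  (k.+1%:R * (x - y - k.+2%:R)) *: od j i (iter k (ev j i) v1)
  + (x + y) *: iter k.+1 (ev j i) v.
Proof.
have [w1 w2] := v1_wt wi wj.
rewrite eF (e_fk (v1_sing sing) w1 w2) linearZ /= Hdiff_fk.
rewrite (Hdiff_v1 wi wj) iterZ addrA addrAC -scalerBl; congr (_ *: _ + _).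
by rewrite natrM [k.+2%:R]mulrSr [k.+1%:R]mulrSr; ring.
Qed.

(** Each step of [e_Ffk] leads either to F f^k v1 or to f^(k+1) v. With z = x - y the two
    contributions combine through (k+1)(z - k - 2) + z = (k+2)(z - k - 1). *)
Lemma ek_Ffk k : iter k.+1 (ev i j) (od j i (iter k (ev j i) v1)) =
  ((x + y) * \prod_(0 <= t < k.+1) t.+1%:R * \prod_(1 <= t < k.+1) (x - y - t%:R)) *: v.
Proof.
elim: k => [|k IH].
  rewrite /= eF (v1_sing sing) raddf0 add0r (Hdiff_v1 wi wj).
  by rewrite big_nat1 big_geq // !mulr1.
rewrite iterSr e_Ffk iterD !iterZ IH (efk sing wi wj) !scalerA -scalerDl.
congr (_ *: _); rewrite big_split /= [X in _ + _ * (_ * X)]big_ltn // subr0.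
rewrite [\prod_(0 <= t < k.+2) _]big_nat_recr //= [\prod_(1 <= t < k.+2) _]big_nat_recr //=.
set P := \prod_(0 <= i < k.+1) _; set Q := \prod_(1 <= i < k.+1) _.
by rewrite -[k.+2%:R]natr1 -[k.+1%:R]natr1; ring.
Qed.

(** As p - 1 = -1 in K and F^2 = 0, moving E past F leaves F f^(p-2) H v + (x + y) f^(p-1) v. After
    e^(p-1) the two terms share the factor (x + y) (p-1)! times the product of x - y - t for 0 < t <
    p - 1, with cofactors 1 and x - y; their sum 1 + x - y is the missing factor x - y - (p-1). The
    sign is Wilson's theorem. *)
Lemma rank_one :
  act X (nseq p.-1 (false, (i, j)) ++ [:: (true, (i, j))])
    (act X (nseq p.-1 (false, (j, i)) ++ [:: (true, (j, i))]) v) =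
  - phi p x y *: v.
Proof.
have p_pr : prime p by case/andP: p_char.
have pm1 : p.-1%:R = -1 :> K.
  apply/eqP; rewrite -subr_eq0 opprK natr1 prednK ?prime_gt0 //.
  by case/andP: p_char.
have wilson : \prod_(0 <= t < p.-1) t.+1%:R = -1 :> K.
  apply/eqP; rewrite -subr_eq0 opprK -natr_prod natr1.
  have -> : (\prod_(0 <= t < p.-1) t.+1 = p.-1`!)%N by rewrite fact_prod big_add1.
  by rewrite -(dvdn_pcharf p_char) -Wilson ?prime_gt1.
rewrite !act_cat !act_nseq /= fkF.
(* [E_fk] wants the exponent p - 1 in the form [m.+2], which p > 2 allows. *)
have [m Em] : exists m, p.-1 = m.+2.
  by case: (p) p_gt2 => [|[|[|m]]] // _; exists m.
have Ep : p = m.+3 by rewrite -Em prednK // prime_gt0.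
rewrite Em in pm1 wilson *.
rewrite EF (E_fk sing).
have linF a b (u w : V) : od j i (a *: u - b *: w) = a *: od j i u - b *: od j i w.
  by rewrite raddfB /= !linearZ.
rewrite linF odd_sq0 // scaler0 subr0.
rewrite -/v1 pm1 scaleN1r opprK.
have [-> ->] := wt_fk wi wj m.+2.
rewrite -scalerDl addrACA addNr addr0 iterD iterZ ek_Ffk (efk sing wi wj).
rewrite scalerA -scalerDl; congr (_ *: _).
rewrite big_split /= wilson [X in _ + _ * (_ * X)]big_ltn // subr0.
have -> : phi p x y = (x + y) * (\prod_(1 <= t < m.+2) (x - y - t%:R) * (x - y - m.+2%:R)).
  by rewrite /phi Ep big_nat_recr.
by rewrite pm1; ring.
Qed.
End Composite.
End Pair.
End RankOne.

(** * Lowering and raising words *)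

Definition root_word (p n : nat) (r : 'I_n * 'I_n) : seq (letter n) :=
  nseq p.-1 (false, r) ++ [:: (true, r)].

(** The rightmost letters act first: the order a :: t becomes a :: rev t, then a is moved past rev
    t. The word thus follows a reduced decomposition of the longest permutation, with one root word
    for each pair. *)
Fixpoint lowering_word (p n : nat) (s : seq 'I_n) : seq (letter n) :=
  if s is a :: t then
    flatten [seq root_word p (b, a) | b <- t] ++ lowering_word p t
  else [::].

(** Undoes the transpositions of [lowering_word] in the opposite order, with each root replaced by
    its negative. *)
Fixpoint raising_word (p n : nat) (s : seq 'I_n) : seq (letter n) :=
  if s is a :: t then
    raising_word p t ++ flatten [seq root_word p (a, b) | b <- rev t]
  else [::].

Fixpoint chain_coef (K : fieldType) (p n : nat) (lam : 'I_n -> K) (s : seq 'I_n) : K :=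
  if s is a :: t then
    \prod_(b <- t) - phi p (lam a) (lam b) * chain_coef p lam t
  else 1.

Section Chain.
Variables (K : fieldType) (p n : nat) (V : lmodType K).
Variable X : letter n -> {linear V -> V}.
Hypotheses (p_char : p \in [pchar K]) (p_gt2 : (2 < p)%N).
Hypothesis qX : queer_action p X.
Local Notation act := (act X).
Let br := queer_bracket qX.

Definition kills (v : V) : rel 'I_n :=
  fun a b => `[< forall d, X (d, (a, b)) v = 0 >].

Lemma killsP v a b : reflect (forall d, X (d, (a, b)) v = 0) (kills v a b).
Proof. exact: asboolP. Qed.

(** When [s] lists all indices, these are the vectors killed by the nilradical of the Borel
    subalgebra whose positive roots are eps_a - eps_b with a before b. *)
Definition singular (s : seq 'I_n) (v : V) := pairwise (kills v) s.

Definition has_weight (lam : 'I_n -> K) (v : V) :=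
  forall a, X (false, (a, a)) v = lam a *: v.

Lemma has_weightZ lam c v : has_weight lam v -> has_weight lam (c *: v).
Proof. by move=> wv a; rewrite linearZ /= wv !scalerA mulrC. Qed.

Lemma root_word_letter (r : 'I_n * 'I_n) l : l \in root_word p r -> l.2 = r.
Proof.
rewrite mem_cat => /orP[/nseqP[->] //|]; rewrite inE => /eqP-> //.
Qed.

Lemma size_root_word (r : 'I_n * 'I_n) : size (root_word p r) = p.
Proof. by rewrite size_cat size_nseq addn1 prednK //; apply: ltn_trans p_gt2. Qed.

(** The p letters of a root word belong to the same root, so every weight is shifted by a multiple
    of p. *)
Lemma has_weight_root_word (lam : 'I_n -> K) r v :
  has_weight lam v -> has_weight lam (act (root_word p r) v).
Proof.
case: r => k l wv a.
have H w : (forall x, x \in w -> x.2 = (k, l)) ->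
    X (false, (a, a)) (act w v) =
    (lam a + (size w)%:R * ((a == k)%:R - (l == a)%:R)) *: act w v.
  elim: w => [|[d [k' l']] w IH] Hw /=; first by rewrite wv mul0r addr0.
  have [-> ->] := Hw _ (mem_head _ _).
  rewrite (weight_shift qX d k l (IH _)); last first.
    by move=> x xw; apply: Hw; rewrite inE xw orbT.
  by congr (_ *: _); rewrite -natr1; ring.
rewrite H; last exact: root_word_letter.
by rewrite size_root_word (pcharf0 p_char) mul0r addr0.
Qed.

Section Swap.
Variables (i j : 'I_n).
Hypothesis ij : i != j.
Let ji : j != i. Proof. by rewrite eq_sym. Qed.

Lemma kills_left (a : 'I_n) d v : a != i -> a != j -> kills v a i && kills v a j ->
  kills (X (d, (j, i)) v) a i && kills (X (d, (j, i)) v) a j.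
Proof.
move=> ai aj /andP[/killsP vi /killsP vj]; apply/andP; split; apply/killsP=> e;
  rewrite br vi ?vj !(eqxx, negbTE ij, negbTE ji, eq_sym i a, negbTE ai) /=;
  by rewrite ?(raddf0, mulr0, scale0r, scaler0, subr0, addr0) //= ?vi ?scaler0.
Qed.

Lemma kills_right (b : 'I_n) d v : b != i -> b != j -> kills v i b && kills v j b ->
  kills (X (d, (j, i)) v) i b && kills (X (d, (j, i)) v) j b.
Proof.
move=> bi bj /andP[/killsP vi /killsP vj]; apply/andP; split; apply/killsP=> e;
  rewrite br ?vi ?vj !(eqxx, negbTE ij, negbTE ji, negbTE bj) /=;
  by rewrite ?(raddf0, mulr0, scale0r, scaler0, subr0, addr0) //= ?vj ?scaler0.
Qed.

Lemma kills_other (a b : 'I_n) d v : a != i -> b != j -> kills v a b ->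
  kills (X (d, (j, i)) v) a b.
Proof.
move=> ai bj /killsP vab; apply/killsP=> e.
rewrite br vab (negbTE bj) (eq_sym i a) (negbTE ai).
by rewrite !(raddf0, mulr0, scale0r, scaler0, subr0, addr0).
Qed.

Lemma kills_swap v : kills (act (root_word p (j, i)) v) j i.
Proof.
apply/killsP=> -[]; rewrite act_cat act_nseq /=.
  by rewrite -(fkF qX ij) (odd_sq0 p_char p_gt2 qX _ ji) -act_nseq linear0.
by rewrite -iterS prednK ?(queer_nilpotent qX) //; apply: ltn_trans p_gt2.
Qed.

Lemma root_word_preserves (P : V -> Prop) v :
  (forall d u, P u -> P (X (d, (j, i)) u)) -> P v ->
  P (act (root_word p (j, i)) v).
Proof.
move=> HP Pv; have : forall x, x \in root_word p (j, i) -> x.2 = (j, i).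
  exact: root_word_letter.
elim: root_word => //= -[d kl] w IH Hw; have /= -> := Hw _ (mem_head _ _).
by apply: HP; apply: IH => x xw; apply: Hw; rewrite inE xw orbT.
Qed.

(** An analogue of an odd reflection at the simple root eps_i - eps_j. The root vectors for (a, i)
    and (a, j) are stable together under brackets with those of (j, i), as are those for (i, b) and
    (j, b), so they keep killing the vector. The new positive root eps_j - eps_i kills it because
    e_ji^p = 0 and E_ji^2 = 0. *)
Lemma singular_swap u w v : uniq (u ++ i :: j :: w) -> singular (u ++ i :: j :: w) v ->
  singular (u ++ j :: i :: w) (act (root_word p (j, i)) v).
Proof.
set v' := act _ v.
rewrite cat_uniq /= !inE !negb_or => /and3P[_ /and3P[iu ju wu] /and3P[/andP[_ iw] jw _]].
rewrite /singular !pairwise_cat !allrel_consr /= => /and5P[/and3P[ui uj uw] pu /andP[_ iw'] jw' pw].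
have nu a : a \in u -> (a != i) * (a != j).
  by move=> au; split; [apply: contra iu|apply: contra ju] => /eqP<-.
have nw b : b \in w -> (b != i) * (b != j).
  by move=> bw; split; [apply: contra iw|apply: contra jw] => /eqP<-.
have U a : a \in u -> kills v' a i && kills v' a j.
  move=> au; have [ai aj] := nu a au.
  apply: (@root_word_preserves (fun v => kills v a i && kills v a j)).
    by move=> d x; apply: kills_left.
  by rewrite (allP ui _ au) (allP uj _ au).
have W b : b \in w -> kills v' i b && kills v' j b.
  move=> bw; have [bi bj] := nw b bw.
  apply: (@root_word_preserves (fun v => kills v i b && kills v j b)).
    by move=> d x; apply: kills_right.
  by rewrite (allP iw' _ bw) (allP jw' _ bw).
have O a b : a != i -> b != j -> kills v a b -> kills v' a b.
  move=> ai bj; apply: (@root_word_preserves (fun v => kills v a b)) => d x.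
  exact: kills_other.
apply/and5P; split; [apply/and3P; split| |apply/andP; split| |].
- by apply/allP=> a /U/andP[].
- by apply/allP=> a /U/andP[].
- apply/allrelP=> a b au bw; apply: O; [by rewrite nu|by rewrite nw|].
  exact: (allrelP uw).
- apply: (@sub_in_pairwise _ [in u] _ _ _ _ _ pu); last exact/allP.
  by move=> a b au bu; apply: O; rewrite nu.
- exact: kills_swap.
- by apply/allP=> b /W/andP[].
- by apply/allP=> b /W/andP[].
- apply: (@sub_in_pairwise _ [in w] _ _ _ _ _ pw); last exact/allP.
  by move=> a b au bu; apply: O; rewrite nw.
Qed.
End Swap.

Variable lam : 'I_n -> K.

(** Undoing the transpositions, last one first, always meets a multiple of the root word of (b, a)
    on a vector that is singular for (a, b) and of weight lam; [rank_one] then supplies one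
    factor. *)
Lemma move_chain u a t w v : uniq (u ++ a :: t ++ w) ->
  singular (u ++ a :: t ++ w) v -> has_weight lam v ->
  let v' := act (flatten [seq root_word p (b, a) | b <- rev t]) v in
  [/\ singular (u ++ t ++ a :: w) v', has_weight lam v' &
      act (flatten [seq root_word p (a, b) | b <- t]) v' =
      (\prod_(b <- t) - phi p (lam a) (lam b)) *: v].
Proof.
elim: t u v => [|b t IH] u v Hu Hs Hw; first by split; rewrite ?big_nil ?scale1r.
have ab : a != b.
  by move: Hu; rewrite cat_uniq [uniq (a :: _)]cons_uniq inE negb_or => /and3P[_ _ /andP[/andP[]]].
have S1 : singular (rcons u b ++ a :: t ++ w) (act (root_word p (b, a)) v).
  by rewrite cat_rcons; apply: singular_swap.
have U1 : uniq (rcons u b ++ a :: t ++ w).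
  rewrite cat_rcons -(perm_uniq (s1 := u ++ [:: a, b & t ++ w])) //.
  by rewrite perm_cat2l; apply/permPl/(perm_catCA [:: a] [:: b]).
have W1 := has_weight_root_word (b, a) Hw.
have [S2 W2 E2] := IH _ _ U1 S1 W1.
rewrite rev_cons map_rcons flatten_rcons act_cat.
split=> //; first by rewrite cat_rcons in S2.
have Kab d : X (d, (a, b)) v = 0.
  apply/killsP; move: Hs; rewrite /singular pairwise_cat /=.
  by move=> /and3P[_ _ /andP[/andP[]]].
rewrite /= act_cat E2 linearZ /= (rank_one p_char p_gt2 qX ab Kab (Hw a) (Hw b)).
by rewrite big_cons scalerA mulrC.
Qed.

Lemma lowering_chain u t w v : uniq (u ++ t ++ w) ->
  singular (u ++ t ++ w) v -> has_weight lam v ->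
  let v' := act (lowering_word p t) v in
  [/\ singular (u ++ rev t ++ w) v', has_weight lam v' &
      act (raising_word p t) v' = chain_coef p lam t *: v].
Proof.
elim: t u v => [|a t IH] u v Hu Hs Hw; first by rewrite /= scale1r.
have [] := IH (rcons u a) v; rewrite ?cat_rcons //.
set v1 := act (lowering_word p t) v => S1 W1 E1.
have [] := @move_chain u a (rev t) w v1 _ S1 W1.
  rewrite -(perm_uniq (s1 := u ++ a :: t ++ w)) // perm_cat2l perm_cons perm_cat2r.
  by rewrite perm_sym perm_rev.
rewrite revK; set v2 := act _ v1 => S2 W2 E2.
have E3 : act (lowering_word p (a :: t)) v = v2 by rewrite /= act_cat.
rewrite E3; split=> //; first by rewrite rev_cons cat_rcons.
rewrite /= act_cat E2 linearZ /= E1 scalerA; congr (_ * _ *: _).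
by apply: perm_big; rewrite perm_rev.
Qed.

Lemma chain_coef_neq0 s : (chain_coef p lam s != 0) =
  pairwise (fun a b => phi p (lam a) (lam b) != 0) s.
Proof.
elim: s => [|a t IH] /=; first by rewrite oner_neq0.
rewrite mulf_eq0 negb_or IH; congr (_ && _).
by elim: t {IH} => [|b t IH]; rewrite ?big_nil ?oner_neq0 // big_cons mulf_eq0 negb_or oppr_eq0 IH.
Qed.
End Chain.

(** * Words in negative root vectors *)

(** An inductive span, since the modules come without basis or dimension; conditions on height and
    parity are carried by the spanning predicate. *)
Inductive kspan (K : fieldType) (V : lmodType K) (B : V -> Prop) : V -> Prop :=
| KSpan0 : kspan B 0
| KSpanD c x y : B x -> kspan B y -> kspan B (c *: x + y).

Section KSpan.
Variables (K : fieldType) (V : lmodType K).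
Implicit Types B C : V -> Prop.

Lemma kspan_incl B x : B x -> kspan B x.
Proof. by move=> Bx; rewrite -[x]addr0 -[x]scale1r; apply: KSpanD => //; exact: KSpan0. Qed.

Lemma kspan_add B x y : kspan B x -> kspan B y -> kspan B (x + y).
Proof.
move=> + By; elim=> [|c u v Bu _ IH]; first by rewrite add0r.
by rewrite -addrA; apply: KSpanD.
Qed.

Lemma kspan_scale B c x : kspan B x -> kspan B (c *: x).
Proof.
elim=> [|d u v Bu _ IH]; first by rewrite scaler0; exact: KSpan0.
by rewrite scalerDr scalerA; apply: KSpanD.
Qed.

Lemma kspan_opp B x : kspan B x -> kspan B (- x).
Proof. by move=> Bx; rewrite -scaleN1r; apply: kspan_scale. Qed.

Lemma kspan_sub B C x : (forall y, B y -> kspan C y) -> kspan B x -> kspan C x.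
Proof.
move=> BC; elim=> [|c u v Bu _ IH]; first exact: KSpan0.
by apply: kspan_add => //; apply: kspan_scale; exact: BC.
Qed.

Lemma kspan_eq0 B x : (forall y, B y -> y = 0) -> kspan B x -> x = 0.
Proof.
by move=> B0; elim=> // c u v /B0-> _ ->; rewrite scaler0 addr0.
Qed.
End KSpan.

Lemma kspan_linear (K : fieldType) (V W : lmodType K) (f : {linear V -> W})
  (B : V -> Prop) (C : W -> Prop) x :
  (forall y, B y -> kspan C (f y)) -> kspan B x -> kspan C (f x).
Proof.
move=> BC; elim=> [|c u v Bu _ IH]; first by rewrite linear0; exact: KSpan0.
rewrite linearD linearZ /=; apply: kspan_add => //; apply: kspan_scale; exact: BC.
Qed.

Section Words.
Variables (K : fieldType) (p n : nat) (V : lmodType K).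
Variable X : letter n -> {linear V -> V}.
Hypotheses (p_char : p \in [pchar K]) (p_gt2 : (2 < p)%N).
Hypothesis qX : queer_action p X.
Local Notation act := (act X).
Let br := queer_bracket qX.
Variable r : 'I_n -> int.

(** The rank function [r] stays abstract because it is used with both signs: the position in the
    positive order, and its negative, which exchanges lowering and raising letters. *)
Definition lowering (l : letter n) : bool := r l.2.2 < r l.2.1.
Definition height (l : letter n) : int := r l.2.1 - r l.2.2.
Definition wheight (w : seq (letter n)) : int := \sum_(l <- w) height l.
Definition wparity (w : seq (letter n)) : bool := \big[addb/false]_(l <- w) l.1.

Lemma wheight_cons l w : wheight (l :: w) = height l + wheight w.
Proof. exact: big_cons. Qed.

Lemma wparity_cons l w : wparity (l :: w) = l.1 (+) wparity w.
Proof. exact: big_cons. Qed.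

(** The error terms of reordering: the bracket of two lowering letters is a combination of lowering
    letters of the summed height and parity, so a commutator shortens a word and preserves these two
    invariants. *)
Definition shorter (w : seq (letter n)) (v x : V) : Prop :=
  exists w', [/\ all lowering w', (size w' < size w)%N, wheight w' = wheight w,
                 wparity w' = wparity w & x = act w' v].

Lemma shorter_perm w1 w2 v x : perm_eq w1 w2 -> shorter w1 v x -> shorter w2 v x.
Proof.
move=> w12 [w [w1' w2' w3' w4' w5']]; exists w; split=> //.
- by rewrite -(perm_size w12).
- by rewrite w3' /wheight (perm_big _ w12).
by rewrite w4' /wparity (perm_big _ w12).
Qed.

Lemma shorter_cons l w v x : lowering l ->
  kspan (shorter w v) x -> kspan (shorter (l :: w) v) (X l x).
Proof.
move=> Ll; apply: kspan_linear => _ [w' [w1 w2 w3 w4 ->]]; apply: kspan_incl.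
exists (l :: w'); split=> //=; first by rewrite Ll.
  by rewrite !wheight_cons w3.
by rewrite !wparity_cons w4.
Qed.

Lemma lowering_swap l m w v : lowering l -> lowering m -> all lowering w ->
  kspan (shorter (l :: m :: w) v)
    (X l (X m (act w v)) - (-1) ^+ (l.1 && m.1) *: X m (X l (act w v))).
Proof.
case: l m => [d [i j]] [e [k l]] /= ij kl Lw.
rewrite br addrC addKr /=.
have W (i' j' : 'I_n) : r j' < r i' ->
    r i' - r j' = r i - r j + (r k - r l) ->
    kspan (shorter [:: (d, (i, j)), (e, (k, l)) & w] v) (X (d (+) e, (i', j')) (act w v)).
  move=> L H; apply: kspan_incl; exists ((d (+) e, (i', j')) :: w).
  split=> //=; first by apply/andP; split.
    by rewrite !wheight_cons addrA; congr (_ + _).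
  by rewrite !wparity_cons addbA.
rewrite /lowering /= in ij kl.
apply: kspan_add.
  case: eqP => [jk|_]; last by rewrite scale0r; exact: KSpan0.
  by apply/kspan_scale/W; move: ij kl; rewrite -?jk; lia.
apply: kspan_opp; case: eqP => [li|_]; last by rewrite mulr0 scale0r; exact: KSpan0.
by apply/kspan_scale/W; move: ij kl; rewrite -?li; lia.
Qed.

Lemma lowering_front a l b v : all lowering (a ++ l :: b) ->
  exists s : bool, kspan (shorter (a ++ l :: b) v)
    (act (a ++ l :: b) v - (-1) ^+ s *: act (l :: a ++ b) v).
Proof.
elim: a => [|m a IH] /=.
  by exists false; rewrite scale1r subrr; exact: KSpan0.
move=> /andP[Lm La]; have [s Hs] := IH La.
have Ll : lowering l by move: La; rewrite all_cat /= => /and3P[].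
have Lab : all lowering (a ++ b) by move: La; rewrite !all_cat /= => /and3P[-> _].
exists (s (+) (m.1 && l.1)).
rewrite -(subrK ((-1) ^+ s *: X m (X l (act (a ++ b) v))) (X m _)) -addrA.
apply: kspan_add.
  by rewrite -linearZ -linearB; apply: shorter_cons.
rewrite signr_addb -scalerA -scalerBr; apply: kspan_scale.
apply: (kspan_sub _ (lowering_swap v Lm Ll Lab)) => x Hx.
apply: kspan_incl; apply: shorter_perm Hx.
by rewrite perm_cons perm_sym -cat1s perm_catCA.
Qed.

Lemma lowering_perm w1 w2 v : perm_eq w1 w2 -> all lowering w1 ->
  exists s : bool, kspan (shorter w1 v) (act w1 v - (-1) ^+ s *: act w2 v).
Proof.
elim: w2 w1 => [|l w2 IH] w1.
  by move=> /perm_nilP-> _; exists false; rewrite scale1r subrr; exact: KSpan0.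
move=> w12; have lw1 : l \in w1 by rewrite (perm_mem w12) mem_head.
case/splitPr: lw1 w12 => a b w12 Lw.
have [s Hs] := lowering_front v Lw.
have Lab : all lowering (a ++ b) by move: Lw; rewrite !all_cat /= => /and3P[-> _].
have Ll : lowering l by move: Lw; rewrite all_cat /= => /and3P[].
have {}w12 : perm_eq (a ++ b) w2.
  by move: w12; rewrite -cat1s perm_catCA perm_cons.
have [t Ht] := IH _ w12 Lab.
exists (s (+) t); rewrite -(subrK ((-1) ^+ s *: act (l :: a ++ b) v) (act (a ++ _) _)) -addrA.
apply: kspan_add => //; rewrite signr_addb -scalerA -scalerBr; apply: kspan_scale.
rewrite /= -linearZ -linearB.
apply: (kspan_sub _ (shorter_cons Ll Ht)) => x Hx.
by apply: kspan_incl; apply: shorter_perm Hx; rewrite -[l :: _]cat1s perm_catCA.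
Qed.

(** The Poincare-Birkhoff-Witt bounds on the exponents in n^-, coming from E^2 = 0 and e^p = 0. *)
Definition max_mult (l : letter n) : nat :=
  if lowering l then (if l.1 then 1 else p.-1) else 0.

Definition admissible (w : seq (letter n)) :=
  [forall l, (count_mem l w <= max_mult l)%N].

Lemma inadmissible_shorter w v : all lowering w -> ~~ admissible w ->
  kspan (shorter w v) (act w v).
Proof.
move=> Lw /forallPn[l]; rewrite -ltnNge => Hl.
have lw : l \in w by rewrite -has_pred1 has_count; apply: leq_ltn_trans Hl.
have Ll := allP Lw _ lw.
set c := count_mem l w in Hl.
(* One copy of [l] more than allowed is moved to the front, where this power of [l] acts by zero;
   all other copies stay in [rest]. *)
pose rest := nseq (c - (max_mult l).+1) l ++ filter (predC1 l) w.
have w12 : perm_eq w (nseq (max_mult l).+1 l ++ rest).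
  rewrite catA -nseqD subnKC // perm_sym.
  have <- : filter (pred1 l) w = nseq c l.
    by rewrite /c -size_filter; apply/all_pred1P; exact: filter_all.
  exact/permPl/perm_filterC.
have [s] := lowering_perm v w12 Lw.
suff -> : act (nseq (max_mult l).+1 l ++ rest) v = 0 by rewrite scaler0 subr0.
rewrite act_cat act_nseq /max_mult Ll; move: (act rest v) => u.
case: l {Hl lw w12 c rest} Ll => -[] [i j]; rewrite /lowering /= => ij.
  by apply: (odd_sq0 p_char p_gt2 qX); apply: contraTneq ij => ->; rewrite ltxx.
rewrite -iterS prednK; last by apply: ltn_trans p_gt2.
by apply: (queer_nilpotent qX); apply: contraTneq ij => ->; rewrite ltxx.
Qed.

(* Reordering a word only creates shorter words of the same height, so this
   degree increases strictly along rewriting; it is bounded on admissible words. *)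
Definition degree (w : seq (letter n)) : int := \sum_(l <- w) (height l *+ 2 - 1).

Lemma degree_cat w1 w2 : degree (w1 ++ w2) = degree w1 + degree w2.
Proof. exact: big_cat. Qed.

Lemma degreeE w : degree w = wheight w *+ 2 - (size w)%:Z.
Proof.
clear -r w; rewrite /degree sumrB sumrMnl; congr (_ - _).
by rewrite big_const_seq count_predT; elim: size => //= k ->; lia.
Qed.

Lemma sum_count (F : letter n -> int) w :
  \sum_(l <- w) F l = \sum_l F l *+ count_mem l w.
Proof.
elim: w => [|x w IH].
  by rewrite big_nil big1 // => l _; rewrite mulr0n.
rewrite big_cons IH /=; under [RHS]eq_bigr do rewrite mulrnDr.
rewrite big_split /=; congr (_ + _).
rewrite (bigD1 x) //= eqxx mulr1n big1 ?addr0 // => l /negbTE.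
by rewrite eq_sym => ->.
Qed.

Definition top_degree : int := \sum_l (height l *+ 2 - 1) *+ max_mult l.
Definition top_height : int := \sum_l height l *+ max_mult l.

Lemma lowering_pos l : lowering l -> 0 < height l *+ 2 - 1.
Proof. by clear -r l; rewrite /lowering /height => ?; lia. Qed.

Lemma degree_admissible w : all lowering w -> admissible w -> degree w <= top_degree.
Proof.
move=> Lw /forallP Aw; rewrite /degree sum_count; apply: ler_sum => l _.
have := Aw l; rewrite /max_mult; case: ifP => [Ll|_].
  by move=> H; rewrite -(subnK H) mulrnDr lerDr mulrn_wge0 // ltW // lowering_pos.
by rewrite leqn0 => /eqP->.
Qed.

Lemma degree_shorter w w' : wheight w' = wheight w -> (size w' < size w)%N ->
  degree w < degree w'.
Proof. by clear -r w w'; rewrite !degreeE => ->; lia. Qed.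

(** A word above the top degree is inadmissible, hence a combination of shorter words, whose degree
    is larger still; the descent on the length ends with zero. *)
Lemma act_degree_gt w v : all lowering w -> top_degree < degree w -> act w v = 0.
Proof.
move: {-1}(size w) (leqnn (size w)) => k; elim: k w => [|k IH] w wk Lw Dw.
  have Aw : ~~ admissible w by apply: contraTN Dw => Aw; rewrite -leNgt degree_admissible.
  apply: kspan_eq0 (inadmissible_shorter v Lw Aw) => x [w' [_ w2 _ _ _]].
  by have := leq_trans w2 wk.
have Aw : ~~ admissible w by apply: contraTN Dw => Aw; rewrite -leNgt degree_admissible.
apply: kspan_eq0 (inadmissible_shorter v Lw Aw) => _ [w' [w1 w2 w3 _ ->]].
apply: IH => //; first by rewrite -ltnS; apply: leq_trans w2 wk.
by apply: (lt_trans Dw); apply: degree_shorter.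
Qed.

Lemma shorter_top w v x : top_degree <= degree w -> shorter w v x -> x = 0.
Proof.
move=> Dw [w' [w1 w2 w3 _ ->]]; apply: act_degree_gt => //.
by apply: (le_lt_trans Dw); apply: degree_shorter.
Qed.

Lemma act_top_inadmissible w v : all lowering w -> ~~ admissible w ->
  top_degree <= degree w -> act w v = 0.
Proof.
move=> Lw Aw Dw; apply: kspan_eq0 (inadmissible_shorter v Lw Aw) => x.
exact: shorter_top.
Qed.

(** The error terms of reordering have larger degree and so vanish: from the top degree on, lowering
    letters supercommute. *)
Lemma act_top_perm w w' v : all lowering w -> perm_eq w w' -> top_degree <= degree w ->
  exists s : bool, act w v = (-1) ^+ s *: act w' v.
Proof.
move=> Lw ww' Dw; have [s Hs] := lowering_perm v ww' Lw; exists s.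
by apply/eqP; rewrite -subr_eq0; apply/eqP; apply: kspan_eq0 Hs => x; apply: shorter_top.
Qed.
Definition word_of (f : letter n -> nat) : seq (letter n) :=
  flatten [seq nseq (f l) l | l <- enum {: letter n}].

Lemma count_word_of f l : count_mem l (word_of f) = f l.
Proof.
have : l \in enum {: letter n} by rewrite mem_enum.
have := enum_uniq {: letter n}; rewrite /word_of.
elim: (enum _) => //= x s IH /andP[xs Us]; rewrite count_cat count_nseq inE.
case: eqVneq => [->|lx] /=.
  rewrite eqxx mul1n => _; apply/eqP; rewrite -[X in _ == X]addn0 eqn_add2l.
  apply/eqP/count_memPn; apply: contra xs => /flatten_mapP[y ys].
  by move=> /nseqP[->].
by rewrite eq_sym (negbTE lx) mul0n add0n; apply: IH.
Qed.

Lemma perm_word_of f w : (forall l, count_mem l w = f l) -> perm_eq w (word_of f).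
Proof. by move=> H; apply/allP=> l _ /=; rewrite count_word_of H. Qed.

Lemma lowering_word_of f : (forall l, (f l <= max_mult l)%N) -> all lowering (word_of f).
Proof.
move=> H; apply/allP=> l /flatten_mapP[x _ /nseqP[-> fx]].
by have := leq_trans fx (H x); rewrite /max_mult; case: ifP.
Qed.

(** Exponents are taken in ['I_p] to obtain a finite type to sum over; admissible exponents are
    below p. *)
Notation mult := {ffun letter n -> 'I_p}.
Definition word (m : mult) := word_of (fun l => m l).
Definition reduced (m : mult) := [forall l, (m l <= max_mult l)%N].

Lemma lowering_reduced m : reduced m -> all lowering (word m).
Proof. by move/forallP=> H; apply: lowering_word_of. Qed.

Lemma admissible_perm w : admissible w -> exists2 m, reduced m & perm_eq w (word m).
Proof.
move=> /forallP Aw.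
have p_gt0 : (0 < p)%N by apply: ltn_trans p_gt2.
have maxp l : (max_mult l < p)%N.
  by rewrite /max_mult; case: ifP => // _; case: ifP => _; [apply: ltn_trans p_gt2|rewrite prednK].
pose m : mult := [ffun l => Ordinal (ltn_pmod (count_mem l w) p_gt0)].
have mE l : m l = count_mem l w :> nat.
  by rewrite ffunE /= modn_small //; apply: leq_ltn_trans (maxp l).
exists m; first by apply/forallP=> l; rewrite mE.
by apply: perm_word_of => l; rewrite mE.
Qed.

Variable Y : bool -> V -> Prop.
Hypotheses (Y0 : forall e, Y e 0).
Hypotheses (YD : forall e c x y, Y e x -> Y e y -> Y e (c *: x + y)).

(** Ordered monomials with coefficients in [Y], which stands for the two parity components of U(h)
    v0. Only existence is recorded; the coefficients may fail to be unique. *)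
Definition expansion (Q : pred mult) (d : bool) (x : V) : Prop :=
  exists2 y : mult -> V, forall m, Q m -> Y (d (+) wparity (word m)) (y m)
    & x = \sum_(m | Q m) act (word m) (y m).

Lemma expansion0 Q d : expansion Q d 0.
Proof. by exists (fun=> 0) => //; rewrite big1 // => m _; rewrite linear0. Qed.

Lemma expansionD Q d c x y : expansion Q d x -> expansion Q d y ->
  expansion Q d (c *: x + y).
Proof.
move=> [f Yf ->] [g Yg ->]; exists (fun m => c *: f m + g m).
  by move=> m Qm; apply: YD; [apply: Yf|apply: Yg].
rewrite scaler_sumr -big_split; apply: eq_bigr => m _ /=.
by rewrite linearP.
Qed.

Lemma expansion_kspan Q d B x : (forall y, B y -> expansion Q d y) -> kspan B x ->
  expansion Q d x.
Proof. by move=> BQ; elim=> [|c u v /BQ Bu _]; [exact: expansion0|exact: expansionD]. Qed.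

Lemma expansion_word (Q : pred mult) d m y : Q m -> Y (d (+) wparity (word m)) y ->
  expansion Q d (act (word m) y).
Proof.
move=> Qm Yy; exists (fun m' => if m' == m then y else 0).
  by move=> m' _; case: eqP => [->|].
by rewrite (bigD1 m) //= eqxx big1 ?addr0 // => m' /andP[_ /negbTE->]; rewrite linear0.
Qed.

Lemma expansion_act w e v : all lowering w -> Y e v ->
  expansion (fun m => reduced m && (wheight (word m) == wheight w))
    (e (+) wparity w) (act w v).
Proof.
move: {-1}(size w) (leqnn (size w)) => k; elim: k w => [|k IH] w wk Lw Yv.
  have Ew : w = [::] by apply: size0nil; apply/eqP; rewrite -leqn0.
  have [m Rm wm] : exists2 m, reduced m & perm_eq w (word m).
    by apply: admissible_perm; rewrite Ew; apply/forallP.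
  have Em : word m = w by rewrite Ew; apply/perm_nilP; rewrite perm_sym -Ew.
  by rewrite -Em; apply: expansion_word; rewrite ?Rm ?eqxx // addbK.
have Sh x : kspan (shorter w v) x ->
    expansion (fun m => reduced m && (wheight (word m) == wheight w)) (e (+) wparity w) x.
  apply: expansion_kspan => _ [w' [w1 w2 w3 w4 ->]].
  rewrite -w3 -w4; apply: IH => //.
  by rewrite -ltnS; apply: leq_trans w2 wk.
have [Aw|Aw] := boolP (admissible w); last first.
  by apply: Sh; apply: inadmissible_shorter.
have [m Rm wm] := admissible_perm Aw.
have [s /Sh Hs] := lowering_perm v wm Lw.
rewrite -(subrK ((-1) ^+ s *: act (word m) v) (act w v)) addrC.
apply: expansionD => //.
have -> : wheight w = wheight (word m) by exact: perm_big.
have -> : wparity w = wparity (word m) by exact: perm_big.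
by apply: expansion_word; rewrite ?Rm ?eqxx // addbK.
Qed.

Lemma degree_word_of f : degree (word_of f) = \sum_l (height l *+ 2 - 1) *+ f l.
Proof. by rewrite /degree sum_count; under eq_bigr do rewrite count_word_of. Qed.

Lemma height_word_of f : wheight (word_of f) = \sum_l height l *+ f l.
Proof. by rewrite /wheight sum_count; under eq_bigr do rewrite count_word_of. Qed.

(* Multiplying an expansion by the word complementary to a term of least degree
   leaves a multiple of that term only. *)
Lemma expansion_top (Q : pred mult) d x top :
  (forall m, Q m -> reduced m) -> (forall l, count_mem l top = max_mult l) ->
  expansion Q d x -> x != 0 ->
  exists w e y (s : bool), [/\ all lowering w, Y e y, y != 0 &
    act w x = (-1) ^+ s *: act top y].
Proof.
move=> QR Htop [y Yy xE] x0.
have [m1 Qm1] : exists m, Q m && (y m != 0).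
  apply/existsP; apply: contraNT x0 => /existsPn H; rewrite xE big1 // => m Qm.
  by have := H m; rewrite Qm negbK => /eqP->; rewrite linear0.
case: (arg_minP (P := fun m => Q m && (y m != 0)) (fun m => degree (word m)) Qm1) => m0 /andP[Qm0 ym0] min_m0.
have Rm0 : forall l, (m0 l <= max_mult l)%N by apply/forallP/QR.
pose w := word_of (fun l => max_mult l - m0 l)%N.
have Lw : all lowering w by apply: lowering_word_of => l; apply: leq_subr.
exists w, (d (+) wparity (word m0)), (y m0).
have Dw : degree w + degree (word m0) = top_degree.
  rewrite /w !degree_word_of -big_split; apply: eq_bigr => l _ /=.
  by rewrite -mulrnDr subnK.
have Lm m : Q m -> all lowering (w ++ word m).
  by move=> /QR Rm; rewrite all_cat Lw lowering_reduced.
have Dm m : Q m -> y m != 0 -> top_degree <= degree (w ++ word m).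
  move=> Qm ym; rewrite -Dw degree_cat lerD2l.
  by apply: min_m0; rewrite Qm.
have P0 : perm_eq (w ++ word m0) top.
  apply/allP=> l _ /=; rewrite count_cat !count_word_of Htop subnK //.
have [s Es] := act_top_perm (y m0) (Lm _ Qm0) P0 (Dm _ Qm0 ym0).
exists s; split=> //; first exact: Yy.
rewrite -Es xE linear_sum (bigD1 m0) //= -act_cat big1 ?addr0 // => m /andP[Qm mm0].
have [->|ym] := eqVneq (y m) 0; first by rewrite !linear0.
rewrite -act_cat.
have [A|A] := boolP (admissible (w ++ word m)); last first.
  by apply: act_top_inadmissible; [exact: Lm| |exact: Dm].
apply: act_degree_gt; first exact: Lm.
rewrite lt_neqAle Dm // andbT; apply: contra mm0 => /eqP Etop.
(* Admissibility forces m <= m0 pointwise. As m differs from m0, some exponent is strictly smaller,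
   which would put the degree of m below the minimum. *)
have le l : (m l <= m0 l)%N.
  have := forallP A l; rewrite count_cat !count_word_of => H.
  by rewrite -(leq_add2l (max_mult l - m0 l)) subnK.
apply/eqP/ffunP=> l; apply/val_inj/eqP => /=; apply: contraT => ml.
have Ll : lowering l.
  have : (m l < m0 l)%N by rewrite ltn_neqAle ml le.
  move/leq_trans => /(_ _ (Rm0 l)); rewrite /max_mult; case: ifP => //.
suff : degree (word m) < degree (word m0).
  by rewrite -(ltrD2l (degree w)) Dw ltNge -degree_cat Dm.
rewrite !degree_word_of (bigD1 l) //= [X in _ < X](bigD1 l) //=.
apply: ltr_leD.
  have H : (m l < m0 l)%N by rewrite ltn_neqAle ml le.
  rewrite -(subnK (ltnW H)) mulrnDr ltrDr pmulrn_lgt0 ?lowering_pos // ?subn_gt0 //.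
apply: ler_sum => k _; have := Rm0 k; have := le k; rewrite /max_mult.
case: ifP => [Lk H _|_ H]; last first.
  by rewrite leqn0 => /eqP E; move: H; rewrite E leqn0 => /eqP->.
by rewrite -(subnK H) mulrnDr lerDr mulrn_wge0 // ltW // lowering_pos.
Qed.
End Words.

(** * Height and parity on U(n^-) U(h) v0 *)

Section Graded.
Variables (K : fieldType) (p n : nat) (V : lmodType K).
Variable X : letter n -> {linear V -> V}.
Hypotheses (p_char : p \in [pchar K]) (p_gt2 : (2 < p)%N).
Hypothesis qX : queer_action p X.
Local Notation act := (act X).
Let br := queer_bracket qX.
Variable r : 'I_n -> int.
Hypothesis r_inj : injective r.
Variable Y : bool -> V -> Prop.
Hypotheses (Y0 : forall e, Y e 0).
Hypotheses (YD : forall e c x y, Y e x -> Y e y -> Y e (c *: x + y)).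
Hypothesis Yraise : forall d i j e y, r i < r j -> Y e y -> X (d, (i, j)) y = 0.
Hypothesis Ydiag : forall d i e y, Y e y -> Y (e (+) d) (X (d, (i, i)) y).

Definition piece (h : int) (d : bool) : V -> Prop :=
  kspan (fun z => exists w y, [/\ all (lowering r) w, wheight r w = h,
                                  Y (d (+) wparity w) y & z = act w y]).

Lemma piece_act_lowering l h d z : lowering r l -> piece h d z ->
  piece (h + height r l) (d (+) l.1) (X l z).
Proof.
move=> Ll; apply: kspan_linear => _ [w [y [w1 w2 w3 ->]]]; apply: kspan_incl.
exists (l :: w), y; split=> //=; first by rewrite Ll.
  by rewrite wheight_cons w2 addrC.
by rewrite wparity_cons addbA addbK.
Qed.

Lemma piece_diag e y : Y e y -> piece 0 e y.
Proof.
move=> Yy; apply: kspan_incl; exists [::], y; split=> //; first exact: big_nil.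
by rewrite /wparity big_nil addbF.
Qed.

(** A letter commuted through a lowering word yields letters whose heights add up, until it reaches
    [Y]: there a raising letter gives zero, and a letter of height zero is diagonal by injectivity
    of [r] and preserves [Y]. So lowering words on [Y] span a g-stable graded space. *)
Lemma piece_act l h d z : piece h d z -> piece (h + height r l) (d (+) l.1) (X l z).
Proof.
apply: kspan_linear => _ [w [y [w1 w2 w3 ->]]].
elim: w l h d w1 w2 w3 => [|[e [k m]] w IH] [c [i j]] h d.
  move=> _ <- Yy; rewrite /wheight big_nil add0r /=.
  have {}Yy : Y d y by move: Yy; rewrite /wparity big_nil addbF.
  have [rij|rji|/r_inj rij] := ltgtP (r i) (r j).
  - by rewrite (Yraise _ rij Yy); exact: KSpan0.
  - have := piece_act_lowering (l := (c, (i, j))) rji (piece_diag Yy).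
    by rewrite add0r.
  rewrite -rij /height subrr; apply: piece_diag; exact: Ydiag.
move=> /= /andP[Lm Lw] <- Yy.
rewrite br wheight_cons.
have IHl l : piece (wheight r w + height r l) (d (+) e (+) l.1) (X l (act w y)).
  apply: IH => //; congr (Y _ _): Yy.
  by rewrite wparity_cons /= addbA.
rewrite [height r _ + wheight r w]addrC.
apply: kspan_add.
  apply: kspan_scale.
  have := piece_act_lowering Lm (IHl (c, (i, j))).
  by rewrite /= addrAC [d (+) e (+) c](addbAC) addbK.
have BR f i' j' : height r (f, (i', j')) = height r (e, (k, m)) + height r (c, (i, j)) ->
   f = c (+) e ->
   piece (wheight r w + height r (e, (k, m)) + height r (c, (i, j))) (d (+) c)
     (X (f, (i', j')) (act w y)).
  move=> H ->; have := IHl (c (+) e, (i', j')); rewrite /= [height _ _]H addrA.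
  by rewrite -addbA [e (+) _]addbC addbK.
apply: kspan_add.
  case: eqP => [jk|_]; last by rewrite scale0r; exact: KSpan0.
  by apply: kspan_scale; apply: BR => //; rewrite /height /= jk; ring.
apply: kspan_opp; case: eqP => [li|_]; last by rewrite mulr0 scale0r; exact: KSpan0.
by apply: kspan_scale; apply: BR => //; rewrite /height /= li; ring.
Qed.

Lemma piece_word w h d z : piece h d z -> piece (h + wheight r w) (d (+) wparity w) (act w z).
Proof.
elim: w => [|l w IH] Hz.
  by rewrite /wheight /wparity !big_nil addr0 addbF.
rewrite wheight_cons wparity_cons addrCA addrC -[l.1 (+) _]addbC addbA.
by apply: piece_act; apply: IH.
Qed.

Lemma piece_expansion h d z : piece h d z ->
  expansion (p := p) X Y (fun m => reduced r m && (wheight r (word m) == h)) d z.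
Proof.
apply: expansion_kspan => // _ [w [y [w1 <- w3 ->]]].
by have := expansion_act p_char p_gt2 qX Y0 YD w1 w3; rewrite addbK.
Qed.

Lemma expansion_reduced (Q Q' : pred {ffun letter n -> 'I_p}) d z :
  subpred Q Q' -> expansion X Y Q d z -> expansion X Y Q' d z.
Proof.
move=> QQ' [f Yf ->]; exists (fun m => if Q m then f m else 0).
  by move=> m _; case: ifP => [/Yf|].
rewrite [RHS](bigID Q) /= [X in _ = _ + X]big1 ?addr0; last first.
  by move=> m /andP[_ /negbTE->]; rewrite linear0.
apply: eq_big => [m|m ->] //.
by case: (boolP (Q m)) => [/QQ'->|]; rewrite ?andbF.
Qed.

(** All lowering letters have positive height, so only the exponent function that is maximal
    everywhere reaches the top height. *)
Lemma reduced_top (m : {ffun letter n -> 'I_p}) : reduced r m ->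
  wheight r (word m) = top_height p r -> forall l, m l = max_mult p r l :> nat.
Proof.
move=> /forallP Rm; rewrite height_word_of => Hm l.
have [Ll|Ll] := boolP (lowering r l); last first.
  by have := Rm l; rewrite /max_mult (negbTE Ll) leqn0 => /eqP.
apply/eqP; rewrite eqn_leq Rm leqNgt; apply/negP => lt_m.
suff : \sum_l height r l *+ m l < top_height p r by rewrite Hm ltxx.
have hgt0 k : lowering r k -> 0 < height r k by rewrite subr_gt0.
rewrite /top_height (bigD1 l) //= [X in _ < X](bigD1 l) //=; apply: ltr_leD.
  by rewrite -(subnK (ltnW lt_m)) mulrnDr ltrDr pmulrn_lgt0 ?hgt0 ?subn_gt0.
apply: ler_sum => k _; have := Rm k; rewrite /max_mult.
case: ifP => [/hgt0 /ltW Lk H|_]; last by rewrite leqn0 => /eqP->.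
by rewrite -(subnK H) mulrnDr lerDr mulrn_wge0.
Qed.

Lemma wheight_reduced (m : {ffun letter n -> 'I_p}) : reduced r m ->
  wheight r (word m) <= top_height p r.
Proof.
move=> /forallP Rm; rewrite height_word_of; apply: ler_sum => k _.
have := Rm k; rewrite /max_mult; case: ifP => [Lk H|_]; last by rewrite leqn0 => /eqP->.
by rewrite -(subnK H) mulrnDr lerDr mulrn_wge0 // ltW // subr_gt0.
Qed.
End Graded.

(** * Multiplicities of the letters in lowering and raising words *)

Section ChainCount.
Variables (p n : nat).
Hypothesis p_gt2 : (2 < p)%N.

Lemma count_root_word (l : letter n) rr :
  count_mem l (root_word p rr) = ((rr == l.2) * (if l.1 then 1 else p.-1))%N.
Proof.
case: l => d kl; rewrite count_cat count_nseq /= !xpair_eqE eq_sym.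
by case: d; case: eqP; rewrite ?muln1 ?addn0 ?mul1n ?mul0n.
Qed.

Lemma count_root_words (I : Type) (l : letter n) (f : I -> 'I_n * 'I_n) t :
  count_mem l (flatten [seq root_word p (f b) | b <- t]) =
  (count (fun b => f b == l.2) t * (if l.1 then 1 else p.-1))%N.
Proof.
elim: t => //= b t IH; rewrite count_cat IH count_root_word.
by rewrite mulnDl.
Qed.

Lemma count_lowering_word s d (a b : 'I_n) : uniq s -> a \in s -> b \in s ->
  count_mem (d, (b, a)) (lowering_word p s) =
  ((index a s < index b s) * (if d then 1 else p.-1))%N.
Proof.
elim: s => //= c s IH /andP[cs Us]; rewrite !inE count_cat count_root_words /=.
have Ec : count (fun x => (x, c) == (b, a)) s = ((c == a) * (b \in s))%N.
  rewrite -(count_uniq_mem _ Us); case: eqVneq => [->|ca].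
    by rewrite mul1n; apply: eq_count => x /=; rewrite xpair_eqE eqxx andbT.
  rewrite mul0n; apply/eqP; rewrite -leqn0 leqNgt -has_count; apply/hasPn => x _.
  by rewrite xpair_eqE (negbTE ca) andbF.
rewrite Ec ![_ == c]eq_sym => as_ bs_.
have cnt0 : (a \notin s) || (b \notin s) -> count_mem (d, (b, a)) (lowering_word p s) = 0.
  move=> ab; apply/count_memPn; apply: contraL ab; rewrite negb_or !negbK.
  elim: s {IH cs Us Ec as_ bs_} => //= x s IH; rewrite mem_cat !inE.
  case/orP=> [/flatten_mapP[y ys]|/IH/andP[-> ->]]; last by rewrite !orbT.
  by move=> /root_word_letter[-> ->]; rewrite eqxx ys orbT.
case: eqVneq as_ => [ca _|ca /= as_].
  subst c; rewrite cnt0 ?cs // addn0 mul1n.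
  by case: eqVneq bs_ => [<-|ba /= ->]; rewrite ?(negbTE cs).
rewrite mul0n mul0n add0n.
case: eqVneq bs_ => [cb _|cb /= bs_]; last by rewrite ltnS IH.
by rewrite cnt0 ?ltn0 // -cb cs orbT.
Qed.

Lemma count_raising_word s d (a b : 'I_n) :
  count_mem (d, (a, b)) (raising_word p s) = count_mem (d, (b, a)) (lowering_word p s).
Proof.
elim: s => //= c s IH; rewrite !count_cat IH addnC !count_root_words /= count_rev.
by congr (_ * _ + _)%N; apply: eq_count => x /=; rewrite !xpair_eqE andbC.
Qed.
End ChainCount.

Lemma pairwise_rev (T : Type) (e : rel T) s : pairwise e (rev s) = pairwise (fun x y => e y x) s.
Proof.
by elim: s => //= x s IH; rewrite rev_cons pairwise_rcons IH all_rev.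
Qed.

(** * Words acting on a singular weight vector *)

Definition diagonal (n : nat) (l : letter n) := l.2.1 == l.2.2.

Section Top.
Variables (K : fieldType) (p n : nat) (V : lmodType K).
Variable X : letter n -> {linear V -> V}.
Hypotheses (p_char : p \in [pchar K]) (p_gt2 : (2 < p)%N).
Hypothesis qX : queer_action p X.
Local Notation act := (act X).
Let br := queer_bracket qX.

(** The component of U(h) v0 of parity [e], with v0 counted as even; in the baby Verma module it is
    the image of a component of V(lam). *)
Definition cartan_span (v0 : V) (e : bool) : V -> Prop :=
  kspan (fun y => exists w, [/\ all (@diagonal n) w, wparity w = e & y = act w v0]).

Section Span.
Variables (v0 : V).
Local Notation Y := (cartan_span v0).

Lemma cartan_span0 e : Y e 0. Proof. exact: KSpan0. Qed.

Lemma cartan_spanD e c x y : Y e x -> Y e y -> Y e (c *: x + y).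
Proof. by move=> Yx Yy; apply: kspan_add => //; apply: kspan_scale. Qed.

Lemma cartan_span_diag d i e y : Y e y -> Y (e (+) d) (X (d, (i, i)) y).
Proof.
apply: kspan_linear => _ [w [w1 w2 ->]]; apply: kspan_incl.
exists ((d, (i, i)) :: w); rewrite /= /diagonal eqxx; split=> //.
by rewrite wparity_cons w2 addbC.
Qed.

Lemma cartan_span_refl : Y false v0.
Proof. by apply: kspan_incl; exists [::]; split=> //; exact: big_nil. Qed.

Lemma cartan_span_weight lam e y : has_weight X lam v0 -> Y e y -> has_weight X lam y.
Proof.
move=> wv0; elim=> [|c x z [w [w1 _ ->]] _ IH] a; first by rewrite linear0 scaler0.
rewrite linearP IH scalerDr /= [lam a *: (c *: _)]scalerA mulrC -scalerA.
congr (_ *: _ + _).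
elim: w w1 => [_|[d [i j]] w IHw /= /andP[/eqP/= <- /IHw]]; first exact: wv0.
move=> H; rewrite (weight_shift qX d i i H) eq_sym.
by rewrite -addrA subrr addr0.
Qed.

Variable r : 'I_n -> int.
Hypothesis kill0 : forall d i j, r i < r j -> X (d, (i, j)) v0 = 0.

Lemma cartan_span_raise d i j e y : r i < r j -> Y e y -> X (d, (i, j)) y = 0.
Proof.
move=> rij; elim=> [|c x z [w [w1 _ ->]] _ IH]; first by rewrite linear0.
rewrite linearP IH addr0.
suff -> : X (d, (i, j)) (act w v0) = 0 by rewrite scaler0.
elim: w w1 d i j rij {IH e y c x z} => [_|[f [k l]] w IHw /= /andP[/eqP/= <- /IHw H]] d i j rij.
  exact: kill0.
rewrite br (H _ _ _ rij) linear0 scaler0 add0r.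
have -> : (j == k)%:R *: X (d (+) f, (i, k)) (act w v0) = 0.
  by case: eqP => [<-|]; rewrite ?scale0r // H // scaler0.
by case: eqP => [->|]; rewrite ?mulr0 ?scale0r ?subrr // H // scaler0 subrr.
Qed.

Hypothesis r_inj : injective r.

Lemma act_piece w : piece X r Y (wheight r w) (wparity w) (act w v0).
Proof.
have H := piece_word qX r_inj cartan_span_raise cartan_span_diag w
  (piece_diag X r cartan_span_refl).
by rewrite add0r addFb in H.
Qed.

(** U(g) v0 = U(n^-) U(h) v0, in the spanning form that suffices here. *)
Lemma act_expansion d x : kspan (fun y => exists2 w, wparity w = d & y = act w v0) x ->
  expansion (p := p) X Y (reduced r) d x.
Proof.
apply: expansion_kspan; [exact: cartan_span0|exact: cartan_spanD|] => _ [w <- ->].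
have := piece_expansion p_char p_gt2 qX cartan_span0 cartan_spanD (act_piece w).
by apply: (expansion_reduced (cartan_span0)) => m /andP[].
Qed.
End Span.

Variable s : seq 'I_n.
Hypotheses (s_uniq : uniq s) (s_full : forall i, i \in s).
Definition position (i : 'I_n) : int := (index i s)%:Z.
Local Notation r := position.

Lemma position_inj : injective r.
Proof. by move=> i j [] H; rewrite -(nth_index i (s_full i)) H nth_index. Qed.

Lemma singular_kill v d i j : singular X s v -> r i < r j -> X (d, (i, j)) v = 0.
Proof.
move=> /(pairwiseP i) H; rewrite ltz_nat => ij; move: d; apply/killsP.
by have := H (index i s) (index j s); rewrite !nth_index // !inE !index_mem; apply.
Qed.

Lemma kill_singular v : (forall d i j, r i < r j -> X (d, (i, j)) v = 0) ->
  singular X s v.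
Proof.
move=> H; case E: s => [//|i0 s']; apply/(pairwiseP i0) => i j; rewrite !inE => si sj ij.
by apply/killsP => d; apply: H; rewrite /position ltz_nat -E !index_uniq // E.
Qed.

Lemma count_lowering_top l : count_mem l (lowering_word p s) = max_mult p r l.
Proof.
case: l => d [b a]; rewrite count_lowering_word // /max_mult /lowering /= ltz_nat.
by case: (index a s < index b s)%N; rewrite ?mul1n.
Qed.

Variables (lam : 'I_n -> K) (v0 : V).
Hypotheses (v0_sing : singular X s v0) (v0_wt : has_weight X lam v0).
Local Notation Y := (cartan_span v0).
Local Notation T := (lowering_word p s).

Let v0_kill d i j : r i < r j -> X (d, (i, j)) v0 = 0.
Proof. exact: singular_kill. Qed.

Lemma raise_lower e y : Y e y -> act (raising_word p s) (act T y) = chain_coef p lam s *: y.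
Proof.
move=> Yy; have wy := cartan_span_weight v0_wt Yy.
have sy : singular X s y. apply: kill_singular.
  move=> d i j rij; exact: (cartan_span_raise v0_kill _ rij Yy).
have := @lowering_chain K p n V X p_char p_gt2 qX lam [::] s [::] y.
by rewrite !cats0 => /(_ s_uniq sy wy)[].
Qed.

Lemma top_vector d x : chain_coef p lam s != 0 ->
  kspan (fun y => exists2 w, wparity w = d & y = act w v0) x -> x != 0 ->
  exists w e y c, [/\ Y e y, y != 0, c != 0 & act w x = c *: y].
Proof.
move=> c0 /(act_expansion v0_kill position_inj) Ex x0.
have [w [e [y [t [_ Yy y0 Ey]]]]] := expansion_top p_char p_gt2 qX (fun m H => H)
  count_lowering_top Ex x0.
exists (raising_word p s ++ w), e, y, ((-1) ^+ t * chain_coef p lam s); split=> //.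
  by rewrite mulf_neq0 ?signr_eq0.
by rewrite act_cat Ey linearZ /= (raise_lower Yy) scalerA.
Qed.

Lemma lower_lower w : chain_coef p lam s = 0 -> act T (act w (act T v0)) = 0.
Proof.
move=> c0; set y0 := act T v0.
have [] := @lowering_chain K p n V X p_char p_gt2 qX lam [::] s [::] v0.
- by rewrite cats0.
- by rewrite cats0.
- exact: v0_wt.
rewrite !cats0 /= -/y0 => y0_sing y0_wt _.
(* T v0 is singular for the reversed order. With the rank function negated, [act_expansion]
   therefore writes w T v0 in raising words on the Cartan span of T v0. *)
pose r' i := - r i.
have r'_inj : injective r' by move=> i j /oppr_inj/position_inj.
have y0_kill d i j : r' i < r' j -> X (d, (i, j)) y0 = 0.
  rewrite ltrN2 ltz_nat => ij; move: d; apply/killsP.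
  move: y0_sing; rewrite /singular pairwise_rev => /(pairwiseP i) H.
  by have := H (index j s) (index i s); rewrite !nth_index // !inE !index_mem; apply.
(* A vector of positive height is a combination of nonempty lowering words on U(h) v0, and prefixing
   T to such a word exceeds the top degree. *)
have T0 h d z : 0 < h -> piece X r Y h d z -> act T z = 0.
  move=> h0 Hz; suff : kspan (fun _ => False) (act T z) by apply: kspan_eq0.
  apply: kspan_linear Hz => _ [w' [y [w1 w2 w3 ->]]].
  rewrite -[X in kspan _ X]/(act T (act w' y)) -act_cat.
  rewrite (act_degree_gt p_char p_gt2 qX (r := r)).
  - exact: KSpan0.
  - rewrite all_cat w1 andbT; apply/allP=> l; rewrite -has_pred1 has_count.
    by rewrite count_lowering_top /max_mult; case: ifP.
  rewrite degree_cat; have -> : degree r T = top_degree p r.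
    rewrite /degree sum_count; apply: eq_bigr => l _.
    by rewrite count_lowering_top.
  rewrite ltrDl /degree; case: w' w1 w2 {w3} => [|l w'] /=.
    by rewrite /wheight !big_nil => _ E; move: h0; rewrite -E ltxx.
  move=> /andP[Ll Lw] _; rewrite big_cons; apply: ltr_wpDr; last exact: (lowering_pos Ll).
  by rewrite big_seq; apply: sumr_ge0 => k /(allP Lw) Lk; apply/ltW/lowering_pos.
have hT : wheight r T = top_height p r.
  rewrite /wheight sum_count; apply: eq_bigr => l _; by rewrite count_lowering_top.
have := act_expansion y0_kill r'_inj (d := wparity w) (x := act w y0).
case; first by apply: kspan_incl; exists w.
move=> f Yf ->; rewrite linear_sum big1 // => m Rm /=.
have {Yf} := Yf m Rm; set y := f m => Yy.
have h'N (l : letter n) : height r' l = - height r l.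
  by rewrite /height /r' opprB opprK addrC.
pose d' := wparity T (+) (wparity w (+) wparity (word m)).
have Py : piece X r Y (top_height p r) d' y.
  move: Yy; apply: kspan_sub => _ [w' [w1 w2 ->]].
  have := piece_word qX position_inj (cartan_span_raise v0_kill) (@cartan_span_diag v0) w'
    (act_piece v0_kill position_inj T).
  rewrite hT w2 [wheight r w']big1_seq ?addr0 //.
  by move=> l /(allP w1)/eqP; rewrite /height => ->; rewrite subrr.
have Pz := piece_word qX position_inj (cartan_span_raise v0_kill) (@cartan_span_diag v0)
  (word m) Py.
have hm : wheight r' (word m) = - wheight r (word m).
  by rewrite /wheight -sumrN; apply: eq_bigr => l _; rewrite h'N.
have top' : top_height p r' = top_height p r.
  pose flip (l : letter n) : letter n := (l.1, (l.2.2, l.2.1)).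
  have flipK : involutive flip by case=> c [i j].
  rewrite /top_height [RHS](reindex_inj (inv_inj flipK)); apply: eq_bigr => l _.
  by rewrite /max_mult /lowering /height /= /r' ltrN2 opprK addrC.
(* The word of [m] raises by at most the top height. If it raises by less, what remains has positive
   height and [T0] applies. *)
have := wheight_reduced Rm; rewrite top' hm le_eqVlt => /orP[/eqP Em|lt_m]; last first.
  by apply: T0 Pz; clear -lt_m; lia.
have Rtop l : m l = max_mult p r' l :> nat by apply: (reduced_top Rm); rewrite hm top'.
have wm : perm_eq (word m) (raising_word p s).
  rewrite perm_sym; apply: perm_word_of => -[c [i j]].
  rewrite count_raising_word count_lowering_top Rtop.
  by rewrite /max_mult /lowering /= /r' ltrN2.
have [t ->] : exists t : bool, act (word m) y = (-1) ^+ t *: act (raising_word p s) y.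
  apply: (act_top_perm p_char p_gt2 qX (r := r')) => //; first exact: lowering_reduced.
  by rewrite degree_word_of /top_degree; under eq_bigr do rewrite -Rtop.
suff -> : act (raising_word p s) y = 0 by rewrite !linear0.
(* Having top height, [y] is a combination of top monomials, each T up to sign, on vectors of U(h)
   v0; after T the raising word acts by the vanishing coefficient. *)
have [g Yg ->] := piece_expansion p_char p_gt2 qX (@cartan_span0 v0) (@cartan_spanD v0) Py.
rewrite linear_sum big1 // => m2 /andP[Rm2 /eqP hm2] /=.
have [||t' ->] := act_top_perm p_char p_gt2 qX (g m2) (lowering_reduced Rm2) (w' := T).
- rewrite perm_sym; apply: perm_word_of => l; rewrite count_lowering_top.
  by rewrite (reduced_top Rm2 hm2).
- by rewrite degree_word_of /top_degree; under eq_bigr do rewrite -(reduced_top Rm2 hm2).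
rewrite linearZ /= (raise_lower (Yg m2 _)) ?Rm2 ?hm2 ?eqxx //.
by rewrite c0 scale0r scaler0.
Qed.
End Top.

(** * Irreducibility of Clifford modules *)

Section Form.
Variables (K : fieldType) (n : nat) (lam : 'I_n -> K).

(** The form (a|b)_lam on h_1 in the basis E_ii; the factor 2 comes from [E_ii, E_ii] = 2 e_ii. *)
Definition odd_form (c d : 'rV[K]_n) : K := 2%:R * \sum_i lam i * (c 0 i * d 0 i).

Lemma odd_formC c d : odd_form c d = odd_form d c.
Proof. by congr (_ * _); apply: eq_bigr => i _; rewrite [c 0 i * _]mulrC. Qed.

Lemma odd_formDr c a d e : odd_form c (a *: d + e) = a * odd_form c d + odd_form c e.
Proof.
rewrite /odd_form mulrCA -mulrDr; congr (_ * _).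
rewrite mulr_sumr -big_split; apply: eq_bigr => i _ /=.
by rewrite !mxE; ring.
Qed.

Lemma odd_formBr c a d e : odd_form c (e - a *: d) = odd_form c e - a * odd_form c d.
Proof. by rewrite -scaleNr addrC odd_formDr mulNr addrC. Qed.

Lemma odd_formBl c a d e : odd_form (e - a *: d) c = odd_form e c - a * odd_form d c.
Proof. by rewrite odd_formC odd_formBr !(odd_formC c). Qed.

Lemma odd_form_mx c d : odd_form c d = (c *m diag_mx (\row_i (2%:R * lam i)) *m d^T) 0 0.
Proof.
rewrite /odd_form mulr_sumr !mxE; apply: eq_bigr => i _.
by rewrite mul_mx_diag !mxE; ring.
Qed.
End Form.

(** Linear algebra on A = W D, where D is the Gram matrix: a row basis B = P A with right inverse Q
    gives the w_i as rows of P W and the c_j as columns of Q. Their number is the rank of A, since W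
    may meet the radical of the form. *)
Lemma dual_vectors (K : fieldType) (n m : nat) (lam : 'I_n -> K) (Wm : 'M[K]_(m, n)) :
  exists (r : nat) (w c : 'I_r -> 'rV[K]_n),
  [/\ forall i, (w i <= Wm)%MS,
      forall i j, odd_form lam (w i) (c j) = (i == j)%:R &
      forall d, exists a : 'I_r -> K, forall e, (e <= Wm)%MS ->
        odd_form lam e (d - \sum_j a j *: c j) = 0].
Proof.
pose D := diag_mx (\row_i (2%:R * lam i)); pose A := Wm *m D.
pose B := row_base A; pose P := B *m pinvmx A; pose Q := pinvmx B.
have PA : P *m A = B by rewrite mulmxKpV // eq_row_base.
have BQ : B *m Q = 1%:M by rewrite mulmxVp // row_base_free.
have AQB : A *m Q *m B = A by rewrite mulmxKpV // eq_row_base.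
exists (\rank A), (fun i => row i (P *m Wm)), (fun j => (col j Q)^T); split.
- by move=> i; rewrite row_mul submxMl.
- move=> i j; rewrite odd_form_mx trmxK -row_mul -mulmxA -/D -/A PA colE mulmxA.
  by rewrite -!row_mul BQ mul1mx !mxE eqxx andbT.
move=> d; exists (fun j => (P *m A *m d^T) j 0) => e /submxP[x ->].
have E : \sum_j (P *m A *m d^T) j 0 *: (col j Q)^T = (Q *m (P *m A *m d^T))^T.
  apply/rowP=> i; rewrite summxE [RHS]mxE [RHS]mxE; apply: eq_bigr => j _.
  by rewrite !mxE mulrC.
rewrite odd_form_mx E linearB /= trmxK -/D -[x *m Wm *m D]mulmxA -/A.
have F : x *m A *m Q *m B = x *m A by rewrite -[in RHS]AQB !mulmxA.
by clearbody P Q; clearbody B; clearbody A; rewrite mulmxBr PA !mulmxA F subrr mxE.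
Qed.

Section Clifford.
Variables (K : closedFieldType) (p n : nat) (V : lmodType K).
Variable X : letter n -> {linear V -> V}.
Hypotheses (p_char : p \in [pchar K]) (p_gt2 : (2 < p)%N).
Hypothesis qX : queer_action p X.
Local Notation act := (act X).
Let br := queer_bracket qX.

Definition odd_op (c : 'rV[K]_n) (v : V) : V := \sum_i c 0 i *: X (true, (i, i)) v.

Fact odd_op_linear c : linear (odd_op c).
Proof.
move=> a x y; rewrite /odd_op scaler_sumr -big_split; apply: eq_bigr => i _ /=.
by rewrite linearP scalerDr !scalerA mulrC.
Qed.
HB.instance Definition _ c := GRing.isLinear.Build K V V *:%R (odd_op c) (odd_op_linear c).

Lemma odd_opD a c d v : odd_op (a *: c + d) v = a *: odd_op c v + odd_op d v.
Proof.
rewrite /odd_op scaler_sumr -big_split; apply: eq_bigr => i _ /=.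
by rewrite !mxE scalerDl scalerA.
Qed.

Lemma odd_op_delta i v : odd_op (delta_mx 0 i) v = X (true, (i, i)) v.
Proof.
rewrite /odd_op (bigD1 i) //= mxE !eqxx scale1r big1 ?addr0 // => j /negbTE ji.
by rewrite mxE ji andbF scale0r.
Qed.

Variables (lam : 'I_n -> K).
Local Notation form := (odd_form lam).

Lemma has_weightD c x y : has_weight X lam x -> has_weight X lam y ->
  has_weight X lam (c *: x + y).
Proof.
move=> wx wy a; rewrite linearP wx wy scalerDr; congr (_ + _).
by rewrite !scalerA mulrC.
Qed.

Lemma has_weight0 : has_weight X lam 0.
Proof. by move=> a; rewrite linear0 scaler0. Qed.

Lemma has_weight_odd c v : has_weight X lam v -> has_weight X lam (odd_op c v).
Proof.
move=> wv; rewrite /odd_op; elim/big_ind: _ => [|x y wx wy|i _]; first exact: has_weight0.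
  by rewrite -[x]scale1r; apply: has_weightD.
move=> a; rewrite linearZ /= (weight_shift qX true i i (wv a)) eq_sym -addrA subrr addr0.
by rewrite !scalerA mulrC.
Qed.

Lemma odd_op_anticomm c d v : has_weight X lam v ->
  odd_op c (odd_op d v) + odd_op d (odd_op c v) = form c d *: v.
Proof.
move=> wv; rewrite /odd_op.
have E (c' d' : 'rV[K]_n) : \sum_i c' 0 i *: X (true, (i, i)) (\sum_j d' 0 j *: X (true, (j, j)) v)
   = \sum_i \sum_j (c' 0 i * d' 0 j) *: X (true, (i, i)) (X (true, (j, j)) v).
  apply: eq_bigr => i _; rewrite linear_sum scaler_sumr; apply: eq_bigr => j _.
  by rewrite linearZ /= scalerA.
rewrite !E [X in _ + X]exchange_big -big_split /form mulr_sumr scaler_suml.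
apply: eq_bigr => i _ /=; rewrite -big_split (bigD1 i) //= big1 ?addr0 => [|j ji].
  by rewrite [d 0 i * _]mulrC (odd_sq p_char p_gt2 qX) wv -scalerDr -scalerDl !scalerA;
    congr (_ *: _); ring.
rewrite br (negbTE ji) eq_sym (negbTE ji) /= expr1 mulr0 !scale0r subrr addr0.
by rewrite scaleN1r [d 0 j * _]mulrC scalerN addNr.
Qed.

Lemma odd_op_sq c v : has_weight X lam v ->
  odd_op c (odd_op c v) = (form c c / 2%:R) *: v.
Proof.
move=> wv; apply: (scalerI (two_neq0 p_char p_gt2)).
rewrite scalerA mulrC divfK ?(two_neq0 p_char p_gt2) //.
by rewrite -odd_op_anticomm // scaler_nat mulr2n.
Qed.

Variables (v0 : V) (m : nat) (Wm : 'M[K]_(m, n)).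
Hypothesis v0_wt : has_weight X lam v0.
Hypothesis W_kill : forall c, (c <= Wm)%MS -> odd_op c v0 = 0.
Hypothesis W_iso : forall c d, (c <= Wm)%MS -> (d <= Wm)%MS -> form c d = 0.
Hypothesis W_max : forall u, (forall c, (c <= Wm)%MS -> form c u = 0) -> form u u = 0 ->
  (u <= Wm)%MS.

(** By maximality of W the form on the quotient of the orthogonal of W by W has no nonzero isotropic
    vector, so over an algebraically closed field the quotient is at most a line. The vector [u]
    spans it, with u = 0 if the quotient vanishes. *)
Lemma anisotropic_line : exists u, [/\ forall c, (c <= Wm)%MS -> form c u = 0,
  u != 0 -> form u u != 0 &
  forall d, (forall c, (c <= Wm)%MS -> form c d = 0) ->
    exists t, (d - t *: u <= Wm)%MS].
Proof.
have [[u [Wu nu]]|none] := pselect (exists u, (forall c, (c <= Wm)%MS -> form c u = 0) /\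
    ~~ (u <= Wm)%MS); last first.
  exists 0; split=> [c _||d Wd]; last first.
  - exists 0; rewrite scale0r subr0; apply: contrapT => /negP nd.
    by apply: none; exists d.
  - by rewrite eqxx.
  by rewrite /odd_form big1 ?mulr0 // => i _; rewrite mxE !mulr0.
have uu : form u u != 0 by apply: contra nu => /eqP; apply: W_max.
exists u; split=> // d Wd.
(* [t] is a root of form(d - t u, d - t u) = 0, a quadratic equation divided by form u u. *)
have [t Et] := @solve_monicpoly K 2
  (nth 0 [:: - form d d / form u u; 2%:R * form d u / form u u]) isT.
exists t; apply: W_max => [c Wc|].
  by rewrite odd_formBr Wd // Wu // mulr0 subrr.
rewrite odd_formBr !odd_formBl (odd_formC _ u d).
move: Et; rewrite !big_ord_recl big_ord0 /= addr0 expr0 expr1 mulr1 => Et.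
have {}Et : form u u * (t * t) = - form d d + 2%:R * form d u * t.
  by rewrite -expr2 Et; field.
transitivity (form d d - 2%:R * form d u * t + form u u * (t * t)); first by ring.
by rewrite Et; ring.
Qed.

Section Spanning.
Variables (r : nat) (w c : 'I_r -> 'rV[K]_n) (u : 'rV[K]_n).
Hypothesis wW : forall i, (w i <= Wm)%MS.
Hypothesis wc : forall i j, form (w i) (c j) = (i == j)%:R.
Hypothesis Wu : forall d, (d <= Wm)%MS -> form d u = 0.
Hypothesis uu : u != 0 -> form u u != 0.

(** Combinations of ordered square-free products of the c_j on v0 and u v0, of parity [e]; the
    recursion separates the terms with and without the first c_j. *)
Fixpoint clifford_span (js : seq 'I_r) (e : bool) (z : V) : Prop :=
  if js is j :: t then
    exists z0 z1, [/\ clifford_span t e z0, clifford_span t (~~ e) z1 &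
                      z = z0 + odd_op (c j) z1]
  else exists a, z = a *: (if e then odd_op u v0 else v0).

Lemma clifford_spanD js e a x y : clifford_span js e x -> clifford_span js e y ->
  clifford_span js e (a *: x + y).
Proof.
elim: js e x y => /= [|j t IH] e x y.
  by move=> [b ->] [d ->]; exists (a * b + d); rewrite scalerDl scalerA.
move=> [x0 [x1 [Hx0 Hx1 ->]]] [y0 [y1 [Hy0 Hy1 ->]]].
exists (a *: x0 + y0), (a *: x1 + y1); split; [exact: IH|exact: IH|].
by rewrite linearP scalerDr addrACA.
Qed.

Lemma clifford_span0 js e : clifford_span js e 0.
Proof.
elim: js e => /= [|j t IH] e; first by exists 0; rewrite scale0r.
by exists 0, 0; rewrite linear0 addr0; split.
Qed.

Lemma clifford_spanZ js e a x : clifford_span js e x -> clifford_span js e (a *: x).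
Proof.
move=> Hx; rewrite -[a *: x]addr0; apply: clifford_spanD => //; exact: clifford_span0.
Qed.

Lemma clifford_span_head j js e z : clifford_span js e z -> clifford_span (j :: js) e z.
Proof.
move=> Hz; exists z, 0; split=> //; first exact: clifford_span0.
by rewrite linear0 addr0.
Qed.

Lemma clifford_span_weight js e z : clifford_span js e z -> has_weight X lam z.
Proof.
elim: js e z => /= [|j t IH] e z.
  move=> [a ->]; apply: has_weightZ; case: e => //; exact: has_weight_odd.
move=> [z0 [z1 [/IH w0 /IH w1 ->]]]; rewrite -[z0]scale1r; apply: has_weightD => //.
exact: has_weight_odd.
Qed.

Lemma clifford_span_step d j js e z0 z1 :
  (forall e z, clifford_span js e z -> clifford_span js (~~ e) (odd_op d z)) ->
  clifford_span js e z0 -> clifford_span js (~~ e) z1 ->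
  clifford_span (j :: js) (~~ e) (odd_op d (z0 + odd_op (c j) z1)).
Proof.
move=> Hd H0 H1; have w1 := clifford_span_weight H1.
exists (form d (c j) *: z1 + odd_op d z0), (- odd_op d z1).
split; [by apply: clifford_spanD => //; apply: Hd| |].
  by rewrite -scaleN1r; apply/clifford_spanZ/Hd.
rewrite linearD linearN /= -odd_op_anticomm //.
move: (odd_op d (odd_op _ z1)) (odd_op (c j) (odd_op d z1)) (odd_op d z0) => a b x.
by rewrite [RHS]addrAC addrK addrC.
Qed.

Lemma clifford_span_W d js e z : (d <= Wm)%MS -> clifford_span js e z ->
  clifford_span js (~~ e) (odd_op d z).
Proof.
move=> Wd; elim: js e z => [|j t IH] e z; last first.
  by move=> [z0 [z1 [H0 H1 ->]]]; apply: clifford_span_step.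
move=> [a ->]; exists 0; rewrite scale0r linearZ /=; case: e; last by rewrite W_kill ?scaler0.
have := odd_op_anticomm d u v0_wt; rewrite (W_kill Wd) linear0 addr0 => ->.
by rewrite Wu // scale0r scaler0.
Qed.

Lemma clifford_span_u js e z : clifford_span js e z ->
  clifford_span js (~~ e) (odd_op u z).
Proof.
elim: js e z => [|j t IH] e z; last first.
  by move=> [z0 [z1 [H0 H1 ->]]]; apply: clifford_span_step.
move=> [a ->]; rewrite linearZ /=; case: e => /=; last by exists a.
by rewrite odd_op_sq // scalerA; eexists.
Qed.

Lemma clifford_span_c i js e z : i \in js -> clifford_span js e z ->
  clifford_span js (~~ e) (odd_op (c i) z).
Proof.
elim: js e z => // j t IH e z; rewrite inE; have [->|ij] := eqVneq i j => /= it.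
  move=> [z0 [z1 [H0 H1 ->]]].
  exists ((form (c j) (c j) / 2%:R) *: z1), z0; rewrite negbK; split=> //.
    exact: clifford_spanZ.
  by rewrite linearD /= odd_op_sq 1?addrC //; apply: clifford_span_weight H1.
by move=> [z0 [z1 [H0 H1 ->]]]; apply: clifford_span_step => // e' z' H; apply: IH.
Qed.

Lemma clifford_span_kill d js e z : (d <= Wm)%MS ->
  (forall j, j \in js -> form d (c j) = 0) -> clifford_span js e z -> odd_op d z = 0.
Proof.
move=> Wd; elim: js e z => [|j t IH] e z dj.
  move=> [a ->]; rewrite linearZ /=; case: e; last by rewrite W_kill ?scaler0.
  have := odd_op_anticomm d u v0_wt; rewrite (W_kill Wd) linear0 addr0 => ->.
  by rewrite Wu // scale0r scaler0.
have dt i : i \in t -> form d (c i) = 0 by move=> it; rewrite dj // inE it orbT.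
move=> [z0 [z1 [H0 H1 ->]]]; rewrite linearD /= (IH _ _ dt H0) add0r.
have := odd_op_anticomm d (c j) (clifford_span_weight H1).
by rewrite dj ?mem_head // scale0r (IH _ _ dt H1) linear0 addr0.
Qed.

(** In z = z0 + c_j z1 both z0 and z1 are killed by w_j, which kills v0 and is orthogonal to u and
    to the later c_i; hence w_j z = z1, and one factor is stripped. A final multiple of u v0 is
    brought back to v0 by u, whose square acts on v0 by a nonzero scalar. *)
Lemma clifford_span_irr (N : V -> Prop) js e z :
  (forall a x, N x -> N (a *: x)) -> (forall d x, N x -> N (odd_op d x)) -> uniq js ->
  clifford_span js e z -> z != 0 -> N z -> N v0.
Proof.
move=> NZ NH; elim: js e z => [|j t IH] e z /=.
  move=> _ [a ->] nz Nz.
  have a0 : a != 0 by apply: contraNneq nz => ->; rewrite scale0r.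
  case: e nz Nz => nz Nz; last by have := NZ a^-1 _ Nz; rewrite scalerA mulVf // scale1r.
  have u0 : u != 0.
    apply: contraNneq nz => ->; rewrite /odd_op big1 ?scaler0 // => i _.
    by rewrite mxE scale0r.
  have := NZ (a * (form u u / 2%:R))^-1 _ (NH u _ Nz).
  rewrite linearZ /= odd_op_sq // !scalerA -mulrA mulVf ?scale1r //.
  by apply: mulf_neq0 => //; apply: mulf_neq0; rewrite ?uu // invr_neq0 // (two_neq0 p_char p_gt2).
move=> /andP[jt Ut] [z0 [z1 [H0 H1 Ez]]] nz Nz.
have [z10|z10] := eqVneq z1 0.
  by apply: (IH _ _ Ut H0); move: nz Nz; rewrite Ez z10 linear0 addr0.
apply: (IH _ _ Ut H1) => //; have := NH (w j) _ Nz.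
have wj i : i \in t -> form (w j) (c i) = 0.
  by move=> it; rewrite wc; case: eqP => // E; rewrite E it in jt.
rewrite Ez linearD /= (clifford_span_kill (wW j) wj H0) add0r.
have := odd_op_anticomm (w j) (c j) (clifford_span_weight H1).
by rewrite (clifford_span_kill (wW j) wj H1) linear0 addr0 wc eqxx scale1r => ->.
Qed.
End Spanning.

Lemma cartan_irreducible (N : V -> Prop) e y :
  (forall a x, N x -> N (a *: x)) -> (forall d x, N x -> N (odd_op d x)) ->
  cartan_span X v0 e y -> y != 0 -> N y -> N v0.
Proof.
move=> NZ NH Yy y0 Ny.
have [u [Wu uu Wline]] := anisotropic_line.
have [r [w [c [wW wc Wdual]]]] := dual_vectors lam Wm.
pose S := clifford_span c u (enum 'I_r).
have S0 e' : S e' 0 by exact: clifford_span0.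
(* The space h_1 is the sum of W, the line of u and the span of the c_j: subtracting the c_j makes d
   orthogonal to W, and a multiple of u then takes it into W. *)
have SH d e' z : S e' z -> S (~~ e') (odd_op d z).
  move=> Sz; have [a Ha] := Wdual d; have [t Ht] := Wline _ Ha.
  rewrite -(subrK (\sum_j a j *: c j) d) -[d - _](subrK (t *: u)) -addrA.
  rewrite -[_ - t *: u]scale1r odd_opD; apply: clifford_spanD.
    exact: (clifford_span_W Wu Ht).
  rewrite odd_opD; apply: clifford_spanD; first exact: clifford_span_u.
  rewrite -[odd_op _ z]addr0.
  elim: (index_enum _) => [|j js IH].
    rewrite big_nil /odd_op big1 ?addr0; first exact: S0.
    by move=> i _; rewrite mxE scale0r.
  rewrite addr0 big_cons odd_opD -[odd_op (\sum_(_ <- js) _) z]addr0.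
  by apply: clifford_spanD => //; apply: clifford_span_c; rewrite ?mem_enum.
have Sv0 js : clifford_span c u js false v0.
  by elim: js => [|j js IH]; [exists 1; rewrite scale1r|exact: clifford_span_head].
apply: (@clifford_span_irr _ w c u wW wc Wu uu N (enum 'I_r) e y) => //.
  exact: enum_uniq.
rewrite -/S; elim: Yy {y0 Ny} => [|a x z [t [t1 <- ->]] _ IH]; first exact: S0.
apply: clifford_spanD => // {IH z x a}.
elim: t t1 => [_|[d [i j]] t IH /= /andP[/eqP/= <- /IH Ht]].
  by rewrite /wparity big_nil; exact: Sv0.
rewrite wparity_cons /=; case: d => /=; first by rewrite -odd_op_delta; exact: SH.
by rewrite (clifford_span_weight Ht); apply: clifford_spanZ.
Qed.
End Clifford.

(** * Jacobson's formula *)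

Lemma sign_bin_pred p i : prime p -> (i < p)%N ->
  exists k : int, (-1) ^+ i * ('C(p.-1, i))%:Z = 1 + k * p%:Z.
Proof.
move=> p_pr; have p_gt0 := prime_gt0 p_pr; elim: i => [|i IH] ip.
  by exists 0; rewrite bin0.
have [k Ek] := IH (ltnW ip).
have /dvdnP[m Em] : (p %| 'C(p, i.+1))%N by apply: prime_dvd_bin.
have : ('C(p.-1, i.+1))%:Z = m%:Z * p%:Z - ('C(p.-1, i))%:Z.
  by rewrite -PoszM -Em -[in 'C(p, _)](prednK p_gt0) binS PoszD addrK.
move=> ->; exists (k - (-1) ^+ i * m%:Z).
by rewrite exprS mulrBr -!mulrA !mulN1r Ek; ring.
Qed.

Section Ad.
Variables (R : nzRingType) (c : R).
Definition ad (y : R) : R := c * y - y * c.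

Lemma iter_ad k y : iter k ad y =
  \sum_(i < k.+1) (c ^+ (k - i) * y * c ^+ i) *~ ((-1) ^+ i * ('C(k, i))%:Z).
Proof.
elim: k => [|k IH]; first by rewrite big_ord1 /= mul1r mulr1.
rewrite /= IH /ad mulr_sumr mulr_suml.
rewrite [X in _ - X]big_ord_recr big_ord_recl [RHS]big_ord_recr big_ord_recl /=.
rewrite !bin0 !binn !subn0 !subnn !expr0 !mulr1 !mul1r.
rewrite !mulrA -exprS opprD -!addrA; congr (_ + _).
rewrite !addrA; congr (_ + _); last first.
  by rewrite mulrzAl -mulrA -exprSr [(-1) ^+ k.+1]exprS mulN1r mulrNz.
rewrite -sumrB; apply: eq_bigr => -[i ik] _ /=.
rewrite /bump /= add1n binS PoszD mulrDr mulrzDr; congr (_ + _).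
  by rewrite mulrzAr !mulrA -exprS -subSn.
by rewrite subSS mulrzAl -[_ * c ^+ i * c]mulrA -exprSr [(-1) ^+ i.+1]exprS mulN1r mulNr mulrNz.
Qed.

(** The coefficients (-1)^i C(p-1, i) are all 1 modulo p. *)
Lemma iter_ad_pred p y : p \in [pchar R] ->
  iter p.-1 ad y = \sum_(i < p) c ^+ (p.-1 - i) * y * c ^+ i.
Proof.
move=> pc; have p_pr : prime p by case/andP: pc.
rewrite iter_ad; move: (prednK (prime_gt0 p_pr)) => E.
rewrite -[in RHS]E; apply: eq_bigr => -[i ip] _ /=.
have [k ->] : exists k : int, (-1) ^+ i * ('C(p.-1, i))%:Z = 1 + k * p%:Z.
  by apply: sign_bin_pred => //; rewrite -E.
by rewrite mulrzDr mulrzA -[X in _ + X]pmulrn mulrn_pchar // addr0.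
Qed.
End Ad.

Section Coefficients.
Variables (R : nzRingType) (a b : R).
Local Notation c := (a%:P * 'X + b%:P).

Lemma coef_linM q i : (c * q)`_i = (if i is j.+1 then a * q`_j else 0) + b * q`_i.
Proof.
rewrite mulrDl coefD coefCM -mulrA coefCM coefXM.
by case: i => //=; rewrite mulr0.
Qed.

Lemma coef_lin_gt k i : (k < i)%N -> (c ^+ k)`_i = 0.
Proof.
elim: k i => [|k IH] [|i] // ki; first by rewrite expr0 coef1.
by rewrite exprS coef_linM !IH ?mulr0 ?addr0 //; apply: ltnW.
Qed.

Lemma coef_lin_top k : (c ^+ k)`_k = a ^+ k.
Proof.
elim: k => [|k IH]; first by rewrite expr0 coef1.
by rewrite exprS coef_linM IH coef_lin_gt // mulr0 addr0 exprS.
Qed.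

Lemma coef_lin0 k : (c ^+ k)`_0 = b ^+ k.
Proof.
elim: k => [|k IH]; first by rewrite expr0 coef1.
by rewrite exprS coef_linM IH add0r exprS.
Qed.

Lemma sum_coef_lin k : \sum_(i < k.+1) (c ^+ k)`_i = (a + b) ^+ k.
Proof.
elim: k => [|k IH]; first by rewrite big_ord1 !expr0 coef1.
rewrite exprS; under eq_bigr do rewrite coef_linM.
rewrite big_split /= big_ord_recl /= add0r [X in _ + X]big_ord_recr /=.
by rewrite coef_lin_gt // mulr0 addr0 -!mulr_sumr IH -mulrDl exprS.
Qed.

Lemma deriv_lin : c^`() = a%:P.
Proof. by rewrite derivD derivC addr0 derivM derivX derivC mul0r add0r mulr1. Qed.

Lemma deriv_lin_exp k : (c ^+ k)^`() = \sum_(i < k) c ^+ (k.-1 - i) * a%:P * c ^+ i.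
Proof.
elim: k => [|k IH]; first by rewrite expr0 derivC big_ord0.
rewrite exprS derivM deriv_lin IH big_ord_recr /= subnn expr0 mul1r addrC.
congr (_ + _); rewrite mulr_sumr; apply: eq_bigr => -[i ik] _ /=.
by rewrite !mulrA -exprS; congr (c ^+ _ * _ * _); lia.
Qed.

Lemma coef_ad_lin q i :
  (ad c q)`_i = (if i is j.+1 then ad a q`_j else 0) + ad b q`_i.
Proof.
rewrite /ad coefB coef_linM mulrDr coefD coefMC mulrA coefMX.
case: i => [|i] /=; first by rewrite !add0r.
by rewrite coefMC opprD addrACA.
Qed.
End Coefficients.

(** For c = a X + b the derivative of c^p is the sum of c^(p-1-i) a c^i, that is ad(c)^(p-1)(a). So
    j + 1 times the coefficient of degree j + 1 of c^p is a Lie polynomial in a and b, and j + 1 is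
    invertible below p. A map preserving commutators respects these coefficients, and those strictly
    between the ends add up to (a + b)^p - a^p - b^p. *)
Lemma jacobson (K : fieldType) (p : nat) (R S : algType K) (f : {linear R -> S}) a b :
  p \in [pchar K] ->
  (forall x y, f (x * y - y * x) = f x * f y - f y * f x) ->
  f ((a + b) ^+ p) - f (a ^+ p) - f (b ^+ p) = (f a + f b) ^+ p - f a ^+ p - f b ^+ p.
Proof.
move=> pc fad; have p_pr : prime p by case/andP: pc.
have pP (A : algType K) : p \in [pchar {poly A}].
  rewrite pchar_poly; apply/andP; split=> //.
  by rewrite -scaler_nat (pcharf0 pc) scale0r.
pose cR := a%:P * 'X + b%:P; pose cS := (f a)%:P * 'X + (f b)%:P.
have fad_iter k q i : f (iter k (ad cR) q)`_i = (iter k (ad cS) (map_poly f q))`_i.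
  elim: k i => [|k IH] i /=; first by rewrite coef_map.
  have fA x y : f (ad x y) = ad (f x) (f y) by exact: fad.
  by rewrite !coef_ad_lin linearD fA IH; case: i => [|i]; rewrite ?linear0 // fA IH.
have coef_eq j : (j.+1 < p)%N -> f (cR ^+ p)`_j.+1 = (cS ^+ p)`_j.+1.
  move=> jp; have j0 : j.+1%:R != 0 :> K by rewrite -(dvdn_pcharf pc) gtnNdvd.
  apply: (scalerI j0); rewrite -linearZ /= !scaler_nat -!coef_deriv.
  transitivity (f (iter p.-1 (ad cR) a%:P)`_j).
    by rewrite iter_ad_pred ?pP // -deriv_lin_exp.
  rewrite fad_iter iter_ad_pred ?pP // map_polyC /=.
  by rewrite deriv_lin_exp.
have [k Ep] : exists k, p = k.+1 by exists p.-1; rewrite prednK ?prime_gt0.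
have E (A : algType K) (x y : A) : (x + y) ^+ p - x ^+ p - y ^+ p =
    \sum_(i < k) ((x%:P * 'X + y%:P) ^+ p)`_i.+1.
  rewrite -sum_coef_lin Ep big_ord_recr big_ord_recl /= -Ep.
  rewrite coef_lin0 coef_lin_top addrK [y ^+ p + _]addrC addrK.
  by apply: eq_bigr => i _; rewrite /bump.
rewrite -!linearB /= !E linear_sum; apply: eq_bigr => i _; apply: coef_eq.
by rewrite Ep ltnS.
Qed.

Lemma mx_delta_ind (K : fieldType) (n : nat) (Q : 'M[K]_n -> Prop) : Q 0 ->
  (forall c i j A, Q A -> Q (c *: delta_mx i j + A)) -> forall A, Q A.
Proof.
move=> Q0 QD A; rewrite (matrix_sum_delta A) pair_big /=.
elim: (index_enum _) => [|[i j] r IH]; first by rewrite big_nil.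
by rewrite big_cons; apply: QD.
Qed.

Lemma matrix_jacobson (K : fieldType) (p n : nat) (S : algType K)
    (f : {linear 'M[K]_n -> S}) (A B : 'M[K]_n) : p \in [pchar K] ->
  (forall A B : 'M[K]_n, f (A *m B - B *m A) = f A * f B - f B * f A) ->
  f ((A + B) ^+ p) - f (A ^+ p) - f (B ^+ p) = (f A + f B) ^+ p - f A ^+ p - f B ^+ p.
Proof.
(* Matrices of size 0 form the zero ring, to which [jacobson] does not apply; there f is zero. *)
case: n f A B => [|n] f A B pc fad; last exact: (jacobson A B pc fad).
have p_gt0 : (0 < p)%N by apply: prime_gt0; case/andP: pc.
have f0 M : f M = 0 by rewrite [M]flatmx0 linear0.
by rewrite !f0 addr0 expr0n gtn_eqF // !subr0.
Qed.

(** * The oscillator representation *)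

(* [u false], [u true] are the bosonic and fermionic creation operators and
   [v false], [v true] the annihilation operators; the sites form a matrix. *)
Record clifford_weyl (K : fieldType) (p n : nat) (mu : 'I_n -> K) (S : algType K)
    (u v : bool -> 'I_n * 'I_n -> S) : Prop := CliffordWeyl {
  cw_vu : forall a b z w, v b z * u a w =
    (-1) ^+ (a && b) *: (u a w * v b z) + ((a == b) && (z == w))%:R;
  cw_uu : forall a b z w, u a z * u b w = (-1) ^+ (a && b) *: (u b w * u a z);
  cw_vv : forall a b z w, v a z * v b w = (-1) ^+ (a && b) *: (v b w * v a z);
  cw_u2 : forall z, u true z * u true z = 0;
  cw_v2 : forall z, v true z * v true z = 0;
  cw_up : forall i j, i != j -> u false (i, j) ^+ p = 0;
  cw_vp : forall i j, i != j -> v false (i, j) ^+ p = 0;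
  cw_Np : forall i j, (u false (i, j) * v false (i, j)) ^+ p =
    u false (i, j) * v false (i, j) + (if i == j then mu i ^+ p - mu i else 0)%:A }.

Section CliffordWeyl.
Variables (K : fieldType) (p n : nat) (mu : 'I_n -> K) (S : algType K).
Variables u v : bool -> 'I_n * 'I_n -> S.
Hypotheses (p_char : p \in [pchar K]) (p_gt2 : (2 < p)%N).
Hypothesis cw : clifford_weyl p mu u v.

(** The action of q(n) by differential operators on functions on n copies of the natural module
    K^(n|n), numbered by k: e_ij is the sum of x_ik d/dx_jk + xi_ik d/dxi_jk, and E_ij is its mixed
    analogue. *)
Definition cw_letter (l : letter n) : S :=
  \sum_k \sum_a u a (l.2.1, k) * v (a (+) l.1) (l.2.2, k).

Lemma signM (b c : bool) (s t : S) :
  ((-1) ^+ b *: s) * ((-1) ^+ c *: t) = (-1) ^+ (b (+) c) *: (s * t).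
Proof. by rewrite -scalerAl -scalerAr scalerA signr_addb. Qed.

Lemma signK (b : bool) (s : S) : (-1) ^+ b *: ((-1) ^+ b *: s) = s.
Proof. by rewrite scalerA -signr_addb addbb scale1r. Qed.

(** The quartic terms of the two orders agree up to sign, and only the single contractions
    remain. *)
Lemma cw_quadratic a b c d z z' w w' :
  u a z * v b z' * (u c w * v d w') =
  (-1) ^+ ((a (+) b) && (c (+) d)) *: (u c w * v d w' * (u a z * v b z'))
  + (((b == c) && (z' == w))%:R *: (u a z * v d w')
     - ((-1) ^+ ((a (+) b) && (c (+) d)) * ((d == a) && (w' == z))%:R) *: (u c w * v b z')).
Proof.
have quad a' b' c' d' x x' y y' : u a' x * v b' x' * (u c' y * v d' y') =
    (-1) ^+ (c' && b') *: (u a' x * u c' y * (v b' x' * v d' y'))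
    + ((b' == c') && (x' == y))%:R *: (u a' x * v d' y').
  rewrite mulrA -[_ * _ * u c' y]mulrA (cw_vu cw) mulrDr mulrDl eq_sym.
  rewrite -scalerAr -scalerAl !mulrA; congr (_ + _).
  by rewrite mulr_natr mulrnAl scaler_nat.
rewrite (quad a b c d) (quad c d a b) scalerDr !scalerA -!addrA; congr (_ + _).
  rewrite [u a z * u c w](cw_uu cw) [v b z' * v d w'](cw_vv cw) signM scalerA.
  by congr (_ *: _); rewrite -!signr_addb; case: a b c d => [] [] [] [].
by rewrite addrCA subrr addr0.
Qed.

Lemma cw_bracket d e i j k l :
  cw_letter (d, (i, j)) * cw_letter (e, (k, l)) =
  (-1) ^+ (d && e) *: (cw_letter (e, (k, l)) * cw_letter (d, (i, j)))
  + ((j == k)%:R *: cw_letter (d (+) e, (i, l))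
     - ((-1) ^+ (d && e) * (l == i)%:R) *: cw_letter (d (+) e, (k, j))).
Proof.
rewrite /cw_letter /=.
have E f g (i1 j1 k1 l1 : 'I_n) :
   (\sum_m \sum_a u a (i1, m) * v (a (+) f) (j1, m)) *
   (\sum_m \sum_a u a (k1, m) * v (a (+) g) (l1, m)) =
   \sum_m \sum_a \sum_m' \sum_c
     u a (i1, m) * v (a (+) f) (j1, m) * (u c (k1, m') * v (c (+) g) (l1, m')).
  rewrite mulr_suml; apply: eq_bigr => m _; rewrite mulr_suml; apply: eq_bigr => a _.
  rewrite mulr_sumr; apply: eq_bigr => m' _; rewrite mulr_sumr; by apply: eq_bigr.
rewrite !E.
have -> : \sum_m \sum_a \sum_m' \sum_c
     u a (k, m) * v (a (+) e) (l, m) * (u c (i, m') * v (c (+) d) (j, m')) =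
   \sum_m \sum_a \sum_m' \sum_c
     u c (k, m') * v (c (+) e) (l, m') * (u a (i, m) * v (a (+) d) (j, m)).
  under eq_bigr do rewrite exchange_big /=.
  rewrite exchange_big /=; apply: eq_bigr => m _.
  under eq_bigr do rewrite exchange_big /=.
  by rewrite exchange_big.
have sw (b1 b2 : bool) : b1 (+) (b1 (+) b2) = b2 by rewrite addbA addbb.
rewrite !scaler_sumr -sumrB -big_split; apply: eq_bigr => m _ /=.
have split3 (I J : finType) (f g h : I -> J -> S) :
    \sum_x \sum_y (f x y + (g x y - h x y)) =
    \sum_x \sum_y f x y + (\sum_x \sum_y g x y - \sum_x \sum_y h x y).
  rewrite -sumrB -big_split; apply: eq_bigr => x _ /=.
  by rewrite -sumrB -big_split.
have only (I J : finType) (f : I -> J -> S) x0 y0 :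
    (forall x y, ~~ ((x == x0) && (y == y0)) -> f x y = 0) -> \sum_x \sum_y f x y = f x0 y0.
  move=> f0; rewrite (bigD1 x0) //= (bigD1 y0) //= !big1 ?addr0 // => [x xx0|y yy0].
    by rewrite big1 // => y _; apply: f0; rewrite negb_and xx0.
  by apply: f0; rewrite (negbTE yy0) andbF.
have -> : \sum_a u a (k, m) * v (a (+) (d (+) e)) (j, m) =
    \sum_a u (a (+) e) (k, m) * v (a (+) d) (j, m).
  rewrite (reindex_inj (h := addb^~ e)) /=; last by move=> x y /addIb.
  by apply: eq_bigr => a _; rewrite -addbA [e (+) (d (+) e)]addbC addbK.
rewrite !scaler_sumr -sumrB -big_split; apply: eq_bigr => a _ /=.
under eq_bigr => m' _ do under eq_bigr => c _ do rewrite cw_quadratic !sw.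
rewrite split3; congr (_ + (_ - _)).
- by rewrite scaler_sumr; apply: eq_bigr => m' _; rewrite scaler_sumr.
- rewrite (only _ _ _ m (a (+) d)); first by rewrite eqxx xpair_eqE eqxx andbT addbA.
  move=> m' c; rewrite xpair_eqE (eq_sym m) (eq_sym (a (+) d)).
  by case: (c == _); case: (m' == m) => //= _; rewrite ?andbF scale0r.
rewrite (only _ _ _ m (a (+) e)); first by rewrite addbK eqxx xpair_eqE eqxx andbT.
move=> m' c H; case: eqP => [ce|]; last by rewrite mulr0 scale0r.
have ca : c = a (+) e by rewrite -ce addbK.
move: H; rewrite ca eqxx andbT xpair_eqE => /negbTE->.
by rewrite andbF mulr0 scale0r.
Qed.

Lemma cw_even_comm a c i j k k' : (k, a) != (k', c) ->
  GRing.comm (u a (i, k) * v a (j, k)) (u c (i, k') * v c (j, k')).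
Proof.
move=> kc; rewrite /GRing.comm cw_quadratic addbb /= expr0 !scale1r mul1r.
have H (x y : 'I_n) : (a == c) && ((x, k) == (y, k')) = false.
  by apply: contraNF kc => /andP[/eqP-> /eqP[_ ->]].
by rewrite [c == a]eq_sym [(j, k') == _]eq_sym !H !scale0r subrr addr0.
Qed.

Lemma pcharS : p \in [pchar S].
Proof.
apply/andP; split; first by case/andP: p_char.
by rewrite -scaler_nat (pcharf0 p_char) scale0r.
Qed.

Lemma sum_pow (I : eqType) (r : seq I) (F : I -> S) : uniq r ->
  (forall i j, i != j -> GRing.comm (F i) (F j)) ->
  (\sum_(i <- r) F i) ^+ p = \sum_(i <- r) F i ^+ p.
Proof.
move=> + H; elim: r => [_|i r IH /= /andP[ir /IH{}IH]].
  by rewrite !big_nil expr0n gtn_eqF // prime_gt0 //; case/andP: p_char.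
rewrite !big_cons -!(pFrobenius_autE pcharS) pFrobenius_autD_comm.
  by rewrite !pFrobenius_autE IH.
rewrite big_seq; apply: commr_sum => j jr; apply: H.
by apply: contraNneq ir => ->.
Qed.

Lemma cw_odd_pow i j k : (u true (i, k) * v true (j, k)) ^+ p =
  if i == j then u true (i, k) * v true (j, k) else 0.
Proof.
have sq : (u true (i, k) * v true (j, k)) ^+ 2 =
    if i == j then u true (i, k) * v true (j, k) else 0.
  rewrite expr2 -mulrA [v _ _ * _]mulrA (cw_vu cw) /= expr1 xpair_eqE eqxx andbT.
  rewrite mulrDl mulrDr scaleN1r mulNr mulrN -!mulrA (cw_v2 cw) !mulr0 oppr0 add0r.
  by rewrite eq_sym; case: eqP; rewrite ?mul1r ?mul0r ?mulr0.
rewrite -(subnK (ltnW p_gt2)) addn2; case: eqP sq => [_|_] sq.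
  elim: (p - 2)%N => // m IH; by rewrite exprS IH -expr2.
by rewrite -addn2 exprD sq mulr0.
Qed.

Lemma cw_bosonic_pow i j k : (u false (i, k) * v false (j, k)) ^+ p =
  if i == j then u false (i, k) * v false (j, k) +
    (if k == i then mu i ^+ p - mu i else 0)%:A else 0.
Proof.
case: eqVneq => [<-|ij]; first by rewrite (cw_Np cw) [k == i]eq_sym.
have C : GRing.comm (u false (i, k)) (v false (j, k)).
  rewrite /GRing.comm (cw_vu cw) /= expr0 scale1r xpair_eqE [j == i]eq_sym (negbTE ij).
  by rewrite addr0.
rewrite exprMn_comm //; have [ik|ik] := eqVneq i k; last by rewrite (cw_up cw) // mul0r.
by rewrite (cw_vp cw) ?mulr0 // -ik eq_sym.
Qed.

(** The summands commute for distinct (k, a), so the p-th power is taken termwise. For i = j only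
    the boson at the site (i, i) violates N^p = N, and it contributes mu_i^p - mu_i. *)
Lemma cw_letter_pow i j : cw_letter (false, (i, j)) ^+ p =
  if i == j then cw_letter (false, (i, j)) + (mu i ^+ p - mu i)%:A else 0.
Proof.
rewrite /cw_letter /= pair_big /=; under eq_bigr do rewrite addbF.
rewrite sum_pow ?index_enum_uniq //; last first.
  by move=> [k a] [k' c] kc; apply: cw_even_comm.
rewrite -(pair_big xpredT xpredT (fun k a => (u a (i, k) * v a (j, k)) ^+ p)) /=.
rewrite -(pair_big xpredT xpredT (fun k a => u a (i, k) * v a (j, k))) /=.
under eq_bigr do rewrite big_bool /= cw_odd_pow cw_bosonic_pow.
case: eqVneq => [_|_]; last by rewrite big1 // => k _; rewrite addr0.
under eq_bigr do rewrite addrA; rewrite big_split /=; congr (_ + _).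
  by apply: eq_bigr => k _; rewrite big_bool.
by rewrite (bigD1 i) //= eqxx big1 ?addr0 // => k /negbTE->; rewrite scale0r.
Qed.

Definition cw_mx (d : bool) (A : 'M[K]_n) : S :=
  \sum_i \sum_j A i j *: cw_letter (d, (i, j)).

Fact cw_mx_linear d : linear (cw_mx d).
Proof.
move=> c A B; rewrite /cw_mx scaler_sumr -big_split; apply: eq_bigr => i _ /=.
rewrite scaler_sumr -big_split; apply: eq_bigr => j _ /=.
by rewrite !mxE scalerDl scalerA.
Qed.
HB.instance Definition _ d :=
  GRing.isLinear.Build K 'M[K]_n S *:%R (cw_mx d) (cw_mx_linear d).

Lemma cw_mx_delta d i j : cw_mx d (delta_mx i j) = cw_letter (d, (i, j)).
Proof.
rewrite /cw_mx (bigD1 i) //= (bigD1 j) //= mxE !eqxx scale1r !big1 ?addr0 //.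
  by move=> k /negbTE ki; rewrite big1 // => l _; rewrite mxE ki scale0r.
by move=> k /negbTE kj; rewrite mxE kj andbF scale0r.
Qed.

Lemma cw_mx_bracket d e A B : cw_mx d A * cw_mx e B =
  (-1) ^+ (d && e) *: (cw_mx e B * cw_mx d A)
  + cw_mx (d (+) e) (A *m B - (-1) ^+ (d && e) *: (B *m A)).
Proof.
have Dl c D (A' B' : 'M[K]_n) t : (c *: D + A') *m B' - t *: (B' *m (c *: D + A')) =
    c *: (D *m B' - t *: (B' *m D)) + (A' *m B' - t *: (B' *m A')).
  rewrite mulmxDl mulmxDr -scalemxAl -scalemxAr scalerDr scalerBr opprD addrACA.
  by rewrite !scalerA [t * c]mulrC.
have Dr c D (A' B' : 'M[K]_n) t : A' *m (c *: D + B') - t *: ((c *: D + B') *m A') =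
    c *: (A' *m D - t *: (D *m A')) + (A' *m B' - t *: (B' *m A')).
  rewrite mulmxDl mulmxDr -scalemxAl -scalemxAr scalerDr scalerBr opprD addrACA.
  by rewrite !scalerA [t * c]mulrC.
have lin f c D A' : cw_mx f (c *: D + A') = c *: cw_mx f D + cw_mx f A' by rewrite linearP.
have comb c t (x1 x2 y1 y2 : S) : c *: (t *: x1 + y1) + (t *: x2 + y2) =
    t *: (c *: x1 + x2) + (c *: y1 + y2).
  by rewrite !scalerDr !scalerA [t * c]mulrC addrACA.
elim/mx_delta_ind: A => [|c i j A IH].
  by rewrite mul0mx mulmx0 scaler0 subr0 !linear0 mulr0 mul0r scaler0 addr0.
rewrite Dl !lin mulrDr mulrDl IH -scalerAr -scalerAl -comb; congr (_ *: _ + _).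
elim/mx_delta_ind: B {IH} => [|b k l B IH].
  by rewrite mul0mx mulmx0 scaler0 subr0 !linear0 mulr0 mul0r scaler0 addr0.
rewrite Dr !lin mulrDr mulrDl IH -scalerAr -scalerAl -comb; congr (_ *: _ + _).
rewrite !cw_mx_delta cw_bracket !mul_delta_mx_cond -!scaler_nat scalerA; congr (_ + _).
by rewrite linearB /= !linearZ /= !cw_mx_delta.
Qed.

Variable chi : {scalar 'M[K]_n}.
Hypothesis chi_delta : forall i j,
  chi (delta_mx i j) ^+ p = if i == j then mu i ^+ p - mu i else 0.

(** The defect [th] is additive by Jacobson's formula and p-semilinear, as is the p-th power of chi,
    so it suffices to compare them on matrix units. *)
Lemma cw_mx_pow A : cw_mx false A ^+ p - cw_mx false (A ^+ p) - (chi A ^+ p)%:A = 0.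
Proof.
have p_pr : prime p by case/andP: p_char.
have p_gt0 := prime_gt0 p_pr.
pose th A := cw_mx false A ^+ p - cw_mx false (A ^+ p).
have H A2 B2 : cw_mx false (A2 *m B2 - B2 *m A2) =
    cw_mx false A2 * cw_mx false B2 - cw_mx false B2 * cw_mx false A2.
  by rewrite cw_mx_bracket /= expr0 !scale1r [RHS]addrC addKr.
have thD A1 B1 : th (A1 + B1) = th A1 + th B1.
  have /eqP := matrix_jacobson A1 B1 p_char H.
  rewrite !subr_eq /= => /eqP E; rewrite /th linearD /= E.
  move: (_ ^+ p) (cw_mx _ A1 ^+ p) (cw_mx _ B1 ^+ p) (cw_mx _ (A1 ^+ p)) (cw_mx _ (B1 ^+ p)) => x y z t w.
  by rewrite !opprD !opprK !addrA subrr add0r [y - t + z]addrAC [RHS]addrAC.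
have thZ c A1 : th (c *: A1) = c ^+ p *: th A1.
  have powZ k : (c *: A1) ^+ k = c ^+ k *: A1 ^+ k.
    elim: k => [|k IH]; first by rewrite !expr0 scale1r.
    by rewrite !exprS IH -[LHS]/(_ *m _) -scalemxAl -scalemxAr scalerA.
  have lZ a M : cw_mx false (a *: M) = a *: cw_mx false M by exact: linearZ.
  by rewrite /th powZ !lZ exprZn scalerBr.
suff thE : th A = (chi A ^+ p)%:A by apply/eqP; rewrite subr_eq0; apply/eqP.
elim/mx_delta_ind: A => [|c i j A IH].
  by rewrite -(scale0r 0) thZ linearZ /= !expr0n gtn_eqF // mul0r expr0n gtn_eqF // !scale0r.
rewrite thD thZ IH linearP -!(pFrobenius_autE p_char) rmorphD /= rmorphM /= !pFrobenius_autE.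
rewrite chi_delta scalerDl -scalerA; congr (_ *: _ + _).
rewrite /th cw_mx_delta cw_letter_pow; have [<-|ij] := eqVneq i j.
  have -> : (delta_mx i i : 'M[K]_n) ^+ p = delta_mx i i.
    rewrite -(prednK p_gt0); elim: p.-1 => // k Ek.
    by rewrite exprS Ek -[_ * _]/(_ *m _) mul_delta_mx.
  by rewrite cw_mx_delta addrC addKr.
have -> : (delta_mx i j : 'M[K]_n) ^+ p = 0.
  rewrite -(subnK (ltnW p_gt2)) exprD expr2 -[X in _ * X]/(_ *m _).
  by rewrite mul_delta_mx_cond eq_sym (negbTE ij) mulr0.
by rewrite linear0 subrr scale0r.
Qed.
End CliffordWeyl.

(** * Lowering words on oscillator vacua *)

Fixpoint roots (n : nat) (s : seq 'I_n) : seq ('I_n * 'I_n) :=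
  if s is a :: t then [seq (b, a) | b <- t] ++ roots t else [::].

Lemma lowering_word_roots p n (s : seq 'I_n) :
  lowering_word p s = flatten [seq root_word p r | r <- roots s].
Proof.
by elim: s => //= a t ->; rewrite map_cat flatten_cat -map_comp.
Qed.

Section Vacua.
Variables (K : fieldType) (p n : nat) (mu : 'I_n -> K) (S : algType K).
Variables u v : bool -> 'I_n * 'I_n -> S.
Hypotheses (p_char : p \in [pchar K]) (p_gt2 : (2 < p)%N).
Hypothesis cw : clifford_weyl p mu u v.
Hypothesis u_inj : forall i y, u false (i, i) * y = 0 -> y = 0.
Local Notation site := ('I_n * 'I_n)%type.
Local Notation cwl := (cw_letter u v).

(** The flag [t] exchanges creation and annihilation, so that filling and emptying a site become one
    construction. *)
Definition gen (t a : bool) (z : site) : S := if t then u a z else v a z.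

Lemma gen_swap t t' a b z w : z != w ->
  gen t a z * gen t' b w = (-1) ^+ (a && b) *: (gen t' b w * gen t a z).
Proof.
move=> zw; case: t t' => -[]; rewrite /gen.
- exact: (cw_uu cw).
- by rewrite (cw_vu cw) [w == z]eq_sym (negbTE zw) andbF addr0 signK.
- by rewrite (cw_vu cw) (negbTE zw) andbF addr0 andbC.
exact: (cw_vv cw).
Qed.

Lemma gen_kill t t' a b z w y : z != w -> gen t a z * y = 0 ->
  gen t a z * (gen t' b w * y) = 0.
Proof.
by move=> zw E; rewrite mulrA gen_swap // -scalerAl -mulrA E mulr0 scaler0.
Qed.

Lemma gen_kill_exp t t' a k z w y : z != w -> gen t a z * y = 0 ->
  gen t a z * (gen t' false w ^+ k * y) = 0.
Proof.
move=> zw E; elim: k => [|k IH]; first by rewrite mul1r.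
by rewrite exprS -mulrA; apply: gen_kill.
Qed.

Lemma gen_same t a z : gen t a z * gen t false z = gen t false z * gen t a z.
Proof. by case: t; rewrite /gen; [rewrite (cw_uu cw)|rewrite (cw_vv cw)]; rewrite andbF scale1r. Qed.

Lemma gen_odd_sq t z : gen t true z * gen t true z = 0.
Proof. by case: t; rewrite /gen ?(cw_u2 cw) ?(cw_v2 cw). Qed.

Lemma gen_pow t i j : i != j -> gen t false (i, j) ^+ p = 0.
Proof. by move=> ij; case: t; rewrite /gen ?(cw_up cw) ?(cw_vp cw). Qed.

Lemma gen_pair t a z : gen (~~ t) a z * gen t a z =
  (-1) ^+ a *: (gen t a z * gen (~~ t) a z) + (-1) ^+ (~~ (t || a)) *: 1.
Proof.
have E := cw_vu cw a a z z; rewrite !eqxx /= andbb in E.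
case: t; rewrite /gen /= E ?scale1r //.
rewrite scalerDr signK -addrA; case: a {E} => /=;
  by rewrite ?expr0 ?expr1 ?scaleN1r ?scale1r ?addNr ?subrr ?addr0.
Qed.

(* Off the diagonal every site is either full ([st] true: killed by creation) or
   empty (killed by annihilation). *)
Definition vacuum (st : site -> bool) (y : S) : Prop :=
  forall i j, i != j -> forall a, gen (st (i, j)) a (i, j) * y = 0.

(** Turns an empty site into a full one if [t] is true, and a full one into an empty one
    otherwise. *)
Definition top_gen (t : bool) (z : site) : S := gen t false z ^+ p.-1 * gen t true z.

Lemma p_pos : (0 < p)%N. Proof. exact: ltn_trans p_gt2. Qed.

(** The opposite generators remove the factors one by one, with scalars 1 or k + 1 up to sign, where
    k + 1 < p, all nonzero in K. *)
Lemma top_gen_neq0 t z y : (forall a, gen (~~ t) a z * y = 0) -> y != 0 ->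
  top_gen t z * y != 0.
Proof.
move=> ky y0; rewrite -mulrA.
have E1 : gen (~~ t) true z * (gen t true z * y) = (-1) ^+ (~~ (t || true)) *: y.
  by rewrite mulrA gen_pair mulrDl -scalerAl -mulrA ky mulr0 scaler0 add0r -scalerAl mul1r.
have k1 : gen (~~ t) false z * (gen t true z * y) = 0.
  case: t ky {E1} => ky; rewrite /gen /= in ky *.
    by rewrite mulrA (cw_vu cw) /= addr0 scale1r -mulrA ky mulr0.
  have := cw_vu cw false true z z; rewrite /= addr0 scale1r => E.
  by rewrite mulrA -E -mulrA ky mulr0.
have y1 : gen t true z * y != 0.
  by apply: contraNneq y0 => E; move/eqP: E1; rewrite E mulr0 eq_sym scaler_eq0 signr_eq0.
move: (_ * y) k1 y1 => y' ky' y'0.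
have E k : gen (~~ t) false z * (gen t false z ^+ k.+1 * y') =
    ((-1) ^+ (~~ (t || false)) * k.+1%:R) *: (gen t false z ^+ k * y').
  elim: k => [|k IH].
    rewrite expr1 mulrA gen_pair mulrDl -scalerAl -mulrA ky' mulr0 scaler0 add0r.
    by rewrite -scalerAl mulr1.
  rewrite exprS mulrA mulrA gen_pair !mulrDl -!scalerAl -!mulrA IH scale1r mul1r.
  rewrite -scalerAr mulrA -exprS -scalerDl; congr (_ *: _).
  by rewrite -[k.+2%:R]natr1; ring.
have : (p.-1 < p)%N by rewrite prednK // p_pos.
elim: p.-1 => [|k IH] kp; first by rewrite mul1r.
have := IH (ltnW kp); apply: contraNneq => Ek; move/eqP: (E k).
rewrite Ek mulr0 eq_sym scaler_eq0 mulf_eq0 signr_eq0 /=.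
by rewrite -(dvdn_pcharf p_char) gtnNdvd.
Qed.

Lemma top_gen_vacuum t st i j y : i != j -> vacuum st y -> st (i, j) = ~~ t ->
  vacuum (fun z => if z == (i, j) then t else st z) (top_gen t (i, j) * y).
Proof.
move=> ij vy sz k l kl a; rewrite -mulrA; case: eqP => [->|/eqP klz]; last first.
  by apply: gen_kill_exp => //; apply: gen_kill => //; apply: vy.
case: a; last by rewrite mulrA -exprS prednK ?p_pos // gen_pow // mul0r.
have C : GRing.comm (gen t true (i, j)) (gen t false (i, j) ^+ p.-1).
  by apply: commrX; apply: gen_same.
by rewrite mulrA C -mulrA [gen t true _ * (_ * _)]mulrA gen_odd_sq mul0r mulr0.
Qed.

Lemma u_diag_vacuum st i y : vacuum st y -> vacuum st (u false (i, i) ^+ p * y).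
Proof.
move=> vy k l kl a; apply: (@gen_kill_exp _ true) => //; last exact: vy.
by apply: contraNneq kl => -[-> ->].
Qed.

Lemma u_diag_neq0 i y k : y != 0 -> u false (i, i) ^+ k * y != 0.
Proof.
move=> y0; elim: k => [|k IH]; first by rewrite mul1r.
by rewrite exprS -mulrA; apply: contraNneq IH => /u_inj ->.
Qed.

(** The factor [c] makes room for the powers of diagonal creation operators in [diag_root_word]; it
    is 1 for the saturator. *)
Lemma top_gens_vacuum (c : site -> S) t st zs y :
  (forall z st y, vacuum st y -> vacuum st (c z * y)) ->
  (forall z y, y != 0 -> c z * y != 0) ->
  uniq zs -> (forall z, z \in zs -> (z.1 != z.2) && (st z == ~~ t)) ->
  vacuum st y -> y != 0 ->
  vacuum (fun z => if z \in zs then t else st z) ((\prod_(z <- zs) (c z * top_gen t z)) * y) /\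
  (\prod_(z <- zs) (c z * top_gen t z)) * y != 0.
Proof.
move=> cvac c0; elim: zs => [_ _ vy y0|[i j] zs IH /= /andP[zzs Uzs] Hz vy y0].
  by rewrite big_nil mul1r.
have [|vy1 y1] := IH Uzs _ vy y0.
  by move=> z zz; apply: Hz; rewrite inE zz orbT.
have /= /andP[ij /eqP sij] := Hz _ (mem_head _ _).
rewrite big_cons -[_ * _ * y]mulrA; move: (_ * y) vy1 y1 => y' vy1 y1.
rewrite -[_ * _ * y']mulrA.
have st1 : (if (i, j) \in zs then t else st (i, j)) = ~~ t by rewrite (negbTE zzs).
have vy2 := top_gen_vacuum ij vy1 st1.
split; last first.
  by apply: c0; apply: top_gen_neq0 => // a; have := vy1 i j ij a; rewrite st1.
apply: cvac => k l kl a; have := vy2 k l kl a.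
by rewrite inE; case: eqP.
Qed.

(* Multiplying on the left by an element that kills the off-diagonal creation
   operators reduces the letters of a lowering word to their diagonal terms, whose
   product on a vacuum is easily seen to be nonzero. *)
Definition good_rows (A : seq 'I_n) (x : S) : Prop :=
  forall b, b \notin A -> forall k a, k != b -> x * u a (b, k) = 0.

(** The summand of a letter (i, j) that moves a particle from the site (j, i) to the diagonal site
    (i, i). *)
Definition diag_letter (l : letter n) : S :=
  \sum_a u a (l.2.1, l.2.1) * v (a (+) l.1) (l.2.2, l.2.1).

Lemma good_rows_letter A x d b a : good_rows A x -> b \notin A ->
  x * cwl (d, (b, a)) = x * diag_letter (d, (b, a)).
Proof.
move=> gx bA; rewrite /cw_letter (bigD1 b) //= mulrDr; have gb := gx b bA.
rewrite [X in _ + X]mulr_sumr [X in _ + X]big1 ?addr0 // => k kb.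
by rewrite mulr_sumr big1 // => c _; rewrite mulrA gb // mul0r.
Qed.

(** The annihilators in a letter (b, a) lie in row a, so creators of other rows pass through it up
    to sign. *)
Lemma good_rows_diag A x d b a : good_rows (a :: A) x -> b != a ->
  good_rows (a :: A) (x * diag_letter (d, (b, a))).
Proof.
move=> gx ba b' b'A k c kb'; have gb := gx b' b'A.
rewrite /diag_letter mulr_sumr mulr_suml big1 // => e _ /=.
have b'a : (a, b) != (b', k).
  by apply: contraNneq b'A => -[<- _]; rewrite mem_head.
rewrite -!mulrA -[v _ _]/(gen false (e (+) d) (a, b)) -[u c _]/(gen true c (b', k)).
rewrite (gen_swap _ _ _ _ b'a) -!scalerAr /gen [u e _ * (_ * _)]mulrA (cw_uu cw).
by rewrite -!scalerAl -scalerAr -mulrA [x * (u c _ * _)]mulrA gb // mul0r !scaler0.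
Qed.

Lemma good_rows_weaken A a x : good_rows A x -> good_rows (a :: A) x.
Proof. by move=> gx b; rewrite inE negb_or => /andP[_ /gx]. Qed.

Lemma good_rows_word A a x (w : seq (letter n)) : good_rows (a :: A) x ->
  (forall l, l \in w -> (l.2.2 == a) && (l.2.1 \notin a :: A)) ->
  x * (\prod_(l <- w) cwl l) = x * (\prod_(l <- w) diag_letter l) /\
  good_rows (a :: A) (x * (\prod_(l <- w) diag_letter l)).
Proof.
elim: w x => [|[d [b a']] w IH] x gx Hw; first by rewrite !big_nil mulr1.
have /= /andP[/eqP Ea bA] := Hw _ (mem_head _ _); rewrite {}Ea in Hw *.
have ba : b != a by move: bA; rewrite inE negb_or => /andP[].
have [|E1 E2] := IH _ (good_rows_diag d gx ba).
  by move=> l lw; apply: Hw; rewrite inE lw orbT.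
by rewrite !big_cons !mulrA (good_rows_letter d a gx bA) E1.
Qed.

(** Read from the left, the word never returns to row a after the block of a, so it does no harm
    that this row ceases to be good. *)
Lemma good_rows_lowering A x s : good_rows A x -> uniq s -> ~~ has [in A] s ->
  x * (\prod_(l <- lowering_word p s) cwl l) =
  x * (\prod_(l <- lowering_word p s) diag_letter l).
Proof.
elim: s A x => [|a t IH] A x gx /=; first by rewrite !big_nil.
move=> /andP[at_ Ut]; rewrite negb_or => /andP[aA tA].
rewrite !big_cat /= !mulrA.
have [|E1 E2] := good_rows_word (w := flatten [seq root_word p (b, a) | b <- t])
    (good_rows_weaken (a := a) gx).
  move=> l /flatten_mapP[b bt] /root_word_letter -> /=; rewrite eqxx inE negb_or.
  rewrite (hasPn tA _ bt) andbT; by apply: contraNneq at_ => <-.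
rewrite E1; apply: IH E2 Ut _; apply/hasPn => b bt; rewrite inE negb_or (hasPn tA) // andbT.
by apply: contraNneq at_ => <-.
Qed.

(** With x, xi creating at (b, b) and d, D annihilating at (a, b), the letters are x d + xi D and xi
    d + x D. From xi^2 = D^2 = 0 the product is x^(p-1) xi d^p + x^p d^(p-1) D, and d^p = 0. *)
Lemma diag_root_word a b : a != b ->
  \prod_(l <- root_word p (b, a)) diag_letter l =
  u false (b, b) ^+ p * top_gen false (a, b).
Proof.
move=> ab; rewrite big_cat big_seq1 big_nseq /=.
have zw : (b, b) != (a, b) by apply: contraNneq ab => -[->].
set x := u false (b, b); set xi := u true (b, b).
set d := v false (a, b); set D := v true (a, b).
have G t t' c c' : gen t c (b, b) * gen t' c' (a, b) =
  (-1) ^+ (c && c') *: (gen t' c' (a, b) * gen t c (b, b)) := gen_swap t t' c c' zw.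
have xd : x * d = d * x by have := G true false false false; rewrite scale1r.
have xD : x * D = D * x by have := G true false false true; rewrite scale1r.
have xid : xi * d = d * xi by have := G true false true false; rewrite scale1r.
have xiD : xi * D = - (D * xi) by have := G true false true true; rewrite scaleN1r.
have xxi : x * xi = xi * x by have := cw_uu cw false true (b, b) (b, b); rewrite scale1r.
have dD : d * D = D * d by have := cw_vv cw false true (a, b) (a, b); rewrite scale1r.
have xi2 : xi * xi = 0 by exact: (cw_u2 cw).
have D2 : D * D = 0 by exact: (cw_v2 cw).
have dp : d ^+ p = 0 by exact: (cw_vp cw).
have -> : diag_letter (true, (b, a)) = xi * d + x * D.
  by rewrite /diag_letter big_bool.
have xXd k : d * x ^+ k = x ^+ k * d by apply: commrX.
have xXD k : D * x ^+ k = x ^+ k * D by apply: commrX.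
have xXxi k : xi * x ^+ k = x ^+ k * xi by apply: commrX.
have dXD k : D * d ^+ k = d ^+ k * D by apply: commrX.
have -> : diag_letter (false, (b, a)) = xi * D + x * d.
  by rewrite /diag_letter big_bool.
have E k : iter k ( *%R (xi * D + x * d)) 1 * (xi * d + x * D) =
    x ^+ k * xi * d ^+ k.+1 + x ^+ k.+1 * d ^+ k * D.
  elim: k => [|k IH]; first by rewrite !mul1r mulr1.
  rewrite iterS -mulrA IH mulrDl !mulrDr.
  have -> : xi * D * (x ^+ k * xi * d ^+ k.+1) = 0.
    have Dxi : D * xi = - (xi * D) by rewrite xiD opprK.
    rewrite -!mulrA [D * _]mulrA xXD -mulrA [D * (xi * _)]mulrA Dxi mulNr !mulrN.
    by rewrite mulrA xXxi -!mulrA [xi * (xi * _)]mulrA xi2 mul0r !mulr0 oppr0.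
  have -> : xi * D * (x ^+ k.+1 * d ^+ k * D) = 0.
    by rewrite -!mulrA [D * _]mulrA xXD -mulrA [D * (d ^+ k * D)]mulrA dXD -mulrA D2 !mulr0.
  rewrite !add0r; congr (_ + _).
    rewrite -!mulrA [d * _]mulrA xXd -mulrA [d * (xi * _)]mulrA -xid -mulrA -exprS.
    by rewrite mulrA -exprS.
  by rewrite -!mulrA [d * _]mulrA xXd -mulrA [d * (d ^+ k * D)]mulrA -exprS mulrA -exprS.
rewrite E prednK ?p_pos // dp mulr0 add0r -mulrA; congr (_ * _).
Qed.

Lemma prod_root_words (rs : seq site) : (forall r, r \in rs -> r.1 != r.2) ->
  \prod_(l <- flatten [seq root_word p r | r <- rs]) diag_letter l =
  \prod_(z <- [seq (r.2, r.1) | r <- rs]) (u false (z.2, z.2) ^+ p * top_gen false z).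
Proof.
elim: rs => [|[b a] rs IH] H /=; first by rewrite !big_nil.
have /= ba := H _ (mem_head _ _).
rewrite big_cat /= diag_root_word 1?eq_sym // big_cons IH // => r rr.
by apply: H; rewrite inE rr orbT.
Qed.

Definition saturator : S := \prod_(z <- enum [pred z : site | z.1 != z.2]) top_gen true z.

Lemma top_gen_u a z w : exists b : bool, top_gen true z * u a w = (-1) ^+ b *: (u a w * top_gen true z).
Proof.
exists a; rewrite /top_gen /gen -mulrA (cw_uu cw) /= -scalerAr !mulrA; congr (_ *: (_ * _)).
by symmetry; apply: commrX; rewrite /GRing.comm (cw_uu cw) andbF scale1r.
Qed.

Lemma top_gens_u a zs w : exists b : bool, (\prod_(z <- zs) top_gen true z) * u a w =
  (-1) ^+ b *: (u a w * (\prod_(z <- zs) top_gen true z)).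
Proof.
elim: zs => [|z zs [b Eb]]; first by exists false; rewrite big_nil mul1r mulr1 scale1r.
have [c Ec] := top_gen_u a z w.
exists (b (+) c); rewrite big_cons; move: (top_gen true z) Ec => g Ec.
rewrite -mulrA Eb -scalerAr [g * (_ * _)]mulrA Ec -scalerAl scalerA -mulrA.
by rewrite signr_addb.
Qed.

Lemma saturator_u a i j : i != j -> saturator * u a (i, j) = 0.
Proof.
move=> ij; have : (i, j) \in enum [pred z : site | z.1 != z.2] by rewrite mem_enum inE.
rewrite /saturator; elim: (enum _) => // z zs IH; rewrite inE big_cons.
have [<- _|zij /= zz] := eqVneq (i, j) z; last by rewrite -mulrA IH // mulr0.
have [b Eb] := top_gens_u a zs (i, j).
have E0 : top_gen true (i, j) * u a (i, j) = 0; last first.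
  by move: (top_gen _ _) E0 => g E0; rewrite -mulrA Eb -scalerAr [g * (_ * _)]mulrA E0 mul0r scaler0.
rewrite /top_gen /gen -mulrA; case: a {Eb IH}; first by rewrite (cw_u2 cw) mulr0.
rewrite (cw_uu cw) scale1r mulrA -exprSr prednK ?p_pos // (cw_up cw) ?mul0r //.
Qed.

Section Enumerated.
Variable s : seq 'I_n.
Hypotheses (s_uniq : uniq s) (s_full : forall i, i \in s).
Definition upper (z : site) : bool := (index z.1 s < index z.2 s)%N.

Lemma count_roots b a : count_mem (b, a) (roots s) = (upper (a, b) : nat).
Proof.
have := count_lowering_word p true s_uniq (s_full a) (s_full b).
rewrite lowering_word_roots (count_root_words p (true, (b, a)) id) /= !muln1.
by move=> <-; apply: eq_count.
Qed.

Lemma mem_roots r : (r \in roots s) = upper (r.2, r.1).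
Proof. by case: r => b a; rewrite -has_pred1 has_count count_roots; case: upper. Qed.

Lemma upper_neq i j : upper (i, j) -> i != j.
Proof. by apply: contraTneq => ->; rewrite /upper ltnn. Qed.

Lemma roots_uniq : uniq (roots s).
Proof. by apply: count_mem_uniq => -[b a]; rewrite count_roots mem_roots. Qed.

(** Behind the saturator the lowering word reduces to an operator emptying all upper sites. All
    sites off the diagonal are then empty, and the saturator can fill them without producing
    zero. *)
Lemma lowering_vacuum y : vacuum upper y -> y != 0 ->
  (\prod_(l <- lowering_word p s) cwl l) * y != 0.
Proof.
move=> vy y0.
have Ps : ~~ has [in [::]] s by apply/hasPn.
have good0 : good_rows [::] saturator by move=> b _ k a kb; rewrite saturator_u // eq_sym.
have := good_rows_lowering good0 s_uniq Ps.
rewrite lowering_word_roots [X in _ = _ * X]prod_root_words; last first.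
  by move=> [b a]; rewrite mem_roots => /upper_neq; rewrite eq_sym.
set zs := [seq (r.2, r.1) | r <- roots s].
have mem_zs z : (z \in zs) = upper z.
  case: z => a b; apply/mapP/idP => [[[b' a']]|ab]; first by rewrite mem_roots => ab [-> ->].
  by exists (b, a); rewrite ?mem_roots.
have Uzs : uniq zs by rewrite map_inj_uniq ?roots_uniq // => -[x1 x2] [y1 y2] [-> ->].
have [|||vy1 y1] :=
    @top_gens_vacuum (fun z => u false (z.2, z.2) ^+ p) false upper zs y _ _ Uzs _ vy y0.
- by move=> z st x; apply: u_diag_vacuum.
- by move=> z x; apply: u_diag_neq0.
- by move=> [a b]; rewrite mem_zs => ab; rewrite ab (upper_neq ab).
have [|||_] := @top_gens_vacuum (fun=> 1) true _ (enum [pred z : site | z.1 != z.2]) _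
    _ _ (enum_uniq _) _ vy1 y1.
- by move=> z st x; rewrite mul1r.
- by move=> z x; rewrite mul1r.
- by move=> z; rewrite mem_enum inE => -> /=; rewrite mem_zs; case: upper.
under eq_bigr do rewrite mul1r.
move=> N E; apply: contraNneq N => E0; rewrite mulrA -/saturator.
by rewrite -[_ * _ * y]/((saturator * _) * y) -E -mulrA E0 mulr0.
Qed.

(** In a term creating at (a, k) and annihilating at (b, k), either (a, k) is upper, hence full, or
    k does not come after a, so it precedes b and (b, k) is empty. *)
Lemma vacuum_raise d a b y : vacuum upper y -> upper (a, b) -> cwl (d, (a, b)) * y = 0.
Proof.
move=> vy ab; have nab := upper_neq ab.
rewrite mulr_suml big1 // => k _; rewrite mulr_suml big1 // => c _ /=.
have [ak|ak] := boolP (upper (a, k)).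
  have zw : (a, k) != (b, k) by apply: contraNneq nab => -[->].
  have := vy a k (upper_neq ak) c; rewrite ak => E.
  rewrite -[u c _]/(gen true c (a, k)) -[v _ _]/(gen false (c (+) d) (b, k)) -mulrA.
  exact: gen_kill.
have kb : k != b by apply: contraNneq ak => ->.
have bk : upper (b, k) = false.
  apply: contraNF ak => bk; apply: ltn_trans ab bk.
have := vy b k _ (c (+) d); rewrite bk eq_sym => /(_ kb) E.
by rewrite -mulrA [v _ _ * y]E mulr0.
Qed.

(** A full site holds p - 1 bosons and one fermion, p particles in all, so it adds nothing to the
    weight; in the odd letter no contraction occurs. *)
Lemma cw_diag_letter d a y : vacuum upper y ->
  cwl (d, (a, a)) * y = (\sum_c u c (a, a) * v (c (+) d) (a, a)) * y.
Proof.
move=> vy; rewrite /cw_letter /= (bigD1 a) //= mulrDl [X in _ + X]mulr_suml.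
rewrite [X in _ + X]big1 ?addr0 // => k ka.
rewrite eq_sym in ka; have vk c := vy a k ka c.
rewrite mulr_suml; case U : (upper (a, k)) vk => vk; last first.
  by rewrite big1 // => c _; rewrite -mulrA [v _ _ * y]vk mulr0.
rewrite /gen in vk.
have E c e : u c (a, k) * v e (a, k) * y = - ((-1) ^+ (c && e) * (c == e)%:R) *: y.
  have := cw_vu cw c e (a, k) (a, k); rewrite eqxx andbT => H.
  have -> : u c (a, k) * v e (a, k) =
     (-1) ^+ (c && e) *: (v e (a, k) * u c (a, k) - (c == e)%:R).
    by rewrite H addrK signK.
  rewrite -scalerAl mulrBl -mulrA vk mulr0 sub0r mulr_natl scaleNr scalerN -scalerA.
  by rewrite scaler_nat.
rewrite big_bool /= !E -scalerDl; case: d.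
  by rewrite !mulr0 oppr0 addr0 scale0r.
by rewrite /= expr0 expr1 !mulr1 opprK subrr scale0r.
Qed.

Lemma vacuum_diag d a y : vacuum upper y -> vacuum upper (cwl (d, (a, a)) * y).
Proof.
move=> vy; rewrite cw_diag_letter // => k l kl c.
rewrite mulr_suml mulr_sumr big1 // => e _; rewrite -mulrA.
have zw : (k, l) != (a, a) by apply: contraNneq kl => -[-> ->].
by apply: (@gen_kill _ true) => //; apply: (@gen_kill _ false) => //; apply: vy.
Qed.

Lemma vacuum_weight a y : vacuum upper y ->
  u false (a, a) * v false (a, a) * y + u true (a, a) * v true (a, a) * y = mu a *: y ->
  cwl (false, (a, a)) * y = mu a *: y.
Proof. by move=> vy <-; rewrite cw_diag_letter // big_bool mulrDl addrC. Qed.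
End Enumerated.
End Vacua.

(* The base point [i0] only serves to make the endomorphism ring nonzero. *)
Definition endo (K : fieldType) (I : finType) (i0 : I) : Type := 'End({ffun I -> K^o}).

Section Endo.
Variables (K : fieldType) (I : finType) (i0 : I).
Local Notation E := (endo K i0).
Local Notation V := {ffun I -> K^o}.

HB.instance Definition _ := Vector.on E.

Definition endo_mul (f g : E) : E := (f \o g)%VF.
Definition endo_one : E := \1%VF.

Fact endo_mulA : associative endo_mul. Proof. exact: comp_lfunA. Qed.
Fact endo_mul1 : left_id endo_one endo_mul. Proof. exact: comp_lfun1l. Qed.
Fact endo_mulr1 : right_id endo_one endo_mul. Proof. exact: comp_lfun1r. Qed.
Fact endo_mulDl : left_distributive endo_mul +%R. Proof. exact: comp_lfunDl. Qed.
Fact endo_mulDr : right_distributive endo_mul +%R. Proof. exact: comp_lfunDr. Qed.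
Fact endo_one_neq0 : endo_one != 0.
Proof.
apply/eqP=> /lfunP/(_ [ffun=> 1])/ffunP/(_ i0)/eqP.
by rewrite id_lfunE zero_lfunE !ffunE oner_eq0.
Qed.
HB.instance Definition _ := GRing.Zmodule_isNzRing.Build E
  endo_mulA endo_mul1 endo_mulr1 endo_mulDl endo_mulDr endo_one_neq0.

Fact endo_scaleAl (c : K) (x y : E) : c *: (x * y) = c *: x * y.
Proof. by rewrite /GRing.mul /= /endo_mul comp_lfunZl. Qed.
HB.instance Definition _ := GRing.Lmodule_isLalgebra.Build K E endo_scaleAl.
Fact endo_scaleAr (c : K) (x y : E) : c *: (x * y) = x * (c *: y).
Proof. by rewrite /GRing.mul /= /endo_mul comp_lfunZr. Qed.
HB.instance Definition _ := GRing.Lalgebra_isAlgebra.Build K E endo_scaleAr.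

Definition app (f : E) (x : V) : V := (f : 'End(V)) x.

Lemma appM (f g : E) x : app (f * g) x = app f (app g x).
Proof. exact: comp_lfunE. Qed.

Lemma appD (f g : E) x : app (f + g) x = app f x + app g x.
Proof. exact: add_lfunE. Qed.

Lemma appZ c (f : E) x : app (c *: f) x = c *: app f x.
Proof. exact: scale_lfunE. Qed.

Lemma app0 x : app 0 x = 0.
Proof. exact: zero_lfunE. Qed.

Lemma app1 x : app 1 x = x.
Proof. exact: id_lfunE. Qed.

Lemma endoP (f g : E) : (forall x i, app f x i = app g x i) -> f = g.
Proof. by move=> fg; apply/lfunP=> x; apply/ffunP=> i; apply: fg. Qed.

Section WeightedShift.
Variables (c : I -> K) (t : I -> I).

Definition wshift_fun (x : V) : V := [ffun i => c i * x (t i)].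
Fact wshift_linear : linear wshift_fun.
Proof. by move=> a x y; apply/ffunP=> i; rewrite !ffunE mulrDr mulrCA. Qed.
HB.instance Definition _ := GRing.isLinear.Build K V V *:%R wshift_fun wshift_linear.
Definition wshift : E := linfun wshift_fun.
Lemma wshiftE x i : app wshift x i = c i * x (t i).
Proof. by rewrite /app lfunE ffunE. Qed.
End WeightedShift.
End Endo.

(** * Fock space with cyclic and truncated bosons *)

Section Fock.
Variables (K : fieldType) (p n : nat) (mu : 'I_n -> K).
Hypotheses (p_char : p \in [pchar K]) (p_gt0 : (0 < p)%N).
Local Notation site := ('I_n * 'I_n)%type.
Local Notation local_state := (bool * 'I_p)%type.
Local Notation state := {ffun site -> local_state}.

Definition empty_state : state := [ffun=> (false, Ordinal p_gt0)].
Local Notation S := (endo K empty_state).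

Definition upd (s : state) (z : site) (q : local_state) : state :=
  [ffun w => if w == z then q else s w].

Lemma upd_same s z q : upd s z q z = q. Proof. by rewrite ffunE eqxx. Qed.
Lemma upd_other s z q w : w != z -> upd s z q w = s w.
Proof. by move=> /negbTE wz; rewrite ffunE wz. Qed.
Lemma upd_upd s z q q' : upd (upd s z q) z q' = upd s z q'.
Proof. by apply/ffunP=> w; rewrite !ffunE; case: eqP. Qed.
Lemma upd_id s z : upd s z (s z) = s.
Proof. by apply/ffunP=> w; rewrite !ffunE; case: eqP => [->|]. Qed.
Lemma upd_swap s z q w q' : z != w -> upd (upd s z q) w q' = upd (upd s w q') z q.
Proof.
move=> zw; apply/ffunP=> y; rewrite !ffunE; case: (eqVneq y w) => // ->.
by rewrite eq_sym (negbTE zw).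
Qed.

(* Jordan-Wigner sign: the parity of the fermions before [z]. *)
Definition jw (s : state) (z : site) : bool :=
  \big[addb/false]_(w | (enum_rank w < enum_rank z)%N) (s w).1.

Lemma jw_upd s z q w :
  jw (upd s z q) w = jw s w (+) ((enum_rank z < enum_rank w)%N && ((s z).1 (+) q.1)).
Proof.
rewrite /jw; case: (boolP (enum_rank z < enum_rank w)%N) => zw; last first.
  rewrite addbF; apply: eq_bigr => y yw; rewrite upd_other //.
  by apply: contraNneq zw => <-.
rewrite (bigD1 z) // [in RHS](bigD1 z) //= upd_same.
rewrite [in LHS](eq_bigr (fun y => (s y).1)); last first.
  by move=> y /andP[_ yz]; rewrite upd_other.
by case: (s z).1; case: q.1; case: (\big[_/_]_(_ | _) _).
Qed.

Definition site_op (z : site) (e : bool) (c : local_state -> K)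
    (t : local_state -> local_state) : S :=
  wshift empty_state (fun s => (-1) ^+ (e && jw s z) * c (s z)) (fun s => upd s z (t (s z))).

Lemma site_opE z e c t x s :
  app (site_op z e c t) x s = (-1) ^+ (e && jw s z) * c (s z) * x (upd s z (t (s z))).
Proof. exact: wshiftE. Qed.

Lemma site_op_same z e c t e' c' t' : site_op z e c t * site_op z e' c' t' =
  site_op z (e (+) e') (fun q => c q * c' (t q)) (fun q => t' (t q)).
Proof.
apply: endoP => x s; rewrite appM !site_opE jw_upd ltnn addbF upd_same upd_upd !mulrA.
congr (_ * _).
have -> : (-1) ^+ ((e (+) e') && jw s z) = (-1) ^+ (e && jw s z) * (-1) ^+ (e' && jw s z) :> K.
  by rewrite -signr_addb; case: e e' (jw s z) => -[] [].
by congr (_ * _); exact: mulrAC.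
Qed.

(** Exactly one of two distinct sites precedes the other, so exactly one of two odd operators has
    its Jordan-Wigner sign flipped by the other. *)
Lemma site_op_swap z w e c t e' c' t' : z != w ->
  (forall q, (t q).1 = q.1 (+) e) -> (forall q, (t' q).1 = q.1 (+) e') ->
  site_op z e c t * site_op w e' c' t' =
  (-1) ^+ (e && e') *: (site_op w e' c' t' * site_op z e c t).
Proof.
move=> zw te te'; have wz : w != z by rewrite eq_sym.
apply: endoP => x s; rewrite appZ ffunE !appM !site_opE !upd_other // !jw_upd te te'.
rewrite (upd_swap _ _ _ zw) !addbA !addbb !addFb -[_ *: _]/(_ * _) !mulrA; congr (_ * _).
have : (enum_rank z < enum_rank w)%N (+) (enum_rank w < enum_rank z)%N.
  have : enum_rank z != enum_rank w by apply: contraNneq zw => /enum_rank_inj ->.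
  by rewrite -val_eqE /= neq_ltn; case: ltngtP.
move: (_ < _)%N (_ < _)%N (jw s z) (jw s w) => b1 b2 j1 j2 b12.
rewrite -[LHS]mulrA [LHS]mulrACA -[RHS]mulrA [RHS]mulrACA [c' _ * _]mulrC -!signr_addb.
by congr ((-1) ^+ _ * _); case: e {te} e' {te'} b1 b2 b12 j1 j2 => -[] [] [] // _ [] [].
Qed.

Lemma site_op_eq z e c t c' t' : c =1 c' -> t =1 t' -> site_op z e c t = site_op z e c' t'.
Proof. by move=> cc tt; apply: endoP => x s; rewrite !site_opE cc tt. Qed.

Lemma site_opN z e c t : - site_op z e c t = site_op z e (fun q => - c q) t.
Proof.
apply: endoP => x s; rewrite -scaleN1r appZ ffunE !site_opE -[_ *: _]/(_ * _).
by rewrite mulN1r mulrN mulNr.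
Qed.

Lemma site_opD z c c' t : site_op z false c t + site_op z false c' t =
  site_op z false (fun q => c q + c' q) t.
Proof. by apply: endoP => x s; rewrite appD ffunE !site_opE -mulrDl mulrDr. Qed.

Lemma site_op1 z : site_op z false (fun=> 1) id = 1.
Proof. by apply: endoP => x s; rewrite site_opE app1 upd_id /= !mul1r. Qed.

Lemma site_op0 z e c t : (forall q, c q = 0) -> site_op z e c t = 0.
Proof. by move=> c0; apply: endoP => x s; rewrite site_opE app0 c0 mulr0 mul0r ffunE. Qed.

(* The shift by [mu] makes x d act on the vacuum by [mu i] at the diagonal site
   [(i, i)]; there the boson number is cyclic, so x is invertible. *)
Definition nu (z : site) (j : 'I_p) : K := (if z.1 == z.2 then mu z.1 else 0) + j%:R.

Lemma nuS z j : nu z (ordS j) = nu z j + 1.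
Proof.
rewrite /nu -addrA natr1; congr (_ + _) => /=.
have := ltn_ord j; rewrite leq_eqVlt => /orP[/eqP->|jp]; last by rewrite modn_small.
by rewrite modnn (pcharf0 p_char).
Qed.

(** Operators pull functions on states back, so creation reads the value at the state with one
    particle fewer. Off the diagonal it is cut at zero bosons; on the diagonal [ord_pred] wraps
    around. *)
Definition fock_u (a : bool) (z : site) : S :=
  if a then site_op z true (fun q => q.1%:R) (fun q => (~~ q.1, q.2))
  else site_op z false (fun q => ((z.1 == z.2) || (q.2 != 0 :> nat))%:R)
         (fun q => (q.1, ord_pred q.2)).

Definition fock_v (a : bool) (z : site) : S :=
  if a then site_op z true (fun q => (~~ q.1)%:R) (fun q => (~~ q.1, q.2))
  else site_op z false (fun q => nu z (ordS q.2)) (fun q => (q.1, ordS q.2)).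

(** The cut is invisible to the number operator: off the diagonal it removes only the state where nu
    is 0. *)
Lemma cut_nu z (j : 'I_p) : ((z.1 == z.2) || (j != 0 :> nat))%:R * nu z j = nu z j.
Proof.
rewrite /nu; case: eqP => [_|_] /=; first by rewrite mul1r.
by case: (nat_of_ord j) => [|k]; rewrite ?mul0r ?mul1r ?addr0.
Qed.

Lemma fock_uv z : fock_u false z * fock_v false z = site_op z false (fun q => nu z q.2) id.
Proof.
rewrite site_op_same; apply: site_op_eq => -[b j] /=; last by rewrite ord_predK.
by rewrite ord_predK cut_nu.
Qed.

Lemma fock_vu z : fock_v false z * fock_u false z = site_op z false (fun q => nu z q.2 + 1) id.
Proof.
rewrite site_op_same; apply: site_op_eq => -[b j] /=; last by rewrite ordSK.
by rewrite mulrC; apply: etrans (cut_nu z (ordS j)) (nuS z j).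
Qed.

Lemma fock_uv_odd z : fock_u true z * fock_v true z = site_op z false (fun q => q.1%:R) id.
Proof.
by rewrite site_op_same; apply: site_op_eq => -[[] j]; rewrite /= ?mulr1 ?mulr0.
Qed.

Lemma fock_vu_odd z : fock_v true z * fock_u true z = site_op z false (fun q => (~~ q.1)%:R) id.
Proof.
by rewrite site_op_same; apply: site_op_eq => -[[] j]; rewrite /= ?mulr1 ?mulr0.
Qed.

Lemma fock_u_pow i j k x (s : state) : i != j -> ((s (i, j)).2 < k)%N ->
  app (fock_u false (i, j) ^+ k) x s = 0.
Proof.
move=> ij; elim: k s => // k IH s sk; rewrite exprS appM site_opE.
have [s0|s0] := eqVneq (nat_of_ord (s (i, j)).2) 0%N.
  by rewrite /= (negbTE ij) mulr0 mul0r.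
rewrite IH ?mulr0 // upd_same /=; move: sk s0; case: (s (i, j)).2 => m mp /= sk m0.
case: m mp sk m0 => // m mp mk _.
by rewrite addSn /= modnDr modn_small // ltnW.
Qed.

Lemma fock_v_pow i j k x (s : state) : i != j -> (p <= (s (i, j)).2 + k)%N ->
  app (fock_v false (i, j) ^+ k) x s = 0.
Proof.
move=> ij; elim: k s => [|k IH] s; first by rewrite addn0 leqNgt ltn_ord.
move=> sk; rewrite exprS appM site_opE /= mul1r.
have := ltn_ord (s (i, j)).2; rewrite leq_eqVlt => /orP[/eqP sp|sp].
  by rewrite /nu /= (negbTE ij) add0r sp modnn mul0r.
by rewrite IH ?mulr0 // upd_same /= modn_small // addSnnS.
Qed.

Lemma fock_clifford_weyl : clifford_weyl p mu fock_u fock_v.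
Proof.
have p_pr : prime p by case/andP: p_char.
split.
- move=> a b z w; have [<-|zw] := eqVneq z w; last first.
    rewrite andbF addr0 andbC; case: a b => [] []; apply: site_op_swap => // q;
    by rewrite ?addbF ?addbT.
  rewrite andbT; case: a b => [] [].
  + rewrite /= expr1 scaleN1r fock_vu_odd fock_uv_odd site_opN -(site_op1 z) site_opD.
    by apply: site_op_eq => -[[] j] //=; rewrite ?oppr0 ?add0r ?addNr.
  + rewrite /= expr0 scale1r addr0 !site_op_same.
    by apply: site_op_eq => -[[] j] //=; rewrite ?mulr1 ?mulr0 ?mul1r ?mul0r.
  + rewrite /= expr0 scale1r addr0 !site_op_same.
    by apply: site_op_eq => -[[] j] //=; rewrite ?mulr1 ?mulr0 ?mul1r ?mul0r.
  by rewrite fock_uv fock_vu expr0 scale1r -(site_op1 z) site_opD.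
- move=> a b z w; have [<-|zw] := eqVneq z w; last first.
    by case: a b => [] []; apply: site_op_swap => // q; rewrite ?addbF ?addbT.
  case: a b => [] []; rewrite /= ?expr0 ?expr1 ?scale1r // !site_op_same.
  + rewrite !site_op0 ?scaler0 // => -[[] j] /=; by rewrite ?mulr0 ?mul0r.
  + by apply: site_op_eq => -[[] j] //=; rewrite ?mulr1 ?mulr0 ?mul1r ?mul0r.
  by apply: site_op_eq => -[[] j] //=; rewrite ?mulr1 ?mulr0 ?mul1r ?mul0r.
- move=> a b z w; have [<-|zw] := eqVneq z w; last first.
    by case: a b => [] []; apply: site_op_swap => // q; rewrite ?addbF ?addbT.
  case: a b => [] []; rewrite /= ?expr0 ?expr1 ?scale1r // !site_op_same.
  + rewrite !site_op0 ?scaler0 // => -[[] j] /=; by rewrite ?mulr0 ?mul0r.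
  + by apply: site_op_eq => -[[] j] //=; rewrite ?mulr1 ?mulr0 ?mul1r ?mul0r.
  by apply: site_op_eq => -[[] j] //=; rewrite ?mulr1 ?mulr0 ?mul1r ?mul0r.
- by move=> z; rewrite site_op_same site_op0 // => -[[] j] /=; rewrite ?mulr0 ?mul0r.
- by move=> z; rewrite site_op_same site_op0 // => -[[] j] /=; rewrite ?mulr0 ?mul0r.
- by move=> i j ij; apply: endoP => x s; rewrite fock_u_pow // app0 ffunE.
- by move=> i j ij; apply: endoP => x s; rewrite fock_v_pow ?leq_addl // app0 ffunE.
move=> i j; rewrite fock_uv.
have E k : (0 < k)%N -> site_op (i, j) false (fun q => nu (i, j) q.2) id ^+ k =
    site_op (i, j) false (fun q => nu (i, j) q.2 ^+ k) id.
  case: k => // k _; elim: k => [|k IH]; first by rewrite expr1; apply: site_op_eq => q; rewrite ?expr1.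
  by rewrite exprS IH site_op_same; apply: site_op_eq => q //=; rewrite -exprS.
rewrite E // -(site_op1 (i, j)).
have -> (a : K) : a *: site_op (i, j) false (fun=> 1) id = site_op (i, j) false (fun=> a) id.
  apply: endoP => x s; rewrite appZ ffunE !site_opE -[_ *: _]/(_ * _).
  by rewrite !mul1r.
rewrite site_opD; apply: site_op_eq => -[b m] //=.
(* The occupation number lies in the prime field and is fixed by Frobenius, so only mu contributes
   to nu^p - nu. *)
rewrite /nu /= -(pFrobenius_autE p_char) rmorphD /= rmorph_nat pFrobenius_autE.
case: eqP => _; last by rewrite expr0n gtn_eqF // addr0.
by rewrite addrAC addrCA subrr addr0.
Qed.

Lemma fock_u_inj i y : fock_u false (i, i) * y = 0 -> y = 0.
Proof.
move=> uy; apply: endoP => x s; rewrite app0 ffunE.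
pose s' := upd s (i, i) ((s (i, i)).1, ordS (s (i, i)).2).
have : app (fock_u false (i, i) * y) x s' = 0 by rewrite uy app0 ffunE.
rewrite appM site_opE /= eqxx upd_same /= ordSK upd_upd !mul1r.
by rewrite -surjective_pairing upd_id.
Qed.

Section Vacuum.
Variable top : site -> bool.
Hypothesis top_diag : forall i, ~~ top (i, i).
Hypothesis p_gt1 : (1 < p)%N.

Lemma p_pred_lt : (p.-1 < p)%N. Proof. by rewrite prednK. Qed.

Definition vacuum_state : state :=
  [ffun z => if top z then (true, Ordinal p_pred_lt) else (false, Ordinal p_gt0)].

(** The module is S acting on itself by left multiplication, so the vacuum is an operator: the
    projection onto the delta function at [vacuum_state]. *)
Definition fock_vacuum : S := wshift empty_state (fun s => (s == vacuum_state)%:R) (fun=> vacuum_state).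

Lemma fock_vacuum_neq0 : fock_vacuum != 0.
Proof.
apply/eqP => E; have : app fock_vacuum [ffun=> 1] vacuum_state = 0 by rewrite E app0 ffunE.
by rewrite wshiftE ffunE eqxx mulr1 => /eqP; rewrite oner_eq0.
Qed.

Lemma fock_vacuumP : vacuum fock_u fock_v top fock_vacuum.
Proof.
move=> i j ij a; apply: endoP => x s; rewrite appM app0 ffunE.
have H e c t : (forall q, t q = vacuum_state (i, j) -> c q = 0) ->
    app (site_op (i, j) e c t) (app fock_vacuum x) s = 0.
  move=> ct; rewrite site_opE wshiftE; case: eqP => [E|]; last by rewrite mul0r mulr0.
  by rewrite ct ?mulr0 ?mul0r // -E upd_same.
rewrite /gen; case T: (top (i, j)); case: a; apply: H => -[b m]; rewrite ffunE T => -[].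
- by case: b.
- move=> _ /= Em; rewrite (negbTE ij) /=.
  case: m Em => -[|m] mp //=; rewrite modnDr modn_small ?(ltnW mp) // => Em.
  by move: mp; rewrite Em prednK // ltnn.
- by case: b.
move=> _ /= Em.
by rewrite /nu /= (negbTE ij) Em add0r.
Qed.

Lemma fock_vacuum_weight a :
  fock_u false (a, a) * fock_v false (a, a) * fock_vacuum
  + fock_u true (a, a) * fock_v true (a, a) * fock_vacuum = mu a *: fock_vacuum.
Proof.
rewrite fock_uv fock_uv_odd -mulrDl site_opD; apply: endoP => x s.
rewrite appM appZ ffunE site_opE upd_id /= mul1r -[RHS]/(_ * _) !wshiftE.
case: eqP => [->|_]; last by rewrite !mul0r !mulr0.
rewrite ffunE (negbTE (top_diag a)) /nu /= eqxx !addr0 //.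
Qed.
End Vacuum.
End Fock.

(** * Baby Verma modules *)

Lemma falg_ind (K : fieldType) (I : choiceType) (P : falg K I -> Prop) :
  (forall x y, P x -> P y -> P (x + y)) -> (forall c, P c%:A) ->
  (forall i x, P x -> P (fgen K i * x)) -> forall x, P x.
Proof.
move=> PD PC PG x; have P0 : P 0 by have := PC 0; rewrite scale0r.
rewrite [x](monalgE (x : {malg K[{fmonom I}]})).
apply: big_ind => // -[s] _; move: (_@_ _) => c.
have -> : FMonom s = fmonom_of_seq fmonom_key s :> {fmonom I} by rewrite fmE.
elim: s => [|i s IH].
  have E : c *: (1 : {malg K[{fmonom I}]}) = << c *g fmonom_of_seq fmonom_key [::] >>.
    by apply/malgP => k; rewrite mcoeffZ mcoeff1 mcoeffU mulr_natr eq_sym.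
  by have := PC c; rewrite /GRing.one /= falg_one.unlock -E.
have := PG i _ IH; congr P; rewrite /GRing.mul /= falg_mul.unlock.
rewrite [LHS]fgmulUU mul1r; congr << _ *g _ >>.
by rewrite /mmul /= /fmmul /fmu !fmE.
Qed.

Section UchiTheory.
Variables (K : fieldType) (n p : nat) (chi : {scalar 'M[K]_n}).
Local Notation gl := 'M[K]_(n + n).
Variable a : {vspace gl}.
Local Notation U := (Uchi p chi a).
Local Notation pi := (@Uproj K n p chi a).
Local Notation gen := (@Ugen K n p chi a).
Local Notation scal := (@Uscal K n p chi a).

Lemma Uproj_surj (u : U) : exists t, u = pi t.
Proof.
have [v ->] := rpi_surj u; have [t ->] := rpi_surj v.
by exists t.
Qed.

Definition Uscalar : {rmorphism K -> U} := pi \o in_alg (falg K (subvs_of a)).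

Lemma UprojZ c t : pi (c *: t) = scal c * pi t.
Proof. by rewrite /Uscal -rmorphM /= mulr_algl. Qed.

Lemma Uchi_ind (P : U -> Prop) : (forall u v, P u -> P v -> P (u + v)) ->
  (forall c, P (scal c)) -> (forall x u, P u -> P (gen x * u)) -> forall u, P u.
Proof.
move=> PD PC PG u; have [t ->] := Uproj_surj u.
elim/falg_ind: t => [x y Px Py|c|x t Pt].
- by rewrite rmorphD; apply: PD.
- exact: PC.
by rewrite rmorphM; apply: PG.
Qed.

Lemma Uproj_super t : super_rel t -> pi t = 0.
Proof.
move=> st; rewrite -[pi t]/(rpi _ (rpi _ t)).
by rewrite (rpi_rel st) rmorph0.
Qed.

Lemma Uscal0 : scal 0 = 0.
Proof. exact: (rmorph0 Uscalar). Qed.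

Lemma Uscal1 : scal 1 = 1.
Proof. exact: (rmorph1 Uscalar). Qed.

Lemma UscalM c d : scal (c * d) = scal c * scal d.
Proof. exact: (rmorphM Uscalar). Qed.

Lemma UgenD x y : gen (x + y) = gen x + gen y.
Proof.
have := Uproj_super (SuperRelD x y); rewrite (rmorphB pi) (rmorphB pi).
by rewrite -/(gen _) -/(gen x) -/(gen y) -addrA -opprD => /subr0_eq.
Qed.

Lemma UgenZ c x : gen (c *: x) = scal c * gen x.
Proof.
have := Uproj_super (SuperRelZ c x); rewrite (rmorphB pi).
by rewrite UprojZ => /subr0_eq.
Qed.

Lemma Ugen_bracket d e x y z : homog d (vsval x) -> homog e (vsval y) ->
  vsval z = sbracket d e (vsval x) (vsval y) ->
  gen x * gen y = scal ((-1) ^+ (d && e)) * (gen y * gen x) + gen z.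
Proof.
move=> hx hy hz; have := Uproj_super (SuperRelB hx hy hz).
rewrite (rmorphB pi) (rmorphB pi) UprojZ !(rmorphM pi) -/(gen x) -/(gen y) -/(gen z).
by rewrite -addrA -opprD => /subr0_eq.
Qed.

Lemma Ugen_pow x z : homog false (vsval x) -> vsval z = vsval x ^+ p ->
  gen x ^+ p = gen z + scal (chi (ulsubmx (vsval x)) ^+ p).
Proof.
move=> hx hz; pose q : {rmorphism Uenv a -> U} := rpi (@restricted_rel K n p chi a).
have : q _ = 0 := rpi_rel (RestrictedRel chi hx hz).
rewrite (rmorphB q) (rmorphB q) (rmorphXn q) -addrA -opprD => /subr0_eq; exact.
Qed.

Lemma Uscal_comm c u : u * scal c = scal c * u.
Proof.
elim/Uchi_ind: u => [u v Hu Hv|d|x u Hu].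
- by rewrite mulrDl mulrDr Hu Hv.
- exact: etrans (esym (UscalM d c)) (etrans (congr1 scal (mulrC d c)) (UscalM c d)).
rewrite -mulrA Hu !mulrA; congr (_ * _).
by rewrite -UprojZ /Uscal -(rmorphM pi) mulr_algr.
Qed.
End UchiTheory.

Section QueerLetters.
Variables (K : fieldType) (n : nat).
Local Notation gl := 'M[K]_(n + n).

Definition qletter (l : letter n) : gl :=
  if l.1 then qodd K l.2.1 l.2.2 else qeven K l.2.1 l.2.2.

Lemma qletter_queer l : qletter l \in queer K n.
Proof. by case: l => -[] [i j]; apply/qspanP; [exact: qsupp_odd|exact: qsupp_even]. Qed.

Lemma homog_qletter l : homog l.1 (qletter l).
Proof. by case: l => -[] [i j]; rewrite /homog /qletter /= !qeltE. Qed.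

Lemma qletterM d e i j k l : qletter (d, (i, j)) *m qletter (e, (k, l)) =
  (j == k)%:R *: qletter (d (+) e, (i, l)).
Proof.
rewrite /qletter /= /qodd /qeven; case: d e => -[] /=; rewrite qelt_mul !mul_delta_mx_cond;
  rewrite ?(mulmx0, mul0mx, addr0, add0r) eq_sym;
  by case: eqP => _; rewrite ?scale1r ?scale0r ?mulr1n ?mulr0n ?qelt0.
Qed.

Definition lie_letter (l : letter n) : subvs_of (queer K n) := vsproj (queer K n) (qletter l).

Lemma lie_letterE l : vsval (lie_letter l) = qletter l.
Proof. by rewrite vsprojK // qletter_queer. Qed.
End QueerLetters.

Lemma scale_bracket (R : pzRingType) (M : lmodType R) (g h s a k b l : R) (m : M) :
  g * h = s * (h * g) + (a * k + b * l) ->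
  g *: (h *: m) = s *: (h *: (g *: m)) + (a *: (k *: m) + b *: (l *: m)).
Proof. by move=> E; rewrite !scalerA E !scalerDl !mulrA. Qed.

Section ModuleAction.
Variables (K : fieldType) (n p : nat) (chi : {scalar 'M[K]_n}).
Local Notation gl := 'M[K]_(n + n).
Local Notation U := (Uchi p chi (queer K n)).
Variable M : lmodType U.

(** The same module over K alone, the setting of [queer_action]. *)
Definition kmod : lmodType K := restr (Uscalar p chi (queer K n)) M.

Definition letter_op (l : letter n) (m : kmod) : kmod :=
  Ugen p chi (lie_letter K l) *: (m : M).

Fact letter_op_linear l : linear (letter_op l).
Proof.
move=> c x y; pose g := Ugen p chi (lie_letter K l).
pose k := @Uscal K n p chi (queer K n) c.
change (g *: (k *: (x : M) + y) = k *: (g *: (x : M)) + g *: (y : M)).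
by rewrite scalerDr !scalerA Uscal_comm.
Qed.
HB.instance Definition _ l :=
  GRing.isLinear.Build K kmod kmod *:%R (letter_op l) (letter_op_linear l).
Local Notation scal := (@Uscal K n p chi (queer K n)).
Local Notation gen := (@Ugen K n p chi (queer K n)).
Local Notation X := (fun l => letter_op l : {linear kmod -> kmod}).

Lemma kmodE c (m : kmod) : c *: m = (scal c *: (m : M) : M). Proof. by []. Qed.

Lemma lie_letter_bracket d e (i j k l : 'I_n) :
  vsval ((j == k)%:R *: lie_letter K (d (+) e, (i, l))
         - ((-1) ^+ (d && e) * (l == i)%:R) *: lie_letter K (d (+) e, (k, j))) =
  sbracket d e (vsval (lie_letter K (d, (i, j)))) (vsval (lie_letter K (e, (k, l)))).
Proof.
rewrite linearB !linearZ /= !lie_letterE /sbracket !qletterM [e (+) d]addbC.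
by rewrite scalerN scalerA.
Qed.

Lemma letter_op_bracket d e i j k l (v : kmod) :
  X (d, (i, j)) (X (e, (k, l)) v) =
      (-1) ^+ (d && e) *: X (e, (k, l)) (X (d, (i, j)) v)
      + ((j == k)%:R *: X (d (+) e, (i, l)) v
         - ((-1) ^+ (d && e) * (l == i)%:R) *: X (d (+) e, (k, j)) v).
Proof.
have hl f (i' j' : 'I_n) : homog f (vsval (lie_letter K (f, (i', j')))).
  by rewrite lie_letterE; apply: homog_qletter.
have E := Ugen_bracket p chi (hl d i j) (hl e k l) (lie_letter_bracket d e i j k l).
rewrite -scaleNr UgenD UgenZ UgenZ in E; rewrite -scaleNr.
exact: (scale_bracket (M := M) v E).
Qed.

Lemma Uchi_pow (g : U) k (v : M) : g ^+ k *: v = iter k (fun x => g *: x) v.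
Proof. by elim: k => [|k IH]; rewrite ?scale1r // exprS -scalerA IH. Qed.

Hypothesis chi_off : forall i j : 'I_n, i != j -> chi (delta_mx i j) = 0.

(** Off the diagonal a matrix unit squares to zero and chi vanishes on it, so the restricted
    relation becomes e_ij^p = 0. *)
Lemma letter_op_queer_action : (1 < p)%N -> queer_action p X.
Proof.
move=> p_gt1; split=> [|i j v ij]; first exact: letter_op_bracket.
set x := lie_letter K (false, (i, j)).
have hx : homog false (vsval x) by rewrite lie_letterE; exact: (homog_qletter K (false, (i, j))).
have x2 : vsval x ^+ 2 = 0.
  rewrite lie_letterE expr2; apply: etrans (qletterM K false false i j i j) _.
  by rewrite eq_sym (negbTE ij) scale0r.
have gen0 : gen 0 = 0 by rewrite -[0 : subvs_of _](scale0r 0) UgenZ Uscal0 mul0r.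
have xp : vsval x ^+ p = 0 by rewrite -(subnK p_gt1) exprD x2 mulr0.
have E : gen x ^+ p = 0.
  have hz : vsval (0 : subvs_of (queer K n)) = vsval x ^+ p by rewrite xp linear0.
  have := Ugen_pow chi hx hz; rewrite gen0 add0r => ->.
  by rewrite lie_letterE /= qelt_ul chi_off // expr0n eqn0Ngt (ltnW p_gt1) Uscal0.
have := Uchi_pow (gen x) p v; rewrite E scale0r; exact: esym.
Qed.
End ModuleAction.

(** * Universal property of extension of scalars *)

Section TensorLift.
Variables (S R : pzRingType) (phi : {rmorphism S -> R}) (M : lmodType S) (N : lmodType R).
Variable g : M -> N.
Hypothesis gD : forall x y, g (x + y) = g x + g y.
Hypothesis gZ : forall a x, g (a *: x) = phi a *: g x.
Local Notation T := (ext_scalars phi M).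

Local Notation tensor_lift_fun := (fab_lift (fun z : (R * M)%type => z.1 *: g z.2)).

Let liftB (x y : {malg int[(R * M)%type]}) :
  tensor_lift_fun (x - y) = tensor_lift_fun x - tensor_lift_fun y.
Proof. exact: fab_lift_additive. Qed.

Let lift0 : tensor_lift_fun 0 = 0.
Proof. exact: (raddf0 tensor_lift_fun). Qed.

Definition tensor_lift (u : T) : N := tensor_lift_fun (repr u).

Lemma tensor_lift_null x : tensor_gen phi x -> tensor_lift_fun x = 0.
Proof.
elim=> [|y z _ Hy _ Hz|_ [r r' m|r m m'|r a m]]; first exact: lift0.
- by rewrite liftB Hy Hz subr0.
- by rewrite !liftB !fab_liftU /= scalerDl addrAC addrK subrr.
- by rewrite !liftB !fab_liftU /= gD scalerDr addrAC addrK subrr.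
by rewrite liftB !fab_liftU /= gZ scalerA subrr.
Qed.

Lemma tensor_lift_pi x : tensor_lift (tpi phi x) = tensor_lift_fun x.
Proof.
apply/eqP; rewrite -subr_eq0 -liftB; apply/eqP/tensor_lift_null.
by apply/tensor_nullP/tpiP; rewrite tpi_repr.
Qed.

Lemma tensor_liftE r m : tensor_lift (tensor phi r m) = r *: g m.
Proof. by rewrite tensor_lift_pi fab_liftU. Qed.

Lemma tensor_liftB x y : tensor_lift (x - y) = tensor_lift x - tensor_lift y.
Proof.
have [x' ->] := tpi_surj x; have [y' ->] := tpi_surj y.
by rewrite -raddfB !tensor_lift_pi liftB.
Qed.

Lemma tensor_lift0 : tensor_lift 0 = 0.
Proof. by rewrite -(subrr 0) tensor_liftB subrr. Qed.

Lemma tensor_liftD x y : tensor_lift (x + y) = tensor_lift x + tensor_lift y.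
Proof. by apply: (addIr (- tensor_lift y)); rewrite addrK -tensor_liftB addrK. Qed.

Lemma tensor_liftZ r x : tensor_lift (r *: x) = r *: tensor_lift x.
Proof.
elim/ext_scalars_ind: x => [|x y IHx IHy|r' m].
- by rewrite scaler0 tensor_lift0 scaler0.
- by rewrite scalerBr !tensor_liftB scalerBr IHx IHy.
by rewrite -[r *: _]/(ext_scale _ _) ext_scaleU !tensor_liftE scalerA.
Qed.
End TensorLift.

Section IsotropicVector.
Variables (K : closedFieldType) (p n : nat) (V : lmodType K).
Variable X : letter n -> {linear V -> V}.
Hypotheses (p_char : p \in [pchar K]) (p_gt2 : (2 < p)%N).
Hypothesis qX : queer_action p X.
Variables (lam : 'I_n -> K) (P : V -> Prop).
Hypothesis P_wt : forall y, P y -> has_weight X lam y.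
Hypothesis P_odd : forall c y, P y -> P (odd_op X c y).

(** If c y is nonzero, it replaces y: c kills it because form c c = 0, and the elements treated
    before still do because they anticommute with c. This prepares the image of the generator of
    V(lam), which the isotropic subspace must kill. *)
Lemma isotropic_vector v (cs : seq 'rV[K]_n) :
  (forall c d, c \in cs -> d \in cs -> odd_form lam c d = 0) -> P v -> v != 0 ->
  exists y, [/\ P y, y != 0 & forall c, c \in cs -> odd_op X c y = 0].
Proof.
move=> + Pv v0; elim: cs => [|c cs IH] iso; first by exists v.
have [|y [Py y0 ky]] := IH; first by move=> d e dc ec; apply: iso; rewrite inE ?dc ?ec orbT.
have [cy|cy] := eqVneq (odd_op X c y) 0.
  by exists y; split=> // d; rewrite inE => /orP[/eqP-> //|]; exact: ky.
exists (odd_op X c y); split=> //; first exact: P_odd.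
move=> d; rewrite inE => /orP[/eqP->|dcs].
  by rewrite (odd_op_sq p_char p_gt2 qX c (P_wt Py)) iso ?mem_head // mul0r scale0r.
have := odd_op_anticomm p_char p_gt2 qX d c (P_wt Py).
by rewrite (ky d) // linear0 addr0 iso ?mem_head ?inE ?dcs ?orbT // scale0r.
Qed.
End IsotropicVector.

Section QueerParts.
Variables (K : fieldType) (n : nat).
Local Notation gl := 'M[K]_(n + n).

Definition qpart (d : bool) (A : 'M[K]_n) : gl := if d then qelt 0 A else qelt A 0.

Lemma queer_homog d (x : gl) : x \in queer K n -> homog d x -> exists A, x = qpart d A.
Proof.
move=> /mem_qspan/qsuppE E; rewrite E /qpart; case: d => -[]; rewrite !qeltE => -> _.
  by exists (ursubmx x).
by exists (ulsubmx x).
Qed.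

Lemma sbracket_qpart d e (A B : 'M[K]_n) : sbracket d e (qpart d A) (qpart e B) =
  qpart (d (+) e) (A *m B - (-1) ^+ (d && e) *: (B *m A)).
Proof.
have H c (A1 B1 A2 B2 : 'M[K]_n) :
    qelt A1 B1 - c *: qelt A2 B2 = qelt (A1 - c *: A2) (B1 - c *: B2) :> gl.
  by rewrite /qelt scale_block_mx opp_block_mx add_block_mx.
rewrite /sbracket /qpart; case: d e => -[] /=; rewrite !qelt_mul H;
  by rewrite !(mul0mx, mulmx0, addr0, add0r, scaler0, subr0, oppr0).
Qed.
End QueerParts.

(** * U_chi(q(n)) acting on the oscillators *)

Section FockRepresentation.
Variables (K : fieldType) (p n : nat) (mu : 'I_n -> K) (S : algType K).
Variables u v : bool -> 'I_n * 'I_n -> S.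
Hypotheses (p_char : p \in [pchar K]) (p_gt2 : (2 < p)%N).
Hypothesis cw : clifford_weyl p mu u v.
Local Notation cw_letter := (cw_letter u v).
Local Notation gl := 'M[K]_(n + n).

Definition cw_op (l : letter n) (y : S) : S := cw_letter l * y.

Fact cw_op_linear l : linear (cw_op l).
Proof. by move=> c x y; rewrite /cw_op mulrDr scalerAr. Qed.
HB.instance Definition _ l := GRing.isLinear.Build K S S *:%R (cw_op l) (cw_op_linear l).

Lemma cw_queer_action : queer_action p (fun l => cw_op l : {linear S -> S}).
Proof.
split=> [d e i j k l y|i j y ij]; rewrite /= /cw_op.
  by rewrite !mulrA (cw_bracket cw) !mulrDl mulNr -!scalerAl.
have E k : iter k (cw_op (false, (i, j))) y = cw_letter (false, (i, j)) ^+ k * y.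
  by elim: k => [|k IH]; rewrite ?mul1r // iterS IH /cw_op exprS mulrA.
by apply: etrans (E p) _; rewrite (cw_letter_pow p_char p_gt2 cw) (negbTE ij) mul0r.
Qed.

Variable chi : {scalar 'M[K]_n}.
Hypothesis chi_delta : forall i j : 'I_n,
  chi (delta_mx i j) ^+ p = if i == j then mu i ^+ p - mu i else 0.
Local Notation L := (subvs_of (queer K n)).

Definition cw_elt (x : gl) : S := cw_mx u v false (ulsubmx x) + cw_mx u v true (ursubmx x).

Fact cw_elt_linear : linear cw_elt.
Proof.
move=> c x y; rewrite /cw_elt [ulsubmx _]linearP [ursubmx _]linearP !linearP /=.
by rewrite scalerDr addrACA.
Qed.
HB.instance Definition _ := GRing.isLinear.Build K gl S *:%R cw_elt cw_elt_linear.

Lemma cw_elt_qpart d A : cw_elt (qpart d A) = cw_mx u v d A.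
Proof. by rewrite /cw_elt /qpart; case: d; rewrite !qeltE linear0 ?addr0 ?add0r. Qed.

Let f : {rmorphism falg K L -> S} := falg_lift (fun x : L => cw_elt (vsval x)).
Let fgenE x : f (fgen K x) = cw_elt (vsval x).
Proof. exact: falg_lift_gen. Qed.
Let fZ c t : f (c *: t) = c *: f t.
Proof. exact: linearZ. Qed.

Let fgenD (x y : L) : f (fgen K (x + y)) = f (fgen K x) + f (fgen K y).
Proof.
by rewrite !fgenE; exact: etrans (congr1 cw_elt (linearD vsval x y)) (linearD cw_elt _ _).
Qed.
Let fgenZ c (x : L) : f (fgen K (c *: x)) = c *: f (fgen K x).
Proof.
by rewrite !fgenE; exact: etrans (congr1 cw_elt (linearZ_LR vsval c x)) (linearZ_LR cw_elt c _).
Qed.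

Fact rho_super t : super_rel t -> f t = 0.
Proof.
case=> [x y|c x|d e x y z hx hy hz].
- by rewrite (rmorphB f) (rmorphB f) fgenD addrAC addrK subrr.
- by rewrite (rmorphB f) fZ fgenZ subrr.
rewrite (rmorphB f) (rmorphB f) fZ (rmorphM f) (rmorphM f) !fgenE hz.
have [A Ex] := queer_homog (subvsP x) hx; have [B Ey] := queer_homog (subvsP y) hy.
rewrite Ex Ey !cw_elt_qpart sbracket_qpart cw_elt_qpart.
rewrite (cw_mx_bracket cw).
by rewrite addrAC addrK subrr.
Qed.

Fact rho_restricted x z : homog false (vsval x) -> vsval z = vsval x ^+ p ->
  f (fgen K x) ^+ p - f (fgen K z) - f (chi (ulsubmx (vsval x)) ^+ p)%:A = 0.
Proof.
move=> hx hz; rewrite fZ (rmorph1 f) !fgenE hz.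
have [A ->] := queer_homog (subvsP x) hx.
rewrite qelt_exp !(cw_elt_qpart false) qelt_ul.
exact: (cw_mx_pow p_char p_gt2 cw chi_delta).
Qed.

Definition fock_rho : {rmorphism Uchi p chi (queer K n) -> S} :=
  Uchi_lift rho_super rho_restricted.

Lemma fock_rho_gen x : fock_rho (Ugen p chi x) = cw_elt (vsval x).
Proof. exact: etrans (Uchi_liftE rho_super rho_restricted (fgen K x)) (fgenE x). Qed.

Lemma fock_rho_scal c : fock_rho (Uscal p chi (queer K n) c) = c%:A.
Proof. by apply: etrans (Uchi_liftE rho_super rho_restricted _) _; rewrite fZ (rmorph1 f). Qed.

Lemma fock_rho_letter l : fock_rho (Ugen p chi (lie_letter K l)) = cw_letter l.
Proof.
rewrite fock_rho_gen lie_letterE /cw_elt; case: l => -[] [i j] /=;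
  by rewrite !qeltE linear0 ?addr0 ?add0r cw_mx_delta.
Qed.
End FockRepresentation.

(** * The odd Cartan part in coordinates *)

Section OddCartan.
Variables (K : fieldType) (n : nat).
Local Notation gl := 'M[K]_(n + n).

Definition odd_elt (c : 'rV[K]_n) : gl := qelt 0 (diag_mx c).
Definition odd_coord (x : gl) : 'rV[K]_n := \row_i ursubmx x i i.

Lemma odd_eltP c a d : odd_elt (a *: c + d) = a *: odd_elt c + odd_elt d.
Proof.
by rewrite /odd_elt linearP /qelt scale_block_mx add_block_mx scaler0 addr0.
Qed.
Fact odd_elt_linear : linear odd_elt.
Proof. by move=> a c d; exact: odd_eltP. Qed.
HB.instance Definition _ := GRing.isLinear.Build K 'rV[K]_n gl *:%R odd_elt odd_elt_linear.

Fact odd_coord_linear : linear odd_coord.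
Proof. by move=> a c d; apply/rowP=> i; rewrite !mxE. Qed.
HB.instance Definition _ :=
  GRing.isLinear.Build K gl 'rV[K]_n *:%R odd_coord odd_coord_linear.

Lemma odd_eltK c : odd_coord (odd_elt c) = c.
Proof. by apply/rowP=> i; rewrite mxE qelt_ur mxE eqxx. Qed.

Lemma odd_coordK x : x \in cartan1 K n -> odd_elt (odd_coord x) = x.
Proof.
move=> xh; have := subvP (cartan1_sub K n) x xh => /mem_qspan Sx.
rewrite {2}(qsuppE Sx) (cartan1_ul xh); congr qelt; apply/matrixP=> i j.
rewrite 2!mxE; have [<-|ij] := eqVneq i j; first by rewrite mulr1n.
by have [_ ->] := qsupp_uniq Sx ij.
Qed.

Lemma odd_elt_cartan1 c : odd_elt c \in cartan1 K n.
Proof.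
have -> : odd_elt c = \sum_i c 0 i *: qodd K i i.
  rewrite {1}[c](row_sum_delta c) linear_sum; apply: eq_bigr => i _.
  rewrite linearZ /= /odd_elt /qodd; congr (_ *: qelt _ _).
  apply/matrixP=> k l; rewrite !mxE eqxx /=.
  have [->|kl] := eqVneq k l; first by rewrite andbb mulr1n.
  by rewrite mulr0n; case: (eqVneq k i) kl => //= ->; rewrite eq_sym => /negbTE->.
by apply: memv_suml => i _; apply: memvZ; apply: (subvP (sumv_sup i isT (subvv _))); apply: memv_line.
Qed.

Lemma cartan_form_odd (lam : 'rV[K]_n) c d :
  cartan_form lam (odd_elt c) (odd_elt d) = odd_form (lam 0) c d.
Proof.
rewrite /cartan_form /sbracket /odd_elt /= expr1 scaleN1r opprK !qelt_mul linearD /= !qeltE.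
rewrite mul0mx !add0r !mulmx_diag /wt /odd_form mulr_sumr; apply: eq_bigr => i _.
by rewrite !mxE eqxx !mulr1n; ring.
Qed.

Definition odd_mx (W : {vspace gl}) : 'M[K]_(\dim W, n) :=
  \matrix_(k < \dim W) odd_coord (vbasis W)`_k.

Lemma odd_mxP (W : {vspace gl}) c : (W <= cartan1 K n)%VS ->
  (c <= odd_mx W)%MS = (odd_elt c \in W).
Proof.
move=> W1; apply/idP/idP => [/submxP[D ->]|cW].
  rewrite mulmx_sum_row linear_sum; apply: memv_suml => k _; rewrite linearZ; apply: memvZ.
  rewrite rowK; have bW : (vbasis W)`_k \in W by apply/vbasis_mem/mem_nth; rewrite size_tuple.
  by rewrite /= odd_coordK ?(subvP W1).
rewrite -(odd_eltK c) (coord_vbasis cW) linear_sum; apply: summx_sub => k _.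
rewrite linearZ; apply: scalemx_sub => /=.
have -> : odd_coord (vbasis W)`_k = row k (odd_mx W) by rewrite rowK.
exact: row_sub.
Qed.

Lemma odd_mx_iso (lam : 'rV[K]_n) (W : {vspace gl}) c d :
  (W <= cartan1 K n)%VS -> isotropic lam W ->
  (c <= odd_mx W)%MS -> (d <= odd_mx W)%MS -> odd_form (lam 0) c d = 0.
Proof.
by move=> W1 iso; rewrite !odd_mxP // => cW dW; rewrite -cartan_form_odd; apply: iso.
Qed.

(** Under these hypotheses W plus the line of u is still isotropic, and maximality absorbs u. *)
Lemma odd_mx_max (lam : 'rV[K]_n) (W : {vspace gl}) u : max_isotropic lam W ->
  (forall c, (c <= odd_mx W)%MS -> odd_form (lam 0) c u = 0) ->
  odd_form (lam 0) u u = 0 -> (u <= odd_mx W)%MS.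
Proof.
move=> [W1 iso max] Wu uu; rewrite odd_mxP //.
have uh := odd_elt_cartan1 u.
have W'1 : (W + <[odd_elt u]> <= cartan1 K n)%VS by rewrite subv_add W1 -memvE.
rewrite -(max (W + <[odd_elt u]>)%VS) //.
- by apply: (subvP (addvSr _ _)); apply: memv_line.
- move=> a b aW' bW'; rewrite -(odd_coordK (subvP W'1 _ aW')) -(odd_coordK (subvP W'1 _ bW')).
  rewrite cartan_form_odd.
  have H x : x \in (W + <[odd_elt u]>)%VS -> exists c t, (c <= odd_mx W)%MS /\ odd_coord x = t *: u + c.
    move=> /memv_addP[y yW [_ /vlineP[t ->] ->]].
    exists (odd_coord y), t; split; first by rewrite odd_mxP // odd_coordK // (subvP W1).
    by rewrite addrC linearP /= odd_eltK.
  have [c [t [cW ->]]] := H _ aW'; have [d [t' [dW ->]]] := H _ bW'.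
  rewrite odd_formDr odd_formC odd_formDr uu mulr0 add0r odd_formC Wu //.
  rewrite mulr0 add0r odd_formC odd_formDr Wu // mulr0 add0r.
  exact: odd_mx_iso dW cW.
exact: addvSl.
Qed.
End OddCartan.

Section MapLemmas.
Variables (K : fieldType) (n p : nat) (chi : {scalar 'M[K]_n}).
Local Notation gl := 'M[K]_(n + n).
Variables a c : {vspace gl}.

Lemma Uchi_map_scal f (f_hom : restricted_hom p chi f) k :
  Uchi_map f_hom (Uscal p chi a k) = Uscal p chi c k.
Proof.
apply: etrans (Uchi_liftE (Uchi_map_super f_hom) (Uchi_map_restricted f_hom) k%:A) _ => /=.
by rewrite (linearZ_LR (falg_lift _)) rmorph1.
Qed.

Lemma Uincl_scal (ac : (a <= c)%VS) k : Uincl p chi ac (Uscal p chi a k) = Uscal p chi c k.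
Proof. exact: Uchi_map_scal. Qed.

Lemma Uincl_gen (ac : (a <= c)%VS) x :
  Uincl p chi ac (Ugen p chi x) = Ugen p chi (vsproj c (vsval x)).
Proof. exact: Uchi_mapE. Qed.
End MapLemmas.

Lemma Uchi_agree (K : fieldType) (n p : nat) (chi : {scalar 'M[K]_n}) (a : {vspace 'M[K]_(n + n)})
    (S : pzRingType) (f g : {rmorphism Uchi p chi a -> S}) (P : S -> Prop) :
  (forall c, f (Uscal p chi a c) = g (Uscal p chi a c)) ->
  (forall x y, P y -> f (Ugen p chi x) * y = g (Ugen p chi x) * y) ->
  (forall r y, P y -> P (f r * y)) ->
  forall r y, P y -> f r * y = g r * y.
Proof.
move=> fs fg Pf r y Py; elim/Uchi_ind: r => [r t Hr Ht|c|x r Hr].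
- by rewrite (rmorphD f) (rmorphD g) !mulrDl Hr Ht.
- by rewrite fs.
by rewrite (rmorphM f) (rmorphM g) -!mulrA -Hr fg //; exact: Pf.
Qed.

Section KlamLemmas.
Variables (K : fieldType) (n p : nat) (chi : {scalar 'M[K]_n}).
Variables (lam : 'rV[K]_n) (W : {vspace 'M[K]_(n + n)}).
Hypothesis lam_chi : weight_set p chi lam.
Hypothesis W_lam : max_isotropic lam W.
Local Notation ev := (Uchi_lift (Klam_super W_lam) (Klam_restricted lam_chi W_lam)).

Lemma Klam_gen x : ev (Ugen p chi x) = wt lam (ulsubmx (vsval x)).
Proof.
apply: etrans (Uchi_liftE _ _ _) _; exact: (falg_lift_gen (Klam_act lam (W := W))).
Qed.

Lemma Klam_scal k : ev (Uscal p chi _ k) = k.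
Proof.
apply: etrans (Uchi_liftE _ _ _) _.
apply: etrans (falg_lift_scale (Klam_act lam (W := W)) k 1) _.
by rewrite rmorph1 /GRing.scale /= mulr1.
Qed.
End KlamLemmas.

(** Off the diagonal chi vanishes on the root vectors; on it the condition on lam is read at an
    idempotent matrix unit. This is the input the oscillators need, with mu = lam. *)
Lemma weight_set_delta (K : fieldType) (p n : nat) (pos : rel 'I_n) (chi : {scalar 'M[K]_n})
    (lam : 'rV[K]_n) : positive_system pos -> (0 < p)%N ->
  vanishes_on chi (npos K pos) -> vanishes_on chi (nneg K pos) -> weight_set p chi lam ->
  forall i j, chi (delta_mx i j) ^+ p = if i == j then lam 0 i ^+ p - lam 0 i else 0.
Proof.
move=> [_ _ tot] p_gt0 cp cn wl i j; have [<-|ij] := eqVneq i j.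
  have dE : diag_mx (delta_mx 0 i) = delta_mx i i :> 'M[K]_n.
    apply/matrixP=> k l; rewrite !mxE eqxx /=; have [->|kl] := eqVneq k l.
      by rewrite andbb.
    by rewrite mulr0n; case: (eqVneq k i) kl => //= ->; rewrite eq_sym => /negbTE->.
  have dp : (delta_mx i i : 'M[K]_n) ^+ p = delta_mx i i.
    rewrite -(prednK p_gt0); elim: p.-1 => // k Ek.
    by rewrite exprS Ek -[_ * _]/(_ *m _) mul_delta_mx.
  have := wl (delta_mx 0 i); rewrite dE dp => <-.
  suff -> : wt lam (delta_mx i i) = lam 0 i by [].
  rewrite /wt (bigD1 i) //= mxE !eqxx mulr1 big1 ?addr0 // => k /negbTE ki.
  by rewrite mxE ki mulr0.
have hE : homog false (qeven K i j) by rewrite /homog !qeltE.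
suff : chi (ulsubmx (qeven K i j)) = 0.
  by rewrite qelt_ul => ->; rewrite expr0n gtn_eqF.
have := tot i j ij; case pij: (pos i j) => /= pji.
  by apply: cp => //; apply/qspanP/qsupp_even.
by apply: cn => //; apply/qspanP/qsupp_even.
Qed.

Lemma restr_regular (R S : pzRingType) (phi : {rmorphism R -> S}) a (y : restr phi S^o) :
  a *: y = phi a * (y : S).
Proof. by []. Qed.

(** * From the baby Verma module to the oscillators *)

Section ToFock.
Variables (K : closedFieldType) (p n : nat).
Hypotheses (p_char : p \in [pchar K]) (p_gt2 : (2 < p)%N).
Variables (pos : rel 'I_n) (pos_sys : positive_system pos).
Variable chi : {scalar 'M[K]_n}.
Hypothesis chi_npos : vanishes_on chi (npos K pos).
Variables (lam : 'rV[K]_n) (lam_chi : weight_set p chi lam).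
Variables (W : {vspace 'M[K]_(n + n)}) (W_lam : max_isotropic lam W).
Variable s : seq 'I_n.
Hypothesis s_pos : forall i j, pos i j -> (index i s < index j s)%N.
Variables (S : algType K) (u v : bool -> 'I_n * 'I_n -> S).
Hypothesis cw : clifford_weyl p (lam 0) u v.
Hypothesis chi_delta : forall i j : 'I_n,
  chi (delta_mx i j) ^+ p = if i == j then lam 0 i ^+ p - lam 0 i else 0.
Local Notation cw_letter := (cw_letter u v).
Local Notation Y := (fun l => cw_op u v l : {linear S -> S}).
Local Notation gl := 'M[K]_(n + n).
Local Notation rho := (fock_rho p_char p_gt2 cw chi_delta).
Local Notation vac := (vacuum u v (upper s)).
Local Notation h0W := (cartan0 K n + W)%VS.

(* This must be the proof term that occurs in [Vchi]. *)
Let W_sub : (W <= cartan1 K n)%VS := Defs.W_sub_subproof W_lam.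

Lemma cw_mx_mull d A y : cw_mx u v d A * y = \sum_i \sum_j A i j *: (cw_letter (d, (i, j)) * y).
Proof.
rewrite /cw_mx mulr_suml; apply: eq_bigr => i _; rewrite mulr_suml; apply: eq_bigr => j _.
by rewrite scalerAl.
Qed.

Lemma cw_mx_diag d (A : 'M[K]_n) y : (forall i j, i != j -> A i j = 0) ->
  cw_mx u v d A * y = \sum_i A i i *: (cw_letter (d, (i, i)) * y).
Proof.
move=> A0; rewrite cw_mx_mull; apply: eq_bigr => i _.
by rewrite (bigD1 i) //= big1 ?addr0 // => j ji; rewrite A0 ?scale0r // eq_sym.
Qed.

Lemma vacuum0 st : vacuum u v st 0.
Proof. by move=> i j _ a; rewrite mulr0. Qed.

Lemma vacuumD st x y : vacuum u v st x -> vacuum u v st y -> vacuum u v st (x + y).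
Proof. by move=> vx vy i j ij a; rewrite mulrDr vx // vy // addr0. Qed.

Lemma vacuumB st x y : vacuum u v st x -> vacuum u v st y -> vacuum u v st (x - y).
Proof. by move=> vx vy i j ij a; rewrite mulrBr vx // vy // subr0. Qed.

Lemma vacuumZ st c x : vacuum u v st x -> vacuum u v st (c *: x).
Proof. by move=> vx i j ij a; rewrite -scalerAr vx // scaler0. Qed.

Lemma vacuum_sum st (I : finType) (F : I -> S) : (forall i, vacuum u v st (F i)) ->
  vacuum u v st (\sum_i F i).
Proof. by move=> H; apply: big_ind => //; [exact: vacuum0|exact: vacuumD]. Qed.

Lemma cw_elt_cartan x y : x \in cartan K n -> vac y -> vac (cw_elt u v x * y).
Proof.
move=> /mem_qspan Sx vy; rewrite mulrDl; apply: vacuumD; rewrite cw_mx_diag.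
- by apply: vacuum_sum => i; apply: vacuumZ; apply: (vacuum_diag cw).
- by move=> i j ij; have [] := qsupp_uniq Sx ij.
- by apply: vacuum_sum => i; apply: vacuumZ; apply: (vacuum_diag cw).
by move=> i j ij; have [] := qsupp_uniq Sx ij.
Qed.

Lemma cw_elt_borel x y : x \in borel K pos -> vac y ->
  cw_elt u v x * y = cw_elt u v (hproj x) * y.
Proof.
move=> /borelP Sx vy.
have H d (A : 'M[K]_n) : (forall i j, ~~ ((i == j) || pos i j) -> A i j = 0) ->
    cw_mx u v d A * y = cw_mx u v d (hdiag A) * y.
  move=> A0; rewrite !cw_mx_mull; apply: eq_bigr => i _; apply: eq_bigr => j _.
  rewrite mxE; have [<-|ij] := eqVneq i j; first by rewrite mulr1n.
  rewrite mulr0n scale0r; have [pij|npij] := boolP (pos i j).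
    by rewrite (vacuum_raise cw d vy) ?scaler0 //; apply: s_pos.
  by rewrite A0 ?scale0r // negb_or ij.
rewrite /cw_elt 2!mulrDl /hproj !qeltE; congr (_ + _); apply: H => i j ij.
  by have [] := qsupp_uniq Sx ij.
by have [] := qsupp_uniq Sx ij.
Qed.

(** On vacua n^+ acts by zero, so b acts through its projection to h, just as on V(lam) extended to
    b. *)
Lemma borel_agree (rh rb : {rmorphism Uchi p chi (borel K pos) -> S}) :
  (forall x, rh (Ugen p chi x) = cw_elt u v (hproj (vsval x))) ->
  (forall c, rh (Uscal p chi _ c) = c%:A) ->
  (forall x, rb (Ugen p chi x) = cw_elt u v (vsval x)) ->
  (forall c, rb (Uscal p chi _ c) = c%:A) ->
  forall a y, vac y -> rh a * y = rb a * y.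
Proof.
move=> hg hs bg bs; apply: Uchi_agree => [c|x y vy|r y vy]; first by rewrite hs bs.
  by rewrite hg bg (cw_elt_borel (subvsP x)).
elim/Uchi_ind: r => [a b Ha Hb|c|x a Ha].
- by rewrite (rmorphD rh) mulrDl; apply: vacuumD.
- by rewrite hs mulr_algl; apply: vacuumZ.
by rewrite (rmorphM rh) hg -mulrA; apply: cw_elt_cartan => //; exact: hproj_cartan.
Qed.

Variable m0 : S.
Hypothesis m0_vac : vac m0.
Hypothesis m0_wt : has_weight Y (lam 0) m0.
Hypothesis m0_W : forall c, (c <= odd_mx W)%MS -> odd_op Y c m0 = 0.

Lemma cw_elt_cartan0W x : x \in h0W ->
  cw_elt u v x * m0 = wt lam (ulsubmx x) *: m0.
Proof.
move=> xW; have /mem_qspan Sx := subvP (cartan0W_sub W_sub) x xW.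
rewrite mulrDl cw_mx_diag; last by move=> i j ij; have [] := qsupp_uniq Sx ij.
rewrite cw_mx_diag; last by move=> i j ij; have [] := qsupp_uniq Sx ij.
have -> : \sum_i ulsubmx x i i *: (cw_letter (false, (i, i)) * m0) = wt lam (ulsubmx x) *: m0.
  rewrite /wt scaler_suml; apply: eq_bigr => i _.
  by rewrite -[_ * m0]/(Y (false, (i, i)) m0) m0_wt scalerA mulrC.
suff : odd_op Y (odd_coord x) m0 = 0.
  rewrite /odd_op; under eq_bigr do rewrite mxE.
  by move=> ->; rewrite addr0.
apply: m0_W; case/memv_addP: xW => y yh [z zW ->].
rewrite linearD /= (_ : odd_coord y = 0) ?add0r ?odd_mxP ?odd_coordK ?(subvP W_sub) //.
by apply/rowP=> i; rewrite mxE (cartan0_ur yh) !mxE.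
Qed.

Lemma cartan_queer : (cartan K n <= queer K n)%VS.
Proof. exact: qspanS. Qed.

Definition rho_cartan : {rmorphism Uchi p chi (cartan K n) -> S} :=
  rho \o Uincl p chi cartan_queer.

Lemma rho_cartan_gen x : rho_cartan (Ugen p chi x) = cw_elt u v (vsval x).
Proof.
apply: etrans (congr1 rho (Uincl_gen _ _ cartan_queer x)) _; rewrite fock_rho_gen vsprojK //.
exact: subvP cartan_queer _ (subvsP x).
Qed.

Lemma rho_cartan_scal c : rho_cartan (Uscal p chi _ c) = c%:A.
Proof.
by apply: etrans (congr1 rho (Uincl_scal _ _ cartan_queer c)) _; rewrite fock_rho_scal.
Qed.

Lemma rho_cartan_vac r y : vac y -> vac (rho_cartan r * y).
Proof.
move=> vy; elim/Uchi_ind: r => [a b Ha Hb|c|x a Ha].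
- by rewrite (rmorphD rho_cartan) [X in vac X]mulrDl; apply: vacuumD.
- by rewrite rho_cartan_scal mulr_algl; apply: vacuumZ.
by rewrite (rmorphM rho_cartan) rho_cartan_gen -mulrA; apply: cw_elt_cartan => //; exact: subvsP.
Qed.

Local Notation VS := (restr rho_cartan S^o).

(** The vacuum [m0] has weight lam and is killed by W, which makes this map linear over h_0 + W;
    inducing it twice reaches V(lam) and then Z. *)
Definition Klam_fock (k : Klam lam_chi W_lam) : VS := (k : K) *: m0.

Lemma Klam_fockD x y : Klam_fock (x + y) = Klam_fock x + Klam_fock y.
Proof. exact: (@scalerDl K S m0 x y). Qed.

Lemma Klam_fockZ a k : Klam_fock (a *: k) = Uincl p chi (cartan0W_sub W_sub) a *: Klam_fock k.
Proof.
set ev := Uchi_lift (Klam_super W_lam) (Klam_restricted lam_chi W_lam).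
suff E : rho_cartan (Uincl p chi (cartan0W_sub W_sub) a) * m0 = ev a *: m0.
  have R1 := restr_regular (phi := rho_cartan) (Uincl p chi (cartan0W_sub W_sub) a) (Klam_fock k).
  apply: etrans (esym R1).
  rewrite -scalerAr E scalerA mulrC.
  have R2 := restr_regular (phi := ev) a k.
  exact: (congr1 (fun t : K => t *: m0) R2).
elim/Uchi_ind: a => [a b Ha Hb|c|x a Ha].
- by rewrite (rmorphD ev) scalerDl -Ha -Hb !rmorphD mulrDl.
- by rewrite Uincl_scal rho_cartan_scal Klam_scal mulr_algl.
rewrite (rmorphM ev) (rmorphM (Uincl p chi (cartan0W_sub W_sub))) Uincl_gen (rmorphM rho_cartan).
rewrite rho_cartan_gen -mulrA Ha Klam_gen.
rewrite -scalerAr vsprojK; last exact: subvP (cartan0W_sub W_sub) _ (subvsP x).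
by rewrite cw_elt_cartan0W ?subvsP // scalerA mulrC.
Qed.

Definition Vchi_fock : Vchi lam_chi W_lam -> VS := tensor_lift Klam_fock.

Lemma Vchi_fock_tensor r k : Vchi_fock (tensor _ r k) = rho_cartan r * ((k : K) *: m0).
Proof. by apply: etrans (tensor_liftE Klam_fockD Klam_fockZ r k) _. Qed.

Lemma Vchi_fock_vac x : vac (Vchi_fock x).
Proof.
elim/ext_scalars_ind: x => [|x y vx vy|r k].
- rewrite /Vchi_fock (tensor_lift0 Klam_fockD Klam_fockZ); exact: vacuum0.
- rewrite /Vchi_fock (tensor_liftB Klam_fockD Klam_fockZ); exact: vacuumB vx vy.
by rewrite Vchi_fock_tensor; apply: rho_cartan_vac; apply: vacuumZ.
Qed.

Definition rho_borel : {rmorphism Uchi p chi (borel K pos) -> S} :=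
  rho \o Uincl p chi (borel_sub K pos).

Lemma rho_borel_gen x : rho_borel (Ugen p chi x) = cw_elt u v (vsval x).
Proof.
apply: etrans (congr1 rho (Uincl_gen _ _ (borel_sub K pos) x)) _; rewrite fock_rho_gen vsprojK //.
exact: subvP (borel_sub K pos) _ (subvsP x).
Qed.

Lemma rho_borel_scal c : rho_borel (Uscal p chi _ c) = c%:A.
Proof.
by apply: etrans (congr1 rho (Uincl_scal _ _ (borel_sub K pos) c)) _; rewrite fock_rho_scal.
Qed.

Let hp := Uchi_map (hproj_restricted_hom pos_sys p chi_npos).

Definition rho_hproj : {rmorphism Uchi p chi (borel K pos) -> S} := rho_cartan \o hp.

Lemma rho_hproj_gen x : rho_hproj (Ugen p chi x) = cw_elt u v (hproj (vsval x)).
Proof.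
apply: etrans (congr1 rho_cartan (Uchi_mapE _ x)) _.
by rewrite rho_cartan_gen vsprojK // hproj_cartan.
Qed.

Lemma rho_hproj_scal c : rho_hproj (Uscal p chi _ c) = c%:A.
Proof.
by apply: etrans (congr1 rho_cartan (Uchi_map_scal _ c)) _; rewrite rho_cartan_scal.
Qed.

Lemma Vchi_fock_hproj a (x : Vchi lam_chi W_lam) :
  Vchi_fock (hp a *: x) = rho_borel a * Vchi_fock x.
Proof.
have E := borel_agree rho_hproj_gen rho_hproj_scal rho_borel_gen rho_borel_scal a (Vchi_fock_vac x).
apply: etrans _ E; exact: (tensor_liftZ Klam_fockD Klam_fockZ).
Qed.

Definition borel_fock (x : Vchi_borel lam_chi W_lam pos_sys chi_npos) : restr rho S^o := Vchi_fock x.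

Lemma borel_fockD x y : borel_fock (x + y) = borel_fock x + borel_fock y.
Proof. exact: (tensor_liftD Klam_fockD Klam_fockZ). Qed.

Lemma borel_fockZ a x : borel_fock (a *: x) = Uincl p chi (borel_sub K pos) a *: borel_fock x.
Proof.
have R := restr_regular (phi := rho) (Uincl p chi (borel_sub K pos) a) (borel_fock x).
exact: etrans (Vchi_fock_hproj a x) (esym R).
Qed.

Local Notation Z := (baby_Verma lam_chi W_lam pos_sys chi_npos).

Definition verma_fock : Z -> restr rho S^o :=
  tensor_lift (M := Vchi_borel lam_chi W_lam pos_sys chi_npos) (N := restr rho S^o) borel_fock.

Definition verma_top : Z := tensor (M := Vchi_borel lam_chi W_lam pos_sys chi_npos) _ 1
  (tensor (M := Klam lam_chi W_lam) _ 1 (1 : K)).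

Lemma verma_fock_top : verma_fock verma_top = m0.
Proof.
apply: etrans (tensor_liftE borel_fockD borel_fockZ _ _) _.
by rewrite scale1r; apply: etrans (Vchi_fock_tensor _ _) _; rewrite rmorph1 mul1r scale1r.
Qed.

Lemma verma_fock0 : verma_fock 0 = 0.
Proof. exact: (tensor_lift0 borel_fockD borel_fockZ). Qed.

Lemma verma_fock_act w z : verma_fock (act (fun l => letter_op l : {linear kmod Z -> kmod Z}) w z) =
  (\prod_(l <- w) cw_letter l) * verma_fock z.
Proof.
elim: w => [|l w IH]; first by rewrite big_nil mul1r.
rewrite big_cons -mulrA -IH -(fock_rho_letter p_char p_gt2 cw chi_delta).
exact: (tensor_liftZ borel_fockD borel_fockZ).
Qed.
End ToFock.

Lemma fock_model (K : fieldType) (p n : nat) (mu : 'I_n -> K) (s : seq 'I_n) :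
  p \in [pchar K] -> (2 < p)%N ->
  exists (S : algType K) (u v : bool -> 'I_n * 'I_n -> S) (y : S),
  [/\ clifford_weyl p mu u v, forall i z, u false (i, i) * z = 0 -> z = 0,
      vacuum u v (upper s) y, y != 0 & forall a, cw_letter u v (false, (a, a)) * y = mu a *: y].
Proof.
move=> p_char p_gt2; have p_gt0 : (0 < p)%N by apply: ltn_trans p_gt2.
have cw := fock_clifford_weyl mu p_char p_gt0.
have vy := fock_vacuumP mu p_gt0 (upper s).
exists (endo K (empty_state n p_gt0)), (fock_u K p_gt0), (fock_v mu p_gt0), (fock_vacuum K p_gt0 (upper s)).
split.
- exact: cw.
- by move=> i z; exact: fock_u_inj.
- exact: vy.
- exact: fock_vacuum_neq0.
move=> a; apply: (vacuum_weight cw vy); apply: (fock_vacuum_weight mu p_gt0).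
by move=> i; rewrite /upper /= ltnn.
Qed.

Section VermaNonzero.
Variables (K : closedFieldType) (p n : nat).
Hypotheses (p_char : p \in [pchar K]) (p_gt2 : (2 < p)%N).
Variables (pos : rel 'I_n) (pos_sys : positive_system pos).
Variable chi : {scalar 'M[K]_n}.
Hypotheses (chi_npos : vanishes_on chi (npos K pos)) (chi_nneg : vanishes_on chi (nneg K pos)).
Variables (lam : 'rV[K]_n) (lam_chi : weight_set p chi lam).
Variables (W : {vspace 'M[K]_(n + n)}) (W_lam : max_isotropic lam W).
Variable s : seq 'I_n.
Hypotheses (s_uniq : uniq s) (s_full : forall i, i \in s).
Hypothesis s_pos : forall i j, pos i j -> (index i s < index j s)%N.
Local Notation Z := (baby_Verma lam_chi W_lam pos_sys chi_npos).
Local Notation v0 := (verma_top pos_sys chi_npos lam_chi W_lam).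

(** T v0 is sent to T m0, where m0 is a nonzero vacuum obtained from the Fock vacuum by odd Cartan
    operators; [lowering_vacuum] shows that T m0 is nonzero. *)
Lemma verma_lower_neq0 :
  act (fun l => letter_op l : {linear kmod Z -> kmod Z}) (lowering_word p s) v0 != 0.
Proof.
have p_gt0 : (0 < p)%N by apply: ltn_trans p_gt2.
have [S [u [v [y [cw u_inj vy y0 wy]]]]] := fock_model (lam 0) s p_char p_gt2.
have chi_delta := weight_set_delta pos_sys p_gt0 chi_npos chi_nneg lam_chi.
pose Y := (fun l => cw_op u v l : {linear S -> S}).
have qY : queer_action p Y := cw_queer_action p_char p_gt2 cw.
pose P z := vacuum u v (upper s) z /\ has_weight Y (lam 0) z.
have P_odd c z : P z -> P (odd_op Y c z).
  move=> [vz wz]; split; last exact: (has_weight_odd qY).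
  by apply: vacuum_sum => i; apply: vacuumZ; apply: (vacuum_diag cw).
have [W1 iso _] := W_lam.
pose cs := [seq row k (odd_mx W) | k <- enum 'I_(\dim W)].
have [|m0 [[vm wm] m00 km]] := isotropic_vector p_char p_gt2 qY (fun z (Pz : P z) => Pz.2) P_odd
  (cs := cs) (v := y) _ (conj vy wy) y0.
  by move=> c d /mapP[k _ ->] /mapP[l _ ->]; apply: (odd_mx_iso W1 iso); exact: row_sub.
have m0_W c : (c <= odd_mx W)%MS -> odd_op Y c m0 = 0.
  move=> /submxP[D ->]; rewrite mulmx_sum_row; elim/big_ind: _ => [|a b Ha Hb|k _].
  - by rewrite /odd_op big1 // => i _; rewrite mxE scale0r.
  - by rewrite -[a]scale1r odd_opD Ha Hb scaler0 addr0.
  have E : odd_op Y (row k (odd_mx W)) m0 = 0 by apply: km; apply: map_f; rewrite mem_enum.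
  have := odd_opD Y (D 0 k) (row k (odd_mx W)) 0 m0; rewrite addr0 E scaler0 add0r => ->.
  by rewrite /odd_op big1 // => i _; rewrite mxE scale0r.
have top := verma_fock_top p_char p_gt2 pos_sys chi_npos lam_chi W_lam s_pos cw chi_delta vm wm m0_W.
have act := @verma_fock_act K p n p_char p_gt2 pos pos_sys chi chi_npos lam lam_chi W W_lam
  s s_pos _ _ _ cw chi_delta _ vm wm m0_W.
have := lowering_vacuum p_char p_gt2 cw u_inj s_uniq s_full vm m00.
have f0 := verma_fock0 p_char p_gt2 pos_sys chi_npos lam_chi W_lam s_pos cw chi_delta vm wm m0_W.
by apply: contraNneq => E; rewrite -top -act E f0.
Qed.
End VermaNonzero.

(** * Words and parity in U_chi(q(n)) *)

Lemma expand_parts (R : pzRingType) (a b c d : R) :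
  (a + b) * (c + d) = (a * c + b * d) + (a * d + b * c).
Proof. by rewrite mulrDl !mulrDr [b * c + b * d]addrC addrACA. Qed.

Section UchiSpan.
Variables (K : fieldType) (n p : nat) (chi : {scalar 'M[K]_n}).
Local Notation gl := 'M[K]_(n + n).
Local Notation L := (subvs_of (queer K n)).
Local Notation U := (Uchi p chi (queer K n)).
Local Notation scal := (@Uscal K n p chi (queer K n)).
Local Notation gen := (@Ugen K n p chi (queer K n)).
Variable M : lmodType U.
Local Notation X := (fun l => letter_op (M := M) l : {linear kmod M -> kmod M}).

Lemma gen0 : gen 0 = 0.
Proof. by rewrite -[0 : L](scale0r 0) UgenZ Uscal0 mul0r. Qed.

Lemma gen_sum (I : finType) (F : I -> L) : gen (\sum_i F i) = \sum_i gen (F i).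
Proof. by apply: (big_morph gen); [exact: UgenD|exact: gen0]. Qed.

Lemma gen_scaleZ c (x : L) (m : kmod M) :
  gen (c *: x) *: (m : M) = c *: (gen x *: (m : M) : kmod M).
Proof. by rewrite UgenZ -scalerA. Qed.

Fact qpart_linear d : linear (qpart d : 'M[K]_n -> gl).
Proof.
move=> c B D; rewrite /qpart /qelt; case: d;
  by rewrite scale_block_mx add_block_mx scaler0 addr0.
Qed.
HB.instance Definition _ d :=
  GRing.isLinear.Build K 'M[K]_n gl *:%R (@qpart K n d) (qpart_linear d).

Lemma qpart_letters d A : qpart d A = \sum_i \sum_j A i j *: qletter K (d, (i, j)) :> gl.
Proof.
rewrite {1}[A]matrix_sum_delta linear_sum; apply: eq_bigr => i _.
rewrite linear_sum; apply: eq_bigr => j _; rewrite linearZ; congr (_ *: _).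
Qed.

Lemma gen_homog d x (m : kmod M) : homog d (vsval x) -> exists A : 'M[K]_n,
  vsval x = qpart d A /\
  (gen x *: (m : M) : kmod M) = \sum_i \sum_j A i j *: X (d, (i, j)) m.
Proof.
move=> /(queer_homog (subvsP x))[A Ex]; exists A; split=> //.
have -> : x = \sum_i \sum_j A i j *: lie_letter K (d, (i, j)).
  apply/val_inj; rewrite -[val x]/(vsval x) Ex qpart_letters.
  rewrite [RHS]linear_sum; apply: eq_bigr => i _; rewrite linear_sum; apply: eq_bigr => j _.
  by rewrite linearZ /= lie_letterE.
rewrite gen_sum scaler_suml; apply: eq_bigr => i _; rewrite gen_sum scaler_suml.
by apply: eq_bigr => j _; rewrite gen_scaleZ.
Qed.

Lemma kspan_sum (V : lmodType K) (B : V -> Prop) (I : finType) (F : I -> V) :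
  (forall i, kspan B (F i)) -> kspan B (\sum_i F i).
Proof. by move=> H; apply: big_ind => //; [exact: KSpan0|exact: kspan_add]. Qed.

Section WordSpan.
Variable z : kmod M.
Local Notation B d := (fun y : kmod M => exists2 w, wparity w = d & y = act X w z).

Lemma word_span_gen d e x (m : kmod M) : homog d (vsval x) -> kspan (B e) m ->
  kspan (B (d (+) e)) (gen x *: (m : M) : kmod M).
Proof.
move=> hx Bm; have [A [_ ->]] := gen_homog m hx.
apply: kspan_sum => i; apply: kspan_sum => j; apply: kspan_scale.
apply: (kspan_linear (f := X (d, (i, j)))) Bm => _ [w <- ->]; apply: kspan_incl.
by exists ((d, (i, j)) :: w); rewrite ?wparity_cons.
Qed.

Lemma word_span_homog d e u (m : kmod M) : @Uhomog K n p chi (queer K n) d u ->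
  kspan (B e) m -> kspan (B (d (+) e)) (u *: (m : M) : kmod M).
Proof.
move=> Hu Bm; elim: Hu => {d u} [c|d u v _ Hu _ Hv|d f x u hx _ Hu].
- by rewrite addFb -kmodE; apply: kspan_scale.
- by rewrite scalerDl; apply: kspan_add.
by rewrite -scalerA -addbA; apply: word_span_gen.
Qed.
End WordSpan.

Lemma queer_parts (x : L) : exists x0 x1 : L,
  [/\ homog false (vsval x0), homog true (vsval x1) & x = x0 + x1].
Proof.
pose y d := vsproj (queer K n) (qpart d (if d then ursubmx (vsval x) else ulsubmx (vsval x))).
have Ey d : vsval (y d) = qpart d (if d then ursubmx (vsval x) else ulsubmx (vsval x)).
  by rewrite vsprojK //; apply/qspanP; rewrite /qpart; case: d; apply: qelt_qsupp.
exists (y false), (y true); split; rewrite ?Ey; try by rewrite /homog /qpart !qeltE.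
apply/val_inj; rewrite -[val x]/(vsval x) -[val _]/(vsval (_ + _)) linearD /= !Ey.
rewrite /qpart {1}(qsuppE (mem_qspan (subvsP x))) /qelt add_block_mx.
by rewrite !addr0 !add0r.
Qed.

Lemma Uchi_parts (u : U) : exists u0 u1 : U,
  [/\ @Uhomog K n p chi (queer K n) false u0, @Uhomog K n p chi (queer K n) true u1 & u = u0 + u1].
Proof.
have H0 d : @Uhomog K n p chi (queer K n) d 0.
  have h0 : @Uhomog K n p chi (queer K n) false 0 by rewrite -(Uscal0 p chi (queer K n)); exact: UhomogC.
  (* [Uhomog] has no clause for an odd zero; it arises as a product with the zero matrix, which is
     homogeneous of both parities. *)
  case: d => //; have := UhomogM (x := 0) (d := true) _ h0; rewrite mulr0; apply.
  by rewrite linear0; split; apply/matrixP=> i j; rewrite !mxE.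
elim/Uchi_ind: u => [u v [u0 [u1 [a0 a1 ->]]] [v0 [v1 [b0 b1 ->]]]|c|x u [u0 [u1 [a0 a1 ->]]]].
- by exists (u0 + v0), (u1 + v1); split; [exact: UhomogD|exact: UhomogD|rewrite addrACA].
- by exists (scal c), 0; split; [exact: UhomogC|exact: H0|rewrite addr0].
have [x0 [x1 [h0 h1 ->]]] := queer_parts x.
exists (gen x0 * u0 + gen x1 * u1), (gen x0 * u1 + gen x1 * u0); split.
- by apply: UhomogD; [exact: (UhomogM h0 a0)|exact: (UhomogM h1 a1)].
- by apply: UhomogD; [exact: (UhomogM h0 a1)|exact: (UhomogM h1 a0)].
rewrite UgenD; exact: expand_parts.
Qed.

Lemma Uchi_word_span (z : kmod M) u :
  kspan (fun y : kmod M => exists w, y = act X w z) (u *: (z : M) : kmod M).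
Proof.
have [u0 [u1 [h0 h1 ->]]] := Uchi_parts u; rewrite scalerDl.
have Bz : kspan (fun y : kmod M => exists2 w, wparity w = false & y = act X w z) z.
  by apply: kspan_incl; exists [::] => //; rewrite /wparity big_nil.
by apply: kspan_add; [have := word_span_homog h0 Bz|have := word_span_homog h1 Bz];
  apply: kspan_sub => _ [w _ ->]; apply: kspan_incl; exists w.
Qed.

Lemma UhomogZ d c u : @Uhomog K n p chi (queer K n) d u -> Uhomog d (scal c * u).
Proof.
elim=> {d u} [b|d u v _ Hu _ Hv|d e x u hx _ Hu].
- by rewrite -UscalM; exact: UhomogC.
- by rewrite mulrDr; exact: UhomogD.
by rewrite mulrA -Uscal_comm -mulrA; exact: UhomogM.
Qed.

Lemma UhomogMM d e u v : @Uhomog K n p chi (queer K n) d u ->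
  @Uhomog K n p chi (queer K n) e v -> Uhomog (d (+) e) (u * v).
Proof.
move=> Hu Hv; elim: Hu => {d u} [c|d u t _ Hu _ Ht|d f x u hx _ Hu].
- by rewrite addFb; exact: UhomogZ.
- by rewrite mulrDl; exact: UhomogD.
by rewrite -addbA -mulrA; exact: UhomogM.
Qed.

End UchiSpan.

Lemma odd_op_gen (K : closedFieldType) (n p : nat) (chi : {scalar 'M[K]_n})
    (M : lmodType (Uchi p chi (queer K n))) c (m : kmod M) :
  odd_op (fun l => letter_op (M := M) l : {linear kmod M -> kmod M}) c m =
  Ugen p chi (vsproj (queer K n) (odd_elt c)) *: (m : M).
Proof.
have hq : odd_elt c \in queer K n.
  exact: (subvP (cartan_queer K n) _ (subvP (cartan1_sub K n) _ (odd_elt_cartan1 c))).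
have [] := @gen_homog _ _ _ _ _ true (vsproj (queer K n) (odd_elt c)) m.
  by rewrite vsprojK // /homog /odd_elt !qeltE.
move=> A []; rewrite vsprojK // /odd_elt /qpart => EA ->.
have -> : A = diag_mx c by have := congr1 ursubmx EA; rewrite !qeltE.
apply: eq_bigr => i _; rewrite (bigD1 i) //= mxE eqxx mulr1n big1 ?addr0 // => j ji.
by rewrite mxE eq_sym (negbTE ji) mulr0n scale0r.
Qed.

Section TensorScale.
Variables (S R : pzRingType) (phi : {rmorphism S -> R}) (M : lmodType S).

Lemma ext_scale_tensor r r' (m : M) : r *: tensor phi r' m = tensor phi (r * r') m.
Proof. exact: ext_scaleU. Qed.

Lemma tensor1 r (m : M) : tensor phi r m = r *: tensor phi 1 m.
Proof. by rewrite ext_scale_tensor mulr1. Qed.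

Lemma tensor1_scale a (m : M) : tensor phi 1 (a *: m) = phi a *: tensor phi 1 m.
Proof. by rewrite ext_scale_tensor mulr1 -tensorS mul1r. Qed.
End TensorScale.

(** * The generator of the baby Verma module *)

Section VermaTop.
Variables (K : closedFieldType) (p n : nat).
Variables (pos : rel 'I_n) (pos_sys : positive_system pos).
Variable chi : {scalar 'M[K]_n}.
Hypothesis chi_npos : vanishes_on chi (npos K pos).
Variables (lam : 'rV[K]_n) (lam_chi : weight_set p chi lam).
Variables (W : {vspace 'M[K]_(n + n)}) (W_lam : max_isotropic lam W).
Local Notation gl := 'M[K]_(n + n).
Local Notation V := (Vchi lam_chi W_lam).
Local Notation Vb := (Vchi_borel lam_chi W_lam pos_sys chi_npos).
Local Notation Z := (baby_Verma lam_chi W_lam pos_sys chi_npos).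
Local Notation v0 := (verma_top pos_sys chi_npos lam_chi W_lam).
Local Notation Uq := (Uchi p chi (queer K n)).
Local Notation scal := (@Uscal K n p chi (queer K n)).
Local Notation gen := (@Ugen K n p chi (queer K n)).
Local Notation hgen := (@Ugen K n p chi (cartan K n)).
Local Notation hscal := (@Uscal K n p chi (cartan K n)).
Local Notation X := (fun l => letter_op l : {linear kmod Z -> kmod Z}).
Local Notation h0W := (cartan0 K n + W)%VS.

Let W_sub : (W <= cartan1 K n)%VS := Defs.W_sub_subproof W_lam.

Definition verma_in (m : V) : Z := tensor (M := Vb) (Uincl p chi (borel_sub K pos)) 1 m.

Lemma verma_inD x y : verma_in (x + y) = verma_in x + verma_in y.
Proof. exact: (@tensorDr _ _ _ Vb). Qed.

Lemma verma_in0 : verma_in 0 = 0.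
Proof. by apply: (addIr (verma_in 0)); rewrite -verma_inD !add0r. Qed.

Lemma verma_inB x y : verma_in (x - y) = verma_in x - verma_in y.
Proof.
apply: (addIr (verma_in y)); rewrite subrK.
exact: etrans (esym (verma_inD _ _)) (congr1 verma_in (subrK y x)).
Qed.

Let hp : {rmorphism Uchi p chi (borel K pos) -> Uchi p chi (cartan K n)} :=
  Uchi_map (hproj_restricted_hom pos_sys p chi_npos).

Lemma verma_in_hproj a m : Uincl p chi (borel_sub K pos) a *: verma_in m = verma_in (hp a *: m).
Proof. exact: (esym (tensor1_scale (M := Vb) (Uincl p chi (borel_sub K pos)) a m)). Qed.

Lemma verma_in_borel x m : x \in borel K pos ->
  gen (vsproj (queer K n) x) *: verma_in m = verma_in (hgen (vsproj (cartan K n) (hproj x)) *: m).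
Proof.
move=> xb; have := verma_in_hproj (Ugen p chi (vsproj (borel K pos) x)) m.
have E1 : Uincl p chi (borel_sub K pos) (Ugen p chi (vsproj (borel K pos) x)) = gen (vsproj (queer K n) x).
  by apply: etrans (Uincl_gen _ _ _ _) _; rewrite vsprojK.
have E2 : hp (Ugen p chi (vsproj (borel K pos) x)) = hgen (vsproj (cartan K n) (hproj x)).
  by apply: etrans (Uchi_mapE _ _) _; rewrite vsprojK.
by rewrite E1 E2.
Qed.

Lemma hproj_id (x : gl) : x \in cartan K n -> hproj x = x.
Proof.
have hdiag_id (A : 'M[K]_n) : (forall i j, i != j -> A i j = 0) -> hdiag A = A.
  move=> A0; apply/matrixP=> i j; rewrite mxE.
  by have [<-|ij] := eqVneq i j; rewrite ?mulr1n // mulr0n A0.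
move=> /mem_qspan Sx; rewrite {2}(qsuppE Sx) /hproj !hdiag_id // => i j ij;
  by have [] := qsupp_uniq Sx ij.
Qed.

Lemma cartan_borel : (cartan K n <= borel K pos)%VS.
Proof. exact: addvSl. Qed.

Lemma verma_in_cartan (x : subvs_of (cartan K n)) m :
  gen (vsproj (queer K n) (vsval x)) *: verma_in m = verma_in (hgen x *: m).
Proof.
have E : vsproj (cartan K n) (hproj (vsval x)) = x by rewrite hproj_id ?vsvalK ?subvsP.
apply: etrans (verma_in_borel m (subvP cartan_borel _ (subvsP x))) _.
by rewrite E.
Qed.

Lemma verma_in_scal c m : scal c *: verma_in m = verma_in (hscal c *: m).
Proof.
have := verma_in_hproj (Uscal p chi _ c) m.
have E1 := Uincl_scal p chi (borel_sub K pos) c.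
have E2 : hp (Uscal p chi _ c) = hscal c := Uchi_map_scal _ c.
by rewrite E1 E2.
Qed.

Definition vchi_in (k : K) : V :=
  tensor (M := Klam lam_chi W_lam) (Uincl p chi (cartan0W_sub W_sub)) 1 k.
Local Notation vchi_top := (vchi_in 1).

Lemma verma_topE : v0 = verma_in vchi_top. Proof. by []. Qed.

Let ev : {rmorphism Uchi p chi h0W -> K} :=
  Uchi_lift (Klam_super W_lam) (Klam_restricted lam_chi W_lam).

Lemma vchi_in_act a : Uincl p chi (cartan0W_sub W_sub) a *: vchi_top = vchi_in (ev a).
Proof.
pose k1 : Klam lam_chi W_lam := (1 : K).
have E : a *: k1 = ev a := etrans (restr_regular (phi := ev) a (1 : K)) (mulr1 _).
have T := tensor1_scale (M := Klam lam_chi W_lam) (Uincl p chi (cartan0W_sub W_sub)) a (1 : K).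
exact: etrans (esym T) (congr1 (tensor (M := Klam lam_chi W_lam) _ 1) E).
Qed.

Lemma vchi_in_scale c : vchi_in c = hscal c *: vchi_top.
Proof.
have := vchi_in_act (Uscal p chi h0W c).
have E1 := Uincl_scal p chi (cartan0W_sub W_sub) c.
have E2 : ev (Uscal p chi h0W c) = c := Klam_scal _ _ _.
by rewrite E1 E2.
Qed.

Lemma vchi_in_gen x : x \in h0W ->
  hgen (vsproj (cartan K n) x) *: vchi_top = vchi_in (wt lam (ulsubmx x)).
Proof.
move=> xh; have := vchi_in_act (Ugen p chi (vsproj h0W x)).
have E1 := Uincl_gen p chi (cartan0W_sub W_sub) (vsproj h0W x).
have E2 : ev (Ugen p chi (vsproj h0W x)) = wt lam (ulsubmx (vsval (vsproj h0W x))) := Klam_gen _ _ _.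
by rewrite E1 E2 vsprojK.
Qed.

Lemma verma_top_gen x : x \in h0W -> gen (vsproj (queer K n) x) *: v0 = scal (wt lam (ulsubmx x)) *: v0.
Proof.
move=> xh; have xc := subvP (cartan0W_sub W_sub) _ xh.
rewrite verma_topE verma_in_borel ?(subvP cartan_borel) // hproj_id // vchi_in_gen //.
by rewrite vchi_in_scale verma_in_scal.
Qed.

Lemma verma_top_weight : has_weight X (lam 0) v0.
Proof.
move=> a; apply: etrans (verma_top_gen _) _.
  apply: (subvP (addvSl _ _)); apply: (subvP (sumv_sup a isT (subvv _))); exact: memv_line.
rewrite /qletter /= qelt_ul; have -> // : wt lam (delta_mx a a) = lam 0 a.
rewrite /wt (bigD1 a) //= mxE !eqxx mulr1 big1 ?addr0 // => k /negbTE ka.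
by rewrite mxE ka mulr0.
Qed.

Lemma verma_top_W c : (c <= odd_mx W)%MS -> odd_op X c v0 = 0.
Proof.
rewrite odd_mxP // => cW; rewrite odd_op_gen; apply: etrans (verma_top_gen _) _.
  exact: (subvP (addvSr _ _)).
by rewrite /odd_elt qelt_ul wt0 Uscal0 scale0r.
Qed.

Lemma verma_top_upper d i j : pos i j -> X (d, (i, j)) v0 = 0.
Proof.
have [pirr _ _] := pos_sys => pij.
have ij : i != j by apply: contraTneq pij => ->; rewrite pirr.
have xb : qletter K (d, (i, j)) \in borel K pos.
  apply: (subvP (addvSr _ _)); apply/qspanP; case: d; [exact: qsupp_odd|exact: qsupp_even].
apply: etrans (verma_in_borel vchi_top xb) _.
have -> : hproj (qletter K (d, (i, j))) = 0.
  have h0 : hdiag (0 : 'M[K]_n) = 0 by apply/matrixP=> k l; rewrite !mxE mul0rn.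
  have hd : hdiag (delta_mx i j : 'M[K]_n) = 0.
    apply/matrixP=> k l; rewrite !mxE; have [<-|kl] := eqVneq k l; last by rewrite mulr0n.
    by case: (eqVneq k i) => //= ->; rewrite (negbTE ij).
  by rewrite /hproj /qletter; case: (d) => /=; rewrite !qeltE h0 hd qelt0.
have -> : hgen (vsproj (cartan K n) 0) = 0.
  by rewrite linear0 -[0 in LHS](scale0r 0) UgenZ Uscal0 mul0r.
by rewrite scale0r verma_in0.
Qed.

Lemma verma_gen_ind (N : Z -> Prop) : submodule N -> N v0 -> forall x, N x.
Proof.
move=> [N0 Nlin] Nv.
have NZ a x : N x -> N (a *: x) by move=> Nx; rewrite -[a *: x]addr0; apply: Nlin.
have ND x y : N x -> N y -> N (x + y) by move=> Nx Ny; rewrite -[x]scale1r; apply: Nlin.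
have NB x y : N x -> N y -> N (x - y).
  by move=> Nx Ny; apply: ND => //; rewrite -scaleN1r; apply: NZ.
have Nin (m : V) : N (verma_in m).
  elim/ext_scalars_ind: m => [|x y Nx Ny|r k]; first by rewrite verma_in0.
    by rewrite verma_inB; apply: NB.
  rewrite tensor1; elim/Uchi_ind: r => [a b Ha Hb|c|x r Hr].
  - by rewrite scalerDl verma_inD; apply: ND.
  - by rewrite -/(vchi_in k) vchi_in_scale -!verma_in_scal; apply: (NZ); apply: (NZ).
  by rewrite -scalerA -verma_in_cartan; apply: NZ.
elim/ext_scalars_ind => [|x y|r m]; [exact: N0|exact: NB|].
rewrite tensor1; exact: NZ _ _ (Nin m).
Qed.

Local Notation B d := (fun y : kmod Z => exists2 w, wparity w = d & y = act X w v0).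

Lemma verma_in_homog d m : Vchi_homog (lam_chi := lam_chi) (W_lam := W_lam) d m ->
  kspan (B d) (verma_in m : kmod Z).
Proof.
elim=> [|x y _ Hx _ Hy|e f r k Hr Hk <-].
- by rewrite verma_in0; exact: KSpan0.
- by rewrite verma_inD; exact: kspan_add.
case: f Hk => Hk.
  rewrite (Hk isT : k = 0).
  have -> : tensor (M := Klam lam_chi W_lam) (Uincl p chi (cartan0W_sub W_sub)) r 0 = 0.
    by apply: (addIr (tensor (M := Klam lam_chi W_lam) _ r 0)); rewrite -tensorDr !add0r.
  by rewrite verma_in0; exact: KSpan0.
rewrite addbF tensor1 -/(vchi_in k) vchi_in_scale.
elim: Hr => {e r} [c|e r t _ Hr _ Ht|e f x r hx _ Hr].
- rewrite -!verma_in_scal -verma_topE -!kmodE; do 2 apply: kspan_scale.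
  by apply: kspan_incl; exists [::] => //; rewrite /wparity big_nil.
- by rewrite scalerDl verma_inD; exact: kspan_add.
rewrite -scalerA -verma_in_cartan; apply: word_span_gen => //.
rewrite vsprojK //; exact: subvP (cartan_queer K n) _ (subvsP x).
Qed.

(** Translates the grading by iterated tensors into the parity of words, the form in which
    [top_vector] takes its argument. *)
Lemma verma_homog_span d x : baby_Verma_homog d x -> kspan (B d) (x : kmod Z).
Proof.
elim=> [|y z _ Hy _ Hz|e f r m Hr Hm <-]; [exact: KSpan0|exact: kspan_add|].
by rewrite tensor1; apply: word_span_homog => //; exact: verma_in_homog.
Qed.

Lemma verma_homogM d e u x : @Uhomog K n p chi (queer K n) d u -> baby_Verma_homog e x ->
  baby_Verma_homog (d (+) e) (u *: x : Z).
Proof.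
move=> Hu; elim=> [|y z _ Hy _ Hz|f g r m Hr Hm <-].
- by rewrite scaler0; exact: ExtHomog0.
- by rewrite scalerDr; exact: ExtHomogD.
by rewrite ext_scale_tensor addbA; apply: ExtHomogT (UhomogMM Hu Hr) Hm _.
Qed.

Lemma verma_top_homog : baby_Verma_homog false v0.
Proof.
apply: (@ExtHomogT _ _ _ _ _ _ false false false) => //; first by rewrite -Uscal1; exact: UhomogC.
by apply: (@ExtHomogT _ _ _ _ _ _ false false false) => //; rewrite -Uscal1; exact: UhomogC.
Qed.

Lemma verma_word_homog w : baby_Verma_homog (wparity w) (act X w v0 : Z).
Proof.
elim: w => [|l w IH]; first by rewrite /wparity big_nil; exact: verma_top_homog.
rewrite wparity_cons; apply: verma_homogM IH.
rewrite -[Ugen _ _ _]mulr1 -[l.1]addbF -Uscal1; apply: UhomogM; last exact: UhomogC.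
by rewrite lie_letterE; exact: homog_qletter.
Qed.
End VermaTop.

(** * The polynomial Phi and the order of the indices *)

(** Substituting p - k for k turns y - x - k into -(x - y - k). Hence whether Phi vanishes does not
    depend on the order of the indices, and any positive system can be compared with the natural
    one. *)
Lemma phi_swap (K : fieldType) (p : nat) (x y : K) : p \in [pchar K] ->
  phi p y x = (-1) ^+ p.-1 * phi p x y.
Proof.
move=> p_char; rewrite /phi [y + x]addrC mulrCA; congr (_ * _).
have -> : (-1) ^+ p.-1 = \prod_(1 <= k < p) (-1 : K) by rewrite prodr_const_nat subn1.
rewrite -big_split [LHS]big_nat_rev; apply: eq_big_nat => k /andP[k1 kp] /=.
rewrite add1n subSS natrB ?(ltnW kp) // (pcharf0 p_char); ring.
Qed.

Lemma phi_neq0_sym (K : fieldType) (p : nat) (x y : K) : p \in [pchar K] ->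
  (phi p y x != 0) = (phi p x y != 0).
Proof. by move=> pc; rewrite (phi_swap x y pc) mulf_eq0 signr_eq0. Qed.

Lemma Phi_neq0P (K : fieldType) (p n : nat) (lam : 'rV[K]_n) : p \in [pchar K] ->
  Phi p lam != 0 <-> forall i j, i != j -> phi p (lam 0 i) (lam 0 j) != 0.
Proof.
move=> pc; rewrite /Phi; split=> [/prodf_neq0 H i j|H].
  have L (k l : 'I_n) : (k < l)%N -> phi p (lam 0 k) (lam 0 l) != 0.
    by move=> kl; have /prodf_neq0/(_ l kl) := H k isT.
  rewrite -val_eqE neq_ltn => /orP[/L //|/L].
  by rewrite phi_neq0_sym.
apply/prodf_neq0 => i _; apply/prodf_neq0 => j ij; apply: H.
by rewrite -val_eqE neq_ltn ij.
Qed.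

Lemma chain_coef_Phi (K : fieldType) (p n : nat) (lam : 'rV[K]_n) (s : seq 'I_n) :
  p \in [pchar K] -> uniq s -> (forall i, i \in s) ->
  (chain_coef p (lam 0) s != 0) = (Phi p lam != 0).
Proof.
move=> pc s_uniq s_full; rewrite chain_coef_neq0; apply/idP/idP => [sp|].
  apply/(Phi_neq0P lam pc) => i j ij.
  have L (k l : 'I_n) : (index k s < index l s)%N -> phi p (lam 0 k) (lam 0 l) != 0.
    move=> kl; have /(pairwiseP i) H := sp; have := H (index k s) (index l s).
    by rewrite !nth_index // !inE !index_mem; apply.
  have : index i s != index j s.
    by apply: contraNneq ij => E; rewrite -(nth_index i (s_full i)) E nth_index.
  by rewrite neq_ltn => /orP[/L //|/L]; rewrite phi_neq0_sym.
move/(Phi_neq0P lam pc) => H; case: s s_uniq {s_full} => // a s Us.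
apply/(pairwiseP a) => i j; rewrite !inE => si sj ij; apply: H.
by rewrite nth_uniq // neq_ltn ij.
Qed.

(** A positive system is a strict total order on the indices, so sorting by it lists them. *)
Lemma positive_enum n (pos : rel 'I_n) : positive_system pos -> exists s : seq 'I_n,
  [/\ uniq s, forall i, i \in s & forall i j, pos i j = (index i s < index j s)%N].
Proof.
move=> [pirr ptr tot]; pose le := [rel i j | (i == j) || pos i j].
have le_tr : transitive le.
  move=> j i k /orP[/eqP-> //|ij] /orP[/eqP<-|jk]; apply/orP; right=> //.
  exact: ptr ij jk.
have le_tot : total le.
  move=> i j; rewrite /le /= [j == i]eq_sym; have [//|ij] := eqVneq i j.
  by have := tot i j ij; case: (pos i j).
exists (sort le (enum 'I_n)); set s := sort _ _.
have s_uniq : uniq s by rewrite sort_uniq enum_uniq.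
have s_full i : i \in s by rewrite mem_sort mem_enum.
have L i j : (index i s < index j s)%N -> pos i j.
  move=> ij; have := sorted_ltn_index le_tr (sort_sorted le_tot _) i j (s_full i) (s_full j) ij.
  by case/orP=> // /eqP E; rewrite E ltnn in ij.
split=> // i j; apply/idP/idP; last exact: L.
move=> pij; have : index i s != index j s.
  apply: contraTneq pij => E; suff -> : i = j by rewrite pirr.
  by rewrite -(nth_index i (s_full i)) E nth_index.
rewrite neq_ltn => /orP[//|/L pji].
by have := pirr i; rewrite (ptr _ _ _ pij pji).
Qed.

Theorem theoremA (K : closedFieldType) (p n : nat)
  (p_char : p \in [pchar K]) (p_gt2 : (2 < p)%N)
  (pos : rel 'I_n) (pos_sys : positive_system pos)
  (chi : {scalar 'M[K]_n})
  (chi_npos : vanishes_on chi (npos K pos))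
  (chi_nneg : vanishes_on chi (nneg K pos))
  (lam : 'rV[K]_n) (lam_chi : weight_set p chi lam)
  (W : {vspace 'M[K]_(n + n)}) (W_lam : max_isotropic lam W) :
  supersimple (@baby_Verma_homog K n p chi lam W lam_chi W_lam pos pos_sys chi_npos)
  <-> Phi p lam != 0.
Proof.
have [s [s_uniq s_full s_pos]] := positive_enum pos_sys.
have p_gt0 : (0 < p)%N by apply: ltn_trans p_gt2.
rewrite -(chain_coef_Phi lam p_char s_uniq s_full).
set Z := baby_Verma lam_chi W_lam pos_sys chi_npos.
set v0 : kmod Z := verma_top pos_sys chi_npos lam_chi W_lam.
pose X := (fun l => letter_op l : {linear kmod Z -> kmod Z}).
have chi_off i j : i != j -> chi (delta_mx i j) = 0.
  move=> ij; have := weight_set_delta pos_sys p_gt0 chi_npos chi_nneg lam_chi i j.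
  by rewrite (negbTE ij) => /eqP; rewrite expf_eq0 p_gt0 => /eqP.
have qX : queer_action p X := letter_op_queer_action Z chi_off (ltnW p_gt2).
have v0_wt : has_weight X (lam 0) v0 := verma_top_weight pos_sys chi_npos lam_chi W_lam.
have v0_sing : singular X s v0.
  apply: (kill_singular s_uniq) => d i j; rewrite ltz_nat -s_pos => pij.
  exact: verma_top_upper.
have s_pos' i j : pos i j -> (index i s < index j s)%N by rewrite s_pos.
have T0 : act X (lowering_word p s) v0 != 0.
  exact: (@verma_lower_neq0 K p n p_char p_gt2 pos pos_sys chi chi_npos chi_nneg lam lam_chi
    W W_lam s s_uniq s_full s_pos').
have v0_neq0 : v0 != 0 by apply: contraNneq T0 => ->; rewrite linear0.
split=> [[_ simple]|c0].
  (* The submodule generated by y0 = T v0 is graded and nonzero. If it were all of Z, then v0 = u y0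
     for some u, and T v0 = T u T v0 = 0. *)
  apply/eqP => c0; pose t := lowering_word p s.
  pose y0 : Z := act X t v0.
  have y0_hom : baby_Verma_homog (wparity t) y0 := verma_word_homog pos_sys chi_npos lam_chi W_lam t.
  pose N (z : Z) := exists u, z = u *: y0.
  have N_sub : submodule N.
    split=> [|a _ _ [u ->] [v ->]]; first by exists 0; rewrite scale0r.
    by exists (a * u + v); rewrite scalerDl scalerA.
  have N_gr : graded_sub (@baby_Verma_homog K n p chi lam W lam_chi W_lam pos pos_sys chi_npos) N.
    move=> _ [u ->]; have [u0 [u1 [h0 h1 ->]]] := Uchi_parts u.
    have H0 := verma_homogM h0 y0_hom; have H1 := verma_homogM h1 y0_hom.
    rewrite scalerDl; case: (wparity t) H0 H1 => /= H0 H1.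
      by exists (u1 *: y0), (u0 *: y0); split; [exact: H1|exact: H0|exists u1|exists u0|exact: addrC].
    by exists (u0 *: y0), (u1 *: y0); split; [exact: H0|exact: H1|exists u0|exists u1|].
  have [N0|/(_ v0) [u Eu]] := simple N N_sub N_gr.
    by move/eqP: T0; apply; apply: N0; exists 1; rewrite scale1r.
  case/eqP: T0; rewrite Eu; elim: (Uchi_word_span (M := Z) y0 u) => [|c _ z [w ->] _ IH].
    by rewrite linear0.
  by rewrite linearD linearZ /= IH (lower_lower p_char p_gt2 qX s_uniq s_full v0_sing v0_wt) // scaler0 addr0.
split; first by exists v0.
move=> N N_sub N_gr; have [N_nz|] := pselect (exists x, N x /\ x != 0); last first.
  by move=> H; left=> x Nx; apply/eqP/negP => /negP x0; apply: H; exists x.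
right; apply: (verma_gen_ind N_sub).
have NZ (a : Uchi p chi (queer K n)) (x : Z) : N x -> N (a *: x).
  by move=> Nx; rewrite -[a *: x]addr0; apply: N_sub.2 => //; exact: N_sub.1.
have NK c (x : kmod Z) : N x -> N (c *: x) by move=> Nx; exact: NZ.
have Nact w (x : kmod Z) : N x -> N (act X w x).
  by move=> Nx; elim: w => //= l w IH; exact: NZ.
(* A graded submodule contains the components of its elements, and one component of a nonzero
   element is nonzero; [top_vector] needs a definite parity. *)
have [d [x [Nx x0 xh]]] : exists d (x : Z), [/\ N x, x != 0 & baby_Verma_homog d x].
  have [x [Nx x0]] := N_nz; have [x_0 [x_1 [h0 h1 N0 N1 Ex]]] := N_gr x Nx.
  have [E|E] := eqVneq x_0 0; last by exists false, x_0.
  exists true, x_1; split; [exact: N1| |exact: h1].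
  apply: contraNneq x0 => E1; apply/eqP; apply: etrans Ex _; rewrite E E1; exact: addr0.
(* Words in the root vectors bring x to a nonzero multiple of some y in U(h) v0, and irreducibility
   of the Clifford module recovers v0 from y. *)
have [w [e [y [c [Yy y0 c_neq0 Ew]]]]] :=
  top_vector p_char p_gt2 qX s_uniq s_full v0_sing v0_wt c0 (verma_homog_span xh) x0.
have Ny : N y.
  have := NK c^-1 _ (Nact w _ Nx); rewrite Ew scalerA mulVf // scale1r; exact.
apply: (cartan_irreducible p_char p_gt2 qX v0_wt _ _ NK _ Yy y0 Ny).
- exact: verma_top_W.
- by move=> z; exact: (odd_mx_max W_lam).
by move=> c' z Nz; rewrite odd_op_gen; exact: NZ.
Qed.
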